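(* Let $A:C^\infty(\mathbb T^n)\to C^\infty(\mathbb T^n)$ be a continuous linear operator with toroidal symbol $\sigma_A$. Suppose there is a constant $C$ such that $$\left|\partial_x^\beta\sigma_A(x,\xi)\right|\le C$$ for all $x\in\mathbb T^n$, all $\xi\in\mathbb Z^n$ and all multi-indices $\beta\in\mathbb N^n$ with $|\beta|\le n/2+1$. Then $A\in\mathcal L(L^2(\mathbb T^n))$, i.e. $A$ extends to a bounded linear operator on $L^2(\mathbb T^n)$.
   Context: $\mathbb T^n=(\mathbb R/2\pi\mathbb Z)^n$. $C^\infty(\mathbb T^n)$ carries its usual test function topology. The symbol of $A$ is $\sigma_A(x,\xi):=e^{-ix\cdot\xi}(Ae_\xi)(x)$ for $x\in\mathbb T^n$, $\xi\in\mathbb Z^n$, where $e_\xi(x)=e^{ix\cdot\xi}$; it is smooth in $x$ for each $\xi$, and $(Af)(x)=\sum_{\xi\in\mathbb Z^n}\sigma_A(x,\xi)\,\widehat f(\xi)\,e^{ix\cdot\xi}$ for $f\in C^\infty(\mathbb T^n)$, where $\widehat f(\xi)=(2\pi)^{-n}\int_{\mathbb T^n}f(x)e^{-ix\cdot\xi}\,dx$. *)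

(* Defs.v *)
From HB Require Import structures.
From mathcomp Require Import all_boot all_order all_algebra.
From mathcomp Require Import generic_quotient ring_quotient complex ring lra.
From mathcomp Require Import all_classical all_reals all_analysis measurable_realfun.

Set Implicit Arguments.
Unset Strict Implicit.
Unset Printing Implicit Defensive.

Import Order.TTheory GRing.Theory Num.Theory.
Import numFieldNormedType.Exports.

Local Open Scope classical_set_scope.
Local Open Scope ring_scope.
Local Open Scope complex_scope.

Section RealDerivatives.
Context {R : realType} {n : nat}.
Implicit Types (g h : 'rV[R]_n -> R) (i : 'I_n).

Definition partial i g : 'rV[R]_n -> R := fun x => 'D_(delta_mx 0 i) g x.

Definition partials (s : seq 'I_n) g := foldr partial g s.

(* All iterated partial derivatives, in any order, exist and are continuous. *)
Definition smooth g := forall s : seq 'I_n,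
  continuous (partials s g) /\
  forall x i, derivable (partials s g) x (delta_mx 0 i).

(* The derivative of multi-index b, of order \sum_i b i. *)
Definition mpartial (b : 'I_n -> nat) g :=
  foldr (fun i h => iter (b i) (partial i) h) g (enum 'I_n).

Lemma partialZD a g h i :
  (forall x i, derivable g x (delta_mx 0 i)) ->
  (forall x i, derivable h x (delta_mx 0 i)) ->
  partial i (fun x => a * g x + h x) = (fun x => a * partial i g x + partial i h x).
Proof.
move=> dg dh; apply/funext => x; rewrite /partial.
rewrite (_ : (fun x => _) = a *: g + h)//.
by rewrite deriveD ?deriveZ //; exact: derivableZ.
Qed.

Lemma partialsZD a g h s : smooth g -> smooth h ->
  partials s (fun x => a * g x + h x) =
  (fun x => a * partials s g x + partials s h x).
Proof.
move=> sg sh; elim: s => //= i s ->.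
by rewrite partialZD //; [case: (sg s)|case: (sh s)].
Qed.

Lemma smoothZD a g h : smooth g -> smooth h -> smooth (fun x => a * g x + h x).
Proof.
move=> sg sh s; rewrite partialsZD//; split.
  move=> x; have [cg _] := sg s; have [ch _] := sh s.
  by apply: (@cvgD _ _ _ _ _ _ _ _ _ (cvgM (cvg_cst _) (cg x)) (ch x)).
move=> x i; apply: (@derivableD _ _ _ (a *: partials s g)).
  by apply: derivableZ; have [_ +] := sg s; apply.
by have [_ +] := sh s; apply.
Qed.

Lemma partial_cst i (c : R) : partial i (fun=> c) = fun=> 0.
Proof. by apply/funext => x; rewrite /partial derive_cst. Qed.

Lemma smooth0 : smooth (fun=> 0).
Proof.
move=> s; have -> : partials s (fun=> 0) = fun=> 0.
  by elim: s => //= i s ->; rewrite partial_cst.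
by split => [|x i]; [exact: cst_continuous|exact: derivable_cst].
Qed.

End RealDerivatives.

Section SmoothFunctionsOnTheTorus.
Context (R : realType) (n : nat).
Implicit Types f : 'rV[R]_n -> R[i].

(* Smoothness and partial derivatives of a complex-valued function are taken on
   its real and imaginary parts, R[i] being a normed module over R[i] only. *)
Definition csmooth f := smooth (@complex.Re R \o f) /\ smooth (@complex.Im R \o f).

Definition cmpartial (b : 'I_n -> nat) f : 'rV[R]_n -> R[i] :=
  fun x => mpartial b (@complex.Re R \o f) x +i* mpartial b (@complex.Im R \o f) x.

(* Functions on (R / 2 pi Z)^n are identified with the functions on R^n that are
   2 pi-periodic in each coordinate. *)
Definition torus_periodic f :=
  forall i : 'I_n, periodic f (2 * pi *: delta_mx 0 i).

Definition torus_smooth : {pred 'rV[R]_n -> R[i]} :=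
  mem [set f | torus_periodic f /\ csmooth f].

Lemma torus_smooth_submod_closed : submod_closed torus_smooth.
Proof.
split.
  rewrite inE; split=> //; split.
    by rewrite (_ : _ \o _ = fun=> 0)//; exact: smooth0.
  by rewrite (_ : _ \o _ = fun=> 0)//; exact: smooth0.
move=> a f g /[!inE] -[pf [rf jf]] [pg [rg jg]]; split.
  by move=> i x; rewrite /= !fctE pf pg.
have sD (c d : R) (u v : 'rV[R]_n -> R) (h : 'rV[R]_n -> R) :
    smooth u -> smooth v -> smooth h ->
    smooth (fun x => c * u x + (d * v x + h x)).
  by move=> su sv sh; apply: smoothZD => //; exact: smoothZD.
split.
  have -> : @complex.Re R \o (a *: f + g) = fun x =>
      complex.Re a * (@complex.Re R \o f) x + (- complex.Im a * (@complex.Im R \o f) x + (@complex.Re R \o g) x).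
    apply/funext => x /=; rewrite !fctE; case: a => ar ai.
    by case: (f x) => ? ?; case: (g x) => ? ? /=; rewrite mulNr addrA.
  exact: sD.
have -> : @complex.Im R \o (a *: f + g) = fun x =>
    complex.Re a * (@complex.Im R \o f) x + (complex.Im a * (@complex.Re R \o f) x + (@complex.Im R \o g) x).
  apply/funext => x /=; rewrite !fctE; case: a => ar ai.
  by case: (f x) => ? ?; case: (g x) => ? ? /=; rewrite addrA.
exact: sD.
Qed.

HB.instance Definition _ := GRing.isSubmodClosed.Build R[i] _ torus_smooth
  torus_smooth_submod_closed.

Record Cinf := MkCinf {
  Cinf_fun :> 'rV[R]_n -> R[i] ;
  _ : Cinf_fun \in torus_smooth }.

HB.instance Definition _ := [isSub for Cinf_fun].
HB.instance Definition _ := [Choice of Cinf by <:].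
HB.instance Definition _ := [SubChoice_isSubLmodule of Cinf by <:].

(* The test function topology: the coarsest one making every f |-> d^b f
   continuous for uniform convergence. *)
HB.instance Definition _ := Uniform.copy Cinf
  (sup_topology (fun b : 'I_n -> nat => Uniform.class
    (initial_topology (fun f : Cinf =>
       cmpartial b f : {uniform 'rV[R]_n -> R[i]^o})))).

End SmoothFunctionsOnTheTorus.

Section Characters.
Context {R : realType} {n : nat}.
Implicit Types (xi : 'rV[int]_n) (x : 'rV[R]_n).

Definition dotz x xi : R := \sum_(i < n) x 0 i * (xi 0 i)%:~R.

(* e^{it} *)
Definition expi (t : R) : R[i] := cos t +i* sin t.

Definition character xi x : R[i] := expi (dotz x xi).

Lemma dotzD x y xi : dotz (x + y) xi = dotz x xi + dotz y xi.
Proof.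
by rewrite /dotz -big_split/=; apply: eq_bigr => i _; rewrite mxE mulrDl.
Qed.

Lemma dotzZ a x xi : dotz (a *: x) xi = a * dotz x xi.
Proof.
by rewrite /dotz mulr_sumr; apply: eq_bigr => i _; rewrite mxE mulrA.
Qed.

Lemma dotz_delta i xi : dotz (delta_mx 0 i) xi = (xi 0 i)%:~R.
Proof.
rewrite /dotz (bigD1 i)//= big1 ?addr0 => [|j /negbTE ji].
  by rewrite mxE !eqxx mul1r.
by rewrite mxE eqxx ji mul0r.
Qed.

Lemma continuous_dotz xi : continuous (fun x => dotz x xi).
Proof.
rewrite /dotz; elim: (index_enum _) => [|i s IH].
  by under eq_fun do rewrite big_nil; exact: cst_continuous.
under eq_fun do rewrite big_cons.
move=> x; apply: (@cvgD _ _ _ _ _ _ _ _ _ _ (IH x)).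
exact: (cvgM (@coord_continuous R 1 n 0 i x) (cvg_cst _)).
Qed.

Let is_derive_trig (a b : R) xi x v :
  is_derive x v (fun x => a * cos (dotz x xi) + b * sin (dotz x xi))
    (dotz v xi * (b * cos (dotz x xi) - a * sin (dotz x xi))).
Proof.
pose w := dotz v xi; pose d := dotz x xi.
have lineE (g : R -> R) y : g (dotz (y *: v + x) xi) = g (y * w + d).
  by rewrite dotzD dotzZ.
have D : is_derive (0 : R) 1 (fun t : R => a * cos (t * w + d) + b * sin (t * w + d))
    (w * (b * cos d - a * sin d)).
  have Dl : is_derive (0 : R) 1 (fun t : R => t * w + d) w.
    by apply: is_derive_eq; rewrite scaler0 add0r addr0 [LHS]mulr1.
  have /(is_deriveZ a) Dc : is_derive (0 : R) 1 (fun t : R => cos (t * w + d)) (w * - sin d).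
    apply: (is_derive_eq (@is_derive1_comp _ (@cos R) _ _ _ _ _ Dl)); rewrite mul0r add0r; ring.
  have /(is_deriveZ b) Ds : is_derive (0 : R) 1 (fun t : R => sin (t * w + d)) (w * cos d).
    apply: (is_derive_eq (@is_derive1_comp _ (@sin R) _ _ _ _ _ Dl)); rewrite mul0r add0r; ring.
  by apply: (is_derive_eq (is_deriveD Dc Ds)); rewrite /GRing.scale/=; ring.
have E : (fun h : R => h^-1 *: (((fun y => a * cos (dotz y xi) + b * sin (dotz y xi))
     \o shift x) (h *: v) - (a * cos (dotz x xi) + b * sin (dotz x xi)))) =
   (fun h : R => h^-1 *: (((fun t : R => a * cos (t * w + d) + b * sin (t * w + d))
     \o shift 0) (h *: 1) - (a * cos (0 * w + d) + b * sin (0 * w + d)))).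
  apply/funext => h; rewrite /= (lineE cos) (lineE sin) addr0 mul0r add0r.
  by rewrite [h *: 1]mulr1.
split; first by rewrite /derivable E; exact: (@ex_derive _ _ _ _ _ _ _ D).
by rewrite /derive E; exact: (@derive_val _ _ _ _ _ _ _ D).
Qed.

Let expiD2pi (t : R) (k : int) : expi (t + 2 * pi * k%:~R) = expi t.
Proof.
have expin u m : expi (u + 2 * pi * m%:R) = expi u.
  rewrite /expi -mulrA mulr_natl mulr_natr -mulrnA mulnC mulrnA.
  by rewrite (periodicn (@cosD2pi R)) (periodicn (@sinD2pi R)).
case: k => m; first exact: expin.
by rewrite NegzE mulrNz mulrN -[LHS](expin _ m.+1) subrK.
Qed.

Let partials_trig (a b : R) xi (s : seq 'I_n) : exists c d,
  partials s (fun x => a * cos (dotz x xi) + b * sin (dotz x xi)) =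
  (fun x => c * cos (dotz x xi) + d * sin (dotz x xi)).
Proof.
elim: s => [|i s [c [d /= ->]]]; first by exists a, b.
exists ((xi 0 i)%:~R * d), (- (xi 0 i)%:~R * c); apply/funext => x.
rewrite /partial (@derive_val _ _ _ _ _ _ _ (is_derive_trig c d xi x _)).
by rewrite dotz_delta mulrBr mulrA mulNr mulNr mulrA.
Qed.

Let smooth_trig (a b : R) xi :
  smooth (fun x => a * cos (dotz x xi) + b * sin (dotz x xi)).
Proof.
move=> s; have [c [d ->]] := partials_trig a b xi s; split; last first.
  by move=> x i; exact: (@ex_derive _ _ _ _ _ _ _ (is_derive_trig c d xi x _)).
move=> x; have cc (g : R -> R) : continuous g ->
    (g (dotz y xi) @[y --> x] --> g (dotz x xi)).
  by move=> cg; apply: (cvg_comp _ _ (continuous_dotz (x := x)) (cg _)).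
apply: (@cvgD _ _ _ _ _ _ _ _ _ (cvgM (cvg_cst _) (cc _ _)) (cvgM (cvg_cst _) (cc _ _))).
  exact: continuous_cos.
exact: continuous_sin.
Qed.

Lemma character_torus_smooth xi : character xi \in @torus_smooth R n.
Proof.
rewrite inE; split.
  move=> i x; rewrite /character /expi dotzD dotzZ dotz_delta.
  exact: expiD2pi.
split.
  have := smooth_trig 1 0 xi; congr smooth; apply/funext => x /=.
  by rewrite mul1r mul0r addr0.
have := smooth_trig 0 1 xi; congr smooth; apply/funext => x /=.
by rewrite mul1r mul0r add0r.
Qed.

Definition e_ xi : Cinf R n := MkCinf (character_torus_smooth xi).

(* sigma_A(x, xi) = e^{-i x.xi} (A e_xi)(x) *)
Definition symbol (A : Cinf R n -> Cinf R n) x xi : R[i] :=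
  expi (- dotz x xi) * A (e_ xi) x.

End Characters.

Definition measure_row_display : measure_display.
Proof. exact: default_measure_display. Qed.

(* 'rV[R]_n carries the product sigma-algebra of its n coordinates. *)
Section measurable_row.
Context (R : realType) (n : nat).

Let coor : 'I_n -> 'rV[R]_n -> measurableTypeR R := fun i x => x 0 i.

Let row_set0 : g_sigma_preimage coor set0.
Proof. exact: sigma_algebra0. Qed.

Let row_setC A : g_sigma_preimage coor A -> g_sigma_preimage coor (~` A).
Proof. exact: sigma_algebraC. Qed.

Let row_bigcup (F : _^nat) : (forall i, g_sigma_preimage coor (F i)) ->
  g_sigma_preimage coor (\bigcup_i (F i)).
Proof. exact: sigma_algebra_bigcup. Qed.

HB.instance Definition _ := @isMeasurable.Build
  measure_row_display 'rV[R]_n (g_sigma_preimage coor) row_set0 row_setC row_bigcup.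

End measurable_row.

Lemma measurable_coord (R : realType) (n : nat) (i : 'I_n) :
  measurable_fun setT (fun x : 'rV[R]_n => x 0 i : measurableTypeR R).
Proof.
move=> _ Y mY; rewrite setTI; apply: sub_sigma_algebra => /=.
rewrite -bigcup_seq/=; exists i => /=; first by rewrite mem_index_enum.
by exists Y => //; rewrite setTI.
Qed.

Lemma measurable_fun_row d (T : measurableType d) (R : realType) (n : nat)
    (f : T -> 'rV[R]_n) :
  (forall i, measurable_fun setT (fun t => f t 0 i : measurableTypeR R)) ->
  measurable_fun setT f.
Proof.
move=> mf _ A mA; rewrite setTI.
have : (preimage_set_system setT f
    (g_sigma_preimage (fun i (x : 'rV[R]_n) => x 0 i : measurableTypeR R)))
    (f @^-1` A) by exists A; rewrite ?setTI.
rewrite -g_sigma_preimage_comp; apply: smallest_sub.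
  exact: sigma_algebra_measurable.
move=> B; rewrite -bigcup_seq => -[i _ [C mC <-]]; exact: mf.
Qed.

Section TorusMeasure.
Context (R : realType).

Definition period : set (measurableTypeR R) := `[0, 2 * pi]%classic.

Let measurable_period : measurable period.
Proof. exact: measurable_itv. Qed.

Let lebesgue_period : (lebesgue_measure period < +oo)%E.
Proof. exact: compact_finite_measure (@segment_compact _ _ _). Qed.

(* Lebesgue measure on R, restricted to [0, 2 pi]. *)
Definition circle_measure : set (measurableTypeR R) -> \bar R :=
  mfrestr measurable_period lebesgue_period.

HB.instance Definition _ := FiniteMeasure.on circle_measure.

Definition row_cons n (p : measurableTypeR R * 'rV[R]_n) : 'rV[R]_n.+1 :=
  \row_i if unlift 0 i is Some j then p.2 0 j else p.1.

Lemma measurable_row_cons n : measurable_fun setT (@row_cons n).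
Proof.
apply: measurable_fun_row => i.
under eq_fun do rewrite mxE.
case: unliftP => [j ij|i0]; last exact: measurable_fst.
exact: (measurableT_comp (@measurable_coord R n j) measurable_snd).
Qed.

Section Step.
Context n (mu : {finite_measure set 'rV[R]_n -> \bar R}).

Definition cons_measure :=
  pushforward (circle_measure \x mu)%E (@row_cons n).

Let cons_measure0 : cons_measure set0 = 0%E.
Proof. by rewrite /cons_measure /pushforward preimage_set0 measure0. Qed.

Let cons_measure_ge0 A : (0 <= cons_measure A)%E.
Proof. by rewrite /cons_measure /pushforward; exact: measure_ge0. Qed.

Let cons_measure_sigma_additive : semi_sigma_additive cons_measure.
Proof.
rewrite /cons_measure => F; have /(_ F) := @measure_semi_sigma_additive _ _ _
  (measure_function_pushforward__canonical__measure_function_Measure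
    (circle_measure \x mu)%E (@measurable_row_cons n)); exact.
Qed.

HB.instance Definition _ := isMeasure.Build _ _ _ cons_measure
  cons_measure0 cons_measure_ge0 cons_measure_sigma_additive.

Let cons_measure_fin : fin_num_fun cons_measure.
Proof.
suff : (cons_measure setT < +oo)%E by exact: lty_fin_num_fun.
rewrite [ltLHS](_ : _ = (circle_measure \x mu)%E (setT `*` setT)); last first.
  by rewrite setXTT.
rewrite product_measure1E//.
by apply: lte_mul_pinfty => //; [exact: fin_num_measure|rewrite ltey_eq fin_num_measure].
Qed.

HB.instance Definition _ := Measure_isFinite.Build _ _ _ cons_measure
  cons_measure_fin.

End Step.

(* The n-fold product of circle_measure, i.e. Lebesgue measure on the fundamental
   domain [0, 2 pi]^n of the torus (a point mass when n = 0). *)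
Fixpoint torus_measure n : {finite_measure set 'rV[R]_n -> \bar R} :=
  if n is m.+1 then cons_measure (torus_measure m) else dirac (0 : 'rV[R]_0).

End TorusMeasure.

Section SquareIntegrable.
Context (R : realType) (n : nat).
Implicit Types f g : 'rV[R]_n -> R[i].
Let mu := torus_measure R n.

Definition cmeasurable f :=
  measurable_fun setT (@complex.Re R \o f) /\
  measurable_fun setT (@complex.Im R \o f).

Definition Lnorm2 f : \bar R := 'N[mu]_2%:E [EFin \o @Normc.normc R \o f].

(* torus_measure only sees [0, 2 pi]^n, so no periodicity is required: a.e.
   classes of such functions are the elements of L^2 of the torus. *)
Definition square_integrable : {pred 'rV[R]_n -> R[i]} :=
  mem [set f | cmeasurable f /\ (Lnorm2 f < +oo)%E].

Lemma normc_sqr (z : R[i]) :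
  Normc.normc z ^+ 2 = complex.Re z ^+ 2 + complex.Im z ^+ 2.
Proof. by case: z => a b /=; rewrite sqr_sqrtr// addr_ge0// sqr_ge0. Qed.

Lemma Lnorm2_lty f : (Lnorm2 f < +oo)%E <->
  (\int[mu]_x (complex.Re (f x) ^+ 2 + complex.Im (f x) ^+ 2)%:E < +oo)%E.
Proof.
have <- : (\int[mu]_x (`|(Normc.normc (f x))%:E| `^ 2) =
    \int[mu]_x (complex.Re (f x) ^+ 2 + complex.Im (f x) ^+ 2)%:E)%E.
  apply: eq_integral => x _; rewrite -normc_sqr abse_EFin poweR_EFin.
  by rewrite powR_mulrn// real_normK// num_real.
rewrite /Lnorm2 unlock; split; last exact: poweR_lty.
by apply: lty_poweRy; rewrite invr_eq0 pnatr_eq0.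
Qed.

Lemma cmeasurable_sqr f : cmeasurable f ->
  measurable_fun setT (EFin \o (fun x =>
    complex.Re (f x) ^+ 2 + complex.Im (f x) ^+ 2)).
Proof.
move=> [mr mi]; apply/measurable_EFinP; apply: measurable_funD.
  exact: (measurable_funX 2 mr).
exact: (measurable_funX 2 mi).
Qed.

Lemma cmeasurableZD (a : R[i]) f g :
  cmeasurable f -> cmeasurable g -> cmeasurable (a *: f + g).
Proof.
move=> [rf jf] [rg jg]; split.
  have -> : @complex.Re R \o (a *: f + g) = fun x =>
      complex.Re a * (@complex.Re R \o f) x - complex.Im a * (@complex.Im R \o f) x
      + (@complex.Re R \o g) x.
    apply/funext => x /=; rewrite !fctE; case: a => ar ai.
    by case: (f x) => ? ?; case: (g x) => ? ? /=.
  apply: measurable_funD => //; apply: measurable_funB; exact: measurable_funM.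
have -> : @complex.Im R \o (a *: f + g) = fun x =>
    complex.Re a * (@complex.Im R \o f) x + complex.Im a * (@complex.Re R \o f) x
      + (@complex.Im R \o g) x.
  apply/funext => x /=; rewrite !fctE; case: a => ar ai.
  by case: (f x) => ? ?; case: (g x) => ? ? /=.
apply: measurable_funD => //; apply: measurable_funD; exact: measurable_funM.
Qed.

Lemma square_integrable_submod_closed : submod_closed square_integrable.
Proof.
split.
  rewrite inE; split; first by split; exact: measurable_cst.
  rewrite Lnorm2_lty; under eq_integral do rewrite /= !expr0n/= addr0.
  by rewrite integral0.
move=> a f g /[!inE] -[mf lf] [mg lg]; split; first exact: cmeasurableZD.
move: lf lg; rewrite !Lnorm2_lty => lf lg.
have Q0 h (x : 'rV[R]_n) : (0 <= (complex.Re (h x) ^+ 2 + complex.Im (h x) ^+ 2)%:E :> \bar R)%E.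
  by rewrite lee_fin addr_ge0// sqr_ge0.
pose c := 2 * (complex.Re a ^+ 2 + complex.Im a ^+ 2).
have c0 : 0 <= c by rewrite mulr_ge0// addr_ge0// sqr_ge0.
apply: (@le_lt_trans _ _ (\int[mu]_x
  (c%:E * (complex.Re (f x) ^+ 2 + complex.Im (f x) ^+ 2)%:E +
   2%:E * (complex.Re (g x) ^+ 2 + complex.Im (g x) ^+ 2)%:E))%E).
  apply: ge0_le_integral => //.
  - exact: (cmeasurable_sqr (cmeasurableZD a mf mg)).
  - by apply: emeasurable_funD; apply: measurable_funeM;
      [exact: (cmeasurable_sqr mf)|exact: (cmeasurable_sqr mg)].
  - move=> x _; rewrite -!EFinM -EFinD lee_fin !fctE /c.
    case: a {c c0} => p q; case: (f x) => u v; case: (g x) => s t /=.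
    rewrite -subr_ge0.
    rewrite (_ : _ - _ = (p * u - q * v - s) ^+ 2 + (p * v + q * u - t) ^+ 2).
      by rewrite addr_ge0// sqr_ge0.
    by ring.
rewrite ge0_integralD//.
- rewrite !ge0_integralZl_EFin//.
  + by rewrite lte_add_pinfty// lte_mul_pinfty// ?lee_fin.
  + exact: (cmeasurable_sqr mg).
  + exact: (cmeasurable_sqr mf).
- by move=> x _; rewrite mule_ge0.
- by apply: measurable_funeM; exact: (cmeasurable_sqr mf).
- by move=> x _; rewrite mule_ge0.
- by apply: measurable_funeM; exact: (cmeasurable_sqr mg).
Qed.

HB.instance Definition _ := GRing.isSubmodClosed.Build R[i] _ square_integrable
  square_integrable_submod_closed.

Record L2fun := MkL2fun {
  L2fun_fun :> 'rV[R]_n -> R[i] ;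
  _ : L2fun_fun \in square_integrable }.

HB.instance Definition _ := [isSub for L2fun_fun].
HB.instance Definition _ := [Choice of L2fun by <:].
HB.instance Definition _ := [SubChoice_isSubLmodule of L2fun by <:].

Definition L2null : {pred L2fun} := mem [set f : L2fun | {ae mu, forall x, f x = 0}].

Lemma L2null_submod_closed : submod_closed L2null.
Proof.
split; first by rewrite inE; apply: aeW.
move=> a f g /[!inE] f0 g0; apply: filterS2 f0 g0 => x fx gx.
by rewrite /= !fctE fx gx scaler0 addr0.
Qed.

HB.instance Definition _ := GRing.isSubmodClosed.Build R[i] _ L2null
  L2null_submod_closed.

Definition L2 : Type := Quotient.quot L2null.

HB.instance Definition _ := Choice.on L2.
HB.instance Definition _ := GRing.Zmodule.on L2.
HB.instance Definition _ := EqQuotient.on L2.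

Local Open Scope quotient_scope.

Definition L2class (f : L2fun) : L2 := \pi_(Quotient.quot L2null) f.

Lemma L2classP (f g : L2fun) :
  L2class f = L2class g <-> {ae mu, forall x, f x = g x}.
Proof.
transitivity (f - g \in L2null).
  split=> [/eqP|h]; first by rewrite -Quotient.idealrBE.
  by apply/eqP; rewrite -Quotient.idealrBE.
rewrite inE /=; split; apply: filterS => x.
  by rewrite /= !fctE => /eqP; rewrite subr_eq0 => /eqP.
by rewrite /= !fctE => ->; rewrite subrr.
Qed.

Definition L2scale (a : R[i]) (u : L2) : L2 := L2class (a *: (repr u : L2fun)).

Lemma L2classZ a (f : L2fun) : L2scale a (L2class f) = L2class (a *: f).
Proof.
apply/L2classP; have /L2classP : L2class (repr (L2class f)) = L2class f by exact: reprK.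
by apply: filterS => x; rewrite /= !fctE => ->.
Qed.

Lemma L2classD (f g : L2fun) : L2class (f + g) = L2class f + L2class g.
Proof. exact: raddfD. Qed.

Lemma L2class_surj (u : L2) : L2class (repr u) = u.
Proof. exact: reprK. Qed.

Let L2scaleA a b u : L2scale a (L2scale b u) = L2scale (a * b) u.
Proof. by rewrite -[u]L2class_surj !L2classZ scalerA. Qed.

Let L2scale1 : left_id 1 L2scale.
Proof. by move=> u; rewrite -[u]L2class_surj L2classZ scale1r. Qed.

Let L2scaleDr : right_distributive L2scale +%R.
Proof.
move=> a u v; rewrite -[u]L2class_surj -[v]L2class_surj.
by rewrite -L2classD !L2classZ -L2classD scalerDr.
Qed.

Let L2scaleDl u : {morph L2scale^~ u : a b / a + b}.
Proof.
by move=> a b; rewrite -[u]L2class_surj !L2classZ -L2classD scalerDl.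
Qed.

HB.instance Definition _ := GRing.Zmodule_isLmodule.Build R[i] L2
  L2scaleA L2scale1 L2scaleDr L2scaleDl.

Definition L2norm (u : L2) : R := fine (Lnorm2 (repr u)).

Lemma L2normE (f : L2fun) : (L2norm (L2class f))%:E = Lnorm2 f.
Proof.
have -> : Lnorm2 f = Lnorm2 (repr (L2class f)).
  have /L2classP fE := L2class_surj (L2class f).
  have mL (h : L2fun) : measurable_fun setT
      (fun x => (`|(EFin \o @Normc.normc R \o h) x| `^ 2)%E).
    have [+ _] : cmeasurable h /\ (Lnorm2 h < +oo)%E by have := valP h; rewrite inE.
    move=> /cmeasurable_sqr; congr measurable_fun; apply/funext => x /=.
    by rewrite -normc_sqr powR_mulrn// real_normK// num_real.
  rewrite /Lnorm2 unlock; congr (_ `^ _)%E.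
  apply: ae_eq_integral => //.
  by apply: filterS fE => x fx _ /=; rewrite fx.
rewrite fineK// ge0_fin_numE ?Lnorm_ge0//.
by have := valP (repr (L2class f)); rewrite inE => -[].
Qed.

End SquareIntegrable.

Section ContinuousMeasurable.
Context (R : realType) (n : nat).

Let box (q : 'rV[rat]_n) (k : nat) : set 'rV[R]_n :=
  [set x | forall i, `|x 0 i - ratr (q 0 i)| < k.+1%:R^-1].

Let measurable_box q k : measurable (box q k).
Proof.
rewrite (_ : box q k = \bigcap_(i in [set: 'I_n])
    ((fun x : 'rV[R]_n => x 0 i : measurableTypeR R) @^-1`
      [set` `]ratr (q 0 i) - k.+1%:R^-1, ratr (q 0 i) + k.+1%:R^-1[])); last first.
  apply/seteqP; split=> x /= h i; first by move=> _; rewrite /= in_itv/= -ltr_distl; exact: h.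
  by have := h i Logic.I; rewrite /= in_itv/= -ltr_distl.
apply: fin_bigcap_measurable => // i _.
rewrite -[X in measurable X]setTI; exact: measurable_coord.
Qed.

Lemma continuous_measurable_row (f : 'rV[R]_n -> R) :
  continuous f -> measurable_fun setT f.
Proof.
move=> cf; apply: (measurability _ (RGenOInfty.measurableE R)) => //.
move=> _ [_ [a ->] <-]; rewrite setTI.
set U := _ @^-1` _.
have oU : open U.
  apply: open_comp; first by move=> x _; exact: cf.
  by rewrite set_itvE; exact: open_gt.
pose D := [set p : 'rV[rat]_n * nat | box p.1 p.2 `<=` U].
have -> : U = \bigcup_(p in D) box p.1 p.2.
  apply/seteqP; split=> [x Ux|x [p Dp]]; last exact: Dp.
  have /nbhs_ballP[e /= e0 xeU] : nbhs x U by exact: open_nbhs_nbhs.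
  have [k ke] : exists k : nat, k.+1%:R^-1 < e / 2.
    have e20 : 0 < e / 2 by rewrite divr_gt0.
    have [k _ kP] := near_infty_natSinv_lt (PosNum e20).
    by exists k; apply: kP => /=.
  have qP i : {q : rat | `|x 0 i - ratr q| < k.+1%:R^-1}.
    apply: cid; have k0 : 0 < k.+1%:R^-1 :> R by rewrite invr_gt0.
    have [|q] := @rat_in_itvoo R (x 0 i - k.+1%:R^-1) (x 0 i + k.+1%:R^-1).
      by rewrite ltrD2l gtrN.
    by rewrite in_itv/= -ltr_distl distrC; exists q.
  exists (\row_i sval (qP i), k); last first.
    by move=> i; rewrite mxE; exact: (svalP (qP i)).
  move=> y yq; apply: xeU; split=> // j i; rewrite ord1 /ball/=.
  have := yq i; rewrite /= mxE => yqi; have xqi := svalP (qP i).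
  rewrite -(subrKA (ratr (sval (qP i)))) (le_lt_trans (ler_normD _ _))//.
  rewrite [ltRHS]splitr ltrD//; first exact: lt_trans ke.
  by rewrite distrC; exact: lt_trans ke.
rewrite bigcup_mkcond; apply: countable_bigcupT_measurable => // p.
by case: ifPn => // _; exact: measurable0.
Qed.

End ContinuousMeasurable.

Section SmoothSquareIntegrable.
Context (R : realType) (n : nat).
Implicit Types f : 'rV[R]_n -> R[i].

Let periodic_row f (k : 'I_n -> int) x : torus_periodic f ->
  f (x + \row_i (2 * pi * (k i)%:~R)) = f x.
Proof.
move=> pf.
have pn i m y : f (y + (2 * pi * m%:R) *: delta_mx 0 i) = f y.
  by rewrite mulr_natr -scalerMnl; apply: (periodicn (pf i)).
have pz i (m : int) y : f (y + (2 * pi * m%:~R) *: delta_mx 0 i) = f y.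
  case: m => m; first exact: pn.
  by rewrite NegzE mulrNz mulrN scaleNr -[LHS](pn i m.+1) subrK.
rewrite [X in x + X]row_sum_delta; elim: (index_enum _) => [|i s IH] in x *.
  by rewrite big_nil addr0.
by rewrite big_cons addrA IH mxE pz.
Qed.

Let bounded_row (g : 'rV[R]_n -> R) : continuous g ->
  (forall (k : 'I_n -> int) x, g (x + \row_i (2 * pi * (k i)%:~R)) = g x) ->
  exists M, forall x, g x ^+ 2 <= M.
Proof.
move=> cg pg.
pose cube := [set v : 'rV[R]_n | forall i, `[0, 2 * pi]%classic (v ord0 i)].
have pi20 : 0 < 2 * pi :> R by rewrite mulr_gt0// pi_gt0.
have ccube : compact cube by apply: (@rV_compact R n (fun=> `[0, 2 * pi]%classic)) => i; exact: segment_compact.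
have cube0 : cube !=set0.
  by exists 0 => i; rewrite mxE/= in_itv/= lexx ltW.
have [|c _ cM] := @EVT_max_rV R n (fun x => g x ^+ 2) cube cube0 ccube.
  apply: continuous_subspaceT => x; exact: (cvgM (cg x) (cg x)).
exists (g c ^+ 2) => x.
rewrite -(pg (fun i => - Num.floor (x 0 i / (2 * pi))) x).
apply: cM; rewrite inE => i /=; rewrite !mxE in_itv/=.
have := floor_le (x 0 i / (2 * pi)).
have := floorD1_gt (x 0 i / (2 * pi)).
rewrite intrD rmorph1 rmorphN/=; move: (_%:~R) => m.
rewrite ltr_pdivrMr// ler_pdivlMr// => h1 h2; apply/andP; split; lra.
Qed.

Lemma torus_smooth_square_integrable f :
  f \in @torus_smooth R n -> f \in @square_integrable R n.
Proof.
rewrite !inE => -[pf [sr si]].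
have [cr _] := sr [::]; have [ci _] := si [::].
have mr := continuous_measurable_row cr.
have mi := continuous_measurable_row ci.
split=> //; rewrite Lnorm2_lty.
have [M Mr] : exists M, forall x, (@complex.Re R \o f) x ^+ 2 <= M.
  by apply: bounded_row => // k x; rewrite /= periodic_row.
have [N Ni] : exists M, forall x, (@complex.Im R \o f) x ^+ 2 <= M.
  by apply: bounded_row => // k x; rewrite /= periodic_row.
apply: (@le_lt_trans _ _ (\int[torus_measure R n]_x (M + N)%:E)%E).
  apply: ge0_le_integral => //.
  - by move=> x _; rewrite lee_fin addr_ge0// sqr_ge0.
  - exact: (@cmeasurable_sqr R n f (conj mr mi)).
  - by move=> x _; rewrite lee_fin lerD//; [exact: Mr|exact: Ni].
rewrite integral_cst// lte_mul_pinfty//.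
  rewrite lee_fin (le_trans _ (lerD (Mr 0) (Ni 0)))//.
  by rewrite addr_ge0// sqr_ge0.
by rewrite ltey_eq fin_num_measure.
Qed.

Definition L2_of_Cinf (f : Cinf R n) : L2 R n :=
  L2class (MkL2fun (torus_smooth_square_integrable (valP f))).

End SmoothSquareIntegrable.

(* Main.v *)
(* Expand the symbol in a Fourier series in its first variable,
   sigma(x, xi) = sum_eta a(eta, xi) e^{i x.eta}. On a trigonometric polynomial
   p = sum_xi c_xi e_xi this gives A p = sum_eta e_eta (m_eta p), where m_eta is the
   Fourier multiplier with symbol a(eta, .). With the weight
   w(eta) = 1 + sum_i |eta_i|^{2k} and k = floor(n/2) + 1, so that 2k > n and
   sum 1/w < oo, Cauchy-Schwarz in eta followed by orthogonality of the characters
   bounds ||A p||^2 by (sum 1/w) sup_xi (sum_eta w(eta) |a(eta, xi)|^2) ||p||^2, and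
   the inner sum is at most (n + 1) C^2 by Bessel's inequality for sigma(., xi) and its
   derivatives of order k.

   The extension sends u to the L^2-limit of A S_N u, S_N u being the partial sums of
   the Fourier series of u: by Bessel's inequality they are Cauchy, so density of the
   trigonometric polynomials in L^2 is not needed. The limit agrees with A on smooth
   f because S_N f tends to f in the test function topology and A is continuous. *)

Require Import Defs.
From HB Require Import structures.
From mathcomp Require Import all_boot all_order all_algebra complex.
From mathcomp Require Import ring lra zify.
From mathcomp Require Import all_classical all_reals all_analysis measurable_realfun.

Set Implicit Arguments.
Unset Strict Implicit.
Unset Printing Implicit Defensive.

Import Order.TTheory GRing.Theory Num.Theory.
Import numFieldNormedType.Exports.

Local Open Scope classical_set_scope.
Local Open Scope ring_scope.
Local Open Scope complex_scope.

(** * Integration on the torus *)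

(** The pointwise expansion of the symbol is not a formality. Summable coefficients only give a
    uniform limit; to identify it with the function one needs that a continuous periodic function
    with vanishing Fourier coefficients is zero. This is proved by testing against powers of the
    trigonometric polynomial $\prod_i (1+\cos(x_i-a_i))/2$, which concentrate at $a$. The resulting
    inversion theorem serves twice. It expands $\sigma(\cdot,\xi)$, always for the finitely many
    $\xi$ of one trigonometric polynomial, so that a common truncation level can be chosen. It also
    gives $S_N f\to f$ in the test function topology, because $S_N$ commutes with derivatives.
    Orthogonality of the characters and the action of derivatives on coefficients both come from one
    fact: the integral of a partial derivative of a periodic function is zero. Norm estimates are
    made on squared norms of functions, with $\|f+g\|^2\le 2\|f\|^2+2\|g\|^2$ in the role of the
    triangle inequality; this explains the factors 2 in the constants. Classes modulo null functions
    enter only at the end. *)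

Section TorusIntegral.
Context (R : realType).
Implicit Types (n : nat).

(** [circle_measure] lives on the whole line but charges only [period]. Dropping the null complement
    leaves a Lebesgue integral over a segment, the form required by the fundamental theorem of
    calculus. *)
Lemma integral_circle (f : R -> R) M : continuous f -> (forall t, `|f t| <= M) ->
  (\int[@circle_measure R]_t (f t)%:E = \int[lebesgue_measure]_(t in @period R) (f t)%:E)%E.
Proof.
move=> cf fM.
have mf : measurable_fun [set: measurableTypeR R] f by exact: continuous_measurable_fun.
have mp : measurable (@period R) by exact: measurable_itv.
have fi : (@circle_measure R).-integrable setT (EFin \o f).
  apply: measurable_bounded_integrable => //.
    by rewrite ltey_eq fin_num_measure.
  by exists M; split; [exact: num_real|move=> K MK x _; exact: le_trans (fM x) (ltW MK)].
rewrite (@negligible_integral _ _ _ (@circle_measure R) setT (~` @period R))//; first last.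
- transitivity (lebesgue_measure (~` @period R `&` @period R)) => //.
  by rewrite setICl measure0.
- exact: measurableC.
rewrite setTD setCK.
apply: eq_measure_integral => A mA Ap.
transitivity (lebesgue_measure (A `&` @period R)) => //.
by rewrite setIidl.
Qed.

Lemma bounded_integrable d (T : measurableType d) (mu : {finite_measure set T -> \bar R})
    (f : T -> R) M :
  measurable_fun setT f -> (forall x, `|f x| <= M) -> mu.-integrable setT (EFin \o f).
Proof.
move=> mf fM; apply: measurable_bounded_integrable => //.
  by rewrite ltey_eq fin_num_measure.
by exists M; split; [exact: num_real|move=> K MK x _; exact: le_trans (fM x) (ltW MK)].
Qed.

Section Fubini.
Context n (F : 'rV[R]_n.+1 -> R) (M : R).
Hypotheses (mF : measurable_fun setT F) (FM : forall x, `|F x| <= M).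

Let intF : (@circle_measure R \x torus_measure R n)%E.-integrable setT
  (fun p => (F (@row_cons R n p))%:E).
Proof.
have mFc : measurable_fun setT (F \o @row_cons R n).
  exact: measurableT_comp (@measurable_row_cons R n).
apply: measurable_bounded_integrable => //.
  rewrite [ltLHS](_ : _ = (@circle_measure R \x torus_measure R n)%E (setT `*` setT)); last first.
    by rewrite setXTT.
  rewrite product_measure1E//.
  by apply: lte_mul_pinfty => //; [exact: fin_num_measure|rewrite ltey_eq fin_num_measure].
exists M; split; [exact: num_real|move=> K MK x _; exact: le_trans (FM _) (ltW MK)].
Qed.

Let pushE : (\int[torus_measure R n.+1]_x (F x)%:E =
  \int[(@circle_measure R \x torus_measure R n)]_p (F (@row_cons R n p))%:E)%E.
Proof.
have mE : measurable_fun setT (EFin \o F) by exact/measurable_EFinP.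
have := @integral_pushforward _ _ _ _ _ _ (@measurable_row_cons R n)
  (@circle_measure R \x torus_measure R n)%E setT (EFin \o F) mE.
rewrite preimage_setT => /(_ intF measurableT) <-.
by [].
Qed.

(** Both orders of integration are provided because the coordinate being differentiated in
    [integral_partial_eq0] has to belong to the inner integral. *)
Lemma torus_Fubini1 : (\int[torus_measure R n.+1]_x (F x)%:E =
  \int[@circle_measure R]_t \int[torus_measure R n]_y (F (row_cons (t, y)))%:E)%E.
Proof.
by rewrite pushE -(integral12_prod_meas1 intF).
Qed.

Lemma torus_Fubini2 : (\int[torus_measure R n.+1]_x (F x)%:E =
  \int[torus_measure R n]_y \int[@circle_measure R]_t (F (row_cons (t, y)))%:E)%E.
Proof.
by rewrite pushE -(integral21_prod_meas1 intF).
Qed.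

End Fubini.

End TorusIntegral.

(** When [phi] maps the line through [x] along [u] affinely onto the line through [phi x] along [v],
    the two difference quotients are the same function of [h]. Directional derivatives thus transfer
    without any total differentiability of [g]. *)
Lemma derive_shift_comp (R : realType) (V W : normedModType R) (g : W -> R)
    (phi : V -> W) (x u : V) (v : W) :
  (forall h : R, phi (h *: u + x) = h *: v + phi x) ->
  (derivable g (phi x) v -> derivable (g \o phi) x u) /\
  'D_u (g \o phi) x = 'D_v g (phi x).
Proof.
move=> phiE.
have E : (fun h : R => h^-1 *: (((g \o phi) \o shift x) (h *: u) - (g \o phi) x)) =
    (fun h : R => h^-1 *: ((g \o shift (phi x)) (h *: v) - g (phi x))).
  by apply/funext => h; rewrite /= phiE.
by split; rewrite /derivable /derive E.
Qed.

Section RowCons.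
Context (R : realType) (n : nat).
Implicit Types (t : R) (y : 'rV[R]_n).

Lemma row_cons_shiftl t y (h : R) :
  row_cons (h *: (1 : R) + t, y) = h *: delta_mx 0 0 + row_cons (t, y).
Proof.
apply/rowP => i; rewrite !mxE; case: unliftP => [j ->|->] /=.
  by rewrite mulr0 add0r.
by [].
Qed.

Lemma row_cons_shiftr t y (j : 'I_n) (h : R) :
  row_cons (t, h *: delta_mx 0 j + y) = h *: delta_mx 0 (lift 0 j) + row_cons (t, y).
Proof.
apply/rowP => i; rewrite !mxE; case: unliftP => [k ->|->] /=.
  by rewrite !mxE /= (inj_eq (@lift_inj _ ord0)).
by rewrite mulr0 add0r.
Qed.

Lemma continuous_row_consl y : continuous (fun t => row_cons (t, y)).
Proof.
have -> : (fun t => row_cons (t, y)) = (fun t => t *: delta_mx 0 0 + row_cons (0, y)).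
  by apply/funext => t; rewrite -row_cons_shiftl addr0 [t *: 1]mulr1.
move=> t; apply: cvgD; last exact: cvg_cst.
by apply: cvgZr_tmp; exact: cvg_id.
Qed.

Lemma continuous_row_consr t : continuous (fun y => row_cons (t, y)).
Proof.
move=> y A /nbhs_ballP[e /= e0 eA]; apply/nbhs_ballP; exists e => //= z yz; apply: eA.
split=> // i j; rewrite !mxE; case: unliftP => [k _|_] /=; last exact: ballxx.
by have [_] := yz; apply.
Qed.

End RowCons.

(** Fubini reduces the claim to the differentiated variable, where the integral over a period is the
    difference of two end values, equal by periodicity. *)
Lemma integral_partial_eq0 (R : realType) n (g : 'rV[R]_n -> R) (i : 'I_n) M :
  continuous g -> continuous (partial i g) ->
  (forall x, derivable g x (delta_mx 0 i)) -> (forall x, `|partial i g x| <= M) ->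
  periodic g (2 * pi *: delta_mx 0 i) ->
  (\int[torus_measure R n]_x (partial i g x)%:E = 0)%E.
Proof.
elim: n => [|n IH] in g i *; first by case: i.
move=> cg cdg dg dgM pg.
have mdg := continuous_measurable_row cdg.
have [j ij|i0] := unliftP ord0 i.
  rewrite (torus_Fubini1 mdg dgM); apply: integral0_eq => t _.
  have cE y : partial i g (row_cons (t, y)) = partial j (fun y => g (row_cons (t, y))) y.
    by rewrite ij [RHS](derive_shift_comp _ (fun h => row_cons_shiftr t y j h)).2.
  under eq_integral do rewrite cE.
  apply: IH.
  - by move=> y; apply: continuous_comp; [exact: continuous_row_consr|exact: cg].
  - rewrite (_ : partial j _ = fun y => partial i g (row_cons (t, y))); last first.
      by apply/funext => y; rewrite cE.
    by move=> y; apply: continuous_comp; [exact: continuous_row_consr|exact: cdg].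
  - move=> y; apply: (derive_shift_comp _ (fun h => row_cons_shiftr t y j h)).1.
    by rewrite -ij; exact: dg.
  - by move=> y; rewrite -cE.
  - by move=> y; rewrite /= addrC row_cons_shiftr -ij addrC pg.
rewrite (torus_Fubini2 mdg dgM); apply: integral0_eq => y _.
have cE t : partial i g (row_cons (t, y)) = derive1 (fun t => g (row_cons (t, y))) t.
  by rewrite i0 derive1E [RHS](derive_shift_comp _ (fun h => row_cons_shiftl t y h)).2.
have dG t : derivable (fun t => g (row_cons (t, y))) t 1.
  apply: (derive_shift_comp _ (fun h => row_cons_shiftl t y h)).1.
  by move: (dg (row_cons (t, y))); rewrite i0.
have cG : continuous (fun t => g (row_cons (t, y))).
  by move=> t; apply: continuous_comp; [exact: continuous_row_consl|exact: cg].
have cdG : continuous (fun t => partial i g (row_cons (t, y))).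
  by move=> t; apply: continuous_comp; [exact: continuous_row_consl|exact: cdg].
rewrite (integral_circle cdG (fun t => dgM _)).
have pi20 : 0 < 2 * pi :> R by rewrite mulr_gt0// pi_gt0.
rewrite (@continuous_FTC2 _ _ (fun t => g (row_cons (t, y))))//.
- rewrite -EFinB; congr EFin; apply/eqP; rewrite subr_eq0; apply/eqP.
  rewrite -[in LHS](addr0 (2 * pi)) -[X in X + _](mulr1 (2 * pi)) row_cons_shiftl addrC.
  by have := pg (row_cons (0, y)); rewrite i0.
- exact: continuous_subspaceT.
- split; first by move=> t _; exact: dG.
  + by apply: cvg_at_right_filter; exact: cG.
  + by apply: cvg_at_left_filter; exact: cG.
Qed.

(** * Boxes and the fundamental cube *)

Section TorusBox.
Context (R : realType).

Let box n (B : 'I_n -> set (measurableTypeR R)) := [set x : 'rV[R]_n | forall i, B i (x 0 i)].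

Lemma measurable_row_box n (B : 'I_n -> set (measurableTypeR R)) :
  (forall i, measurable (B i)) -> measurable (box B).
Proof.
move=> mB; rewrite (_ : box B = \bigcap_(i in [set: 'I_n])
    ((fun x : 'rV[R]_n => x 0 i : measurableTypeR R) @^-1` B i)); last first.
  by apply/seteqP; split=> x /= h i; [move=> _; exact: h|exact: (h i Logic.I)].
apply: fin_bigcap_measurable => // i _.
by rewrite -[X in measurable X]setTI; exact: measurable_coord.
Qed.

Lemma torus_measure_box n (B : 'I_n -> set (measurableTypeR R)) :
  (forall i, measurable (B i)) ->
  torus_measure R n [set x : 'rV[R]_n | forall i, B i (x 0 i)] =
  (\prod_(i < n) @circle_measure R (B i))%E.
Proof.
elim: n => [|n IH] in B * => mB.
  rewrite big_ord0 /= diracE mem_set//=.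
  by case.
rewrite big_ord_recl -(IH (fun j => B (lift ord0 j)))//.
rewrite -product_measure1E//; last first.
  by apply: (@measurable_row_box _ (fun j => B (lift ord0 j))).
congr ((_ \x _)%E _); apply/seteqP; split => [[t y] /= h|[t y] /= [h1 h2] i].
  split=> [|j]; first by have := h ord0; rewrite mxE unlift_none.
  by have := h (lift ord0 j); rewrite mxE liftK.
by rewrite mxE; case: unliftP => [j ->|->].
Qed.

Definition cube {n} : set 'rV[R]_n := [set x | forall i, @period R (x 0 i)].

Lemma measurable_cube n : measurable (@cube n).
Proof. by apply: (@measurable_row_box _ (fun=> @period R)) => i; exact: measurable_itv. Qed.

(** The cube and the whole space are both boxes, and their sides have the same [circle_measure];
    since the measure is finite, the difference is null. *)
Lemma torus_measure_setC_cube n : torus_measure R n (~` @cube n) = 0%E.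
Proof.
have cubeE : torus_measure R n (@cube n) = torus_measure R n setT.
  have -> : [set: 'rV[R]_n] = [set x | forall i, (@setT (measurableTypeR R)) (x 0 i)].
    by apply/seteqP; split.
  rewrite (@torus_measure_box _ (fun=> setT))//.
  rewrite (@torus_measure_box _ (fun=> @period R)); last by move=> i; exact: measurable_itv.
  apply: eq_bigr => i _.
  transitivity (lebesgue_measure (@period R `&` @period R)) => //.
  transitivity (lebesgue_measure (setT `&` @period R)) => //.
  by rewrite setIid setTI.
rewrite -setTD measureD//; [|exact: measurable_cube|].
  rewrite setTI.
  transitivity (torus_measure R n setT - torus_measure R n setT)%E.
    by congr (_ - _)%E; exact: cubeE.
  by rewrite subee// fin_num_measure.
by rewrite ltey_eq fin_num_measure.
Qed.

Lemma torus_measure_box_gt0 n (a b : 'I_n -> R) :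
  (forall i, a i < b i) -> (forall i, 0 <= a i) -> (forall i, b i <= 2 * pi) ->
  0 < fine (torus_measure R n [set x : 'rV[R]_n | forall i, x 0 i \in `]a i, b i[]).
Proof.
move=> ab a0 b2.
have mB i : measurable ([set` `]a i, b i[] : set (measurableTypeR R)) by exact: measurable_itv.
rewrite fine_gt0//; apply/andP; split; last first.
  by rewrite ltey_eq fin_num_measure//; exact: (measurable_row_box mB).
rewrite (torus_measure_box mB).
apply: (big_ind (fun x => (0 < x)%E)) => // [x y|i _]; first exact: mule_gt0.
have -> : (@circle_measure R [set` `]a i, b i[] =
    lebesgue_measure ([set` `]a i, b i[] `&` @period R))%E by [].
rewrite setIidl ?lebesgue_measure_itv/= ?lte_fin ?ab -?EFinB ?lte_fin ?subr_gt0//.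
move=> x /=; rewrite /period /= !in_itv/= => /andP[ax xb].
by rewrite (le_trans (a0 i) (ltW ax)) (le_trans (ltW xb) (b2 i)).
Qed.

Lemma torus_measure_setT_gt0 n : 0 < fine (torus_measure R n setT).
Proof.
have pi20 : 0 < 2 * pi :> R by rewrite mulr_gt0// pi_gt0.
apply: (lt_le_trans (@torus_measure_box_gt0 n (fun=> 0) (fun=> 2 * pi) _ _ _)) => //.
have mB : measurable [set x : 'rV[R]_n | forall i, x 0 i \in `]0, 2 * pi[].
  by apply: (@measurable_row_box _ (fun=> [set` `]0, 2 * pi[])) => i; exact: measurable_itv.
apply: fine_le; rewrite ?fin_num_measure//.
by apply: le_measure => //; rewrite inE.
Qed.

End TorusBox.

(** * The Hilbert space structure of L^2 *)

(* [conjc] and [Num.conj] share the notation [^*]; fixing one constant keeps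
   rewriting syntactic. *)
Definition cconj (R : realType) (z : R[i]) : R[i] := conjc z.
Arguments cconj : simpl never.
Local Notation "z ^*" := (cconj z) : ring_scope.
Local Notation "z ^*" := (cconj z) : complex_scope.

Section ComplexNumbers.
Context (R : realType).
Implicit Types z w : R[i].

Lemma ReD z w : complex.Re (z + w) = complex.Re z + complex.Re w.
Proof. by case: z; case: w. Qed.

Lemma ImD z w : complex.Im (z + w) = complex.Im z + complex.Im w.
Proof. by case: z; case: w. Qed.

Lemma ReM z w : complex.Re (z * w) =
  complex.Re z * complex.Re w - complex.Im z * complex.Im w.
Proof. by case: z; case: w. Qed.

Lemma ImM z w : complex.Im (z * w) =
  complex.Re z * complex.Im w + complex.Im z * complex.Re w.
Proof. by case: z; case: w. Qed.

Lemma mulcJ z : z * z^* = (Normc.normc z ^+ 2)%:C.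
Proof. by rewrite normc_sqr; case: z => a b; rewrite /cconj /=; simpc; congr (_ +i* _); ring. Qed.

Lemma ReJ z : complex.Re z^* = complex.Re z.
Proof. by case: z. Qed.

Lemma ImJ z : complex.Im z^* = - complex.Im z.
Proof. by case: z. Qed.

Lemma conjcD z w : (z + w)^* = z^* + w^*.
Proof. exact: rmorphD. Qed.

Lemma conjcM z w : (z * w)^* = z^* * w^*.
Proof. exact: rmorphM. Qed.

Lemma conjcN z : (- z)^* = - z^*.
Proof. exact: rmorphN. Qed.

Lemma conjcJ z : z^*^* = z.
Proof. exact: conjcK. Qed.

Lemma conjcR (a : R) : (a%:C)^* = a%:C.
Proof. exact: conjc_real. Qed.

Lemma conjcV z : (z^-1)^* = (z^*)^-1.
Proof. exact: conjc_inv. Qed.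

Lemma conjc_sum I (s : seq I) (f : I -> R[i]) :
  (\sum_(i <- s) f i)^* = \sum_(i <- s) (f i)^*.
Proof. exact: rmorph_sum. Qed.

Lemma realcM (a b : R) : (a * b)%:C = a%:C * b%:C.
Proof. exact: rmorphM. Qed.

Lemma realcD (a b : R) : (a + b)%:C = a%:C + b%:C.
Proof. exact: rmorphD. Qed.

Lemma realcB (a b : R) : (a - b)%:C = a%:C - b%:C.
Proof. exact: rmorphB. Qed.

Lemma realc_sum I (s : seq I) (f : I -> R) :
  (\sum_(i <- s) f i)%:C = \sum_(i <- s) (f i)%:C.
Proof. exact: rmorph_sum. Qed.

Lemma normc_ge0 z : 0 <= Normc.normc z.
Proof. by case: z => a b; exact: sqrtr_ge0. Qed.

Lemma Re_le_normc z : `|complex.Re z| <= Normc.normc z.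
Proof.
rewrite -(@ler_pXn2r _ 2)// ?nnegrE ?normc_ge0// normc_sqr real_normK ?num_real//.
by rewrite lerDl sqr_ge0.
Qed.

Lemma Im_le_normc z : `|complex.Im z| <= Normc.normc z.
Proof.
rewrite -(@ler_pXn2r _ 2)// ?nnegrE ?normc_ge0// normc_sqr real_normK ?num_real//.
by rewrite lerDr sqr_ge0.
Qed.

Lemma normc_le_ReIm z : Normc.normc z <= `|complex.Re z| + `|complex.Im z|.
Proof.
rewrite -(@ler_pXn2r _ 2)// ?nnegrE ?normc_ge0 ?addr_ge0// normc_sqr.
rewrite -(real_normK (num_real (complex.Re z))) -(real_normK (num_real (complex.Im z))).
by rewrite sqrrD -addrA lerD2l lerDr mulrn_wge0// mulr_ge0.
Qed.

Lemma normc_sum I (s : seq I) (f : I -> R[i]) :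
  Normc.normc (\sum_(i <- s) f i) <= \sum_(i <- s) Normc.normc (f i).
Proof.
elim: s => [|i s IH]; first by rewrite !big_nil Normc.normc0.
by rewrite !big_cons (le_trans (le_normcD _ _))// lerD2l.
Qed.

Lemma expiDM (s t : R) : expi (s + t) = expi s * expi t.
Proof. by rewrite /expi cosD sinD /GRing.mul /=; congr (_ +i* _); rewrite addrC. Qed.

Lemma expi0 : expi 0 = 1 :> R[i].
Proof. by rewrite /expi cos0 sin0. Qed.

Lemma expiN (t : R) : expi (- t) = (expi t)^*.
Proof. by rewrite /cconj /expi cosN sinN. Qed.

Lemma normc_expi (t : R) : Normc.normc (expi t) = 1.
Proof. by rewrite /= cos2Dsin2 sqrtr1. Qed.

End ComplexNumbers.

Section ComplexIntegral.
Context (R : realType) (n : nat).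
Let mu := torus_measure R n.
Implicit Types f g : 'rV[R]_n -> R[i].

Definition cintegrable f := mu.-integrable setT (EFin \o (@complex.Re R \o f)) /\
  mu.-integrable setT (EFin \o (@complex.Im R \o f)).

Definition cintegral f : R[i] :=
  Rintegral mu setT (@complex.Re R \o f) +i* Rintegral mu setT (@complex.Im R \o f).

Lemma cintegralZD (a : R[i]) f g : cintegrable f -> cintegrable g ->
  cintegral (fun x => a * f x + g x) = a * cintegral f + cintegral g.
Proof.
move=> [rf jf] [rg jg].
have lin (c d : R) (u v w : 'rV[R]_n -> R) : mu.-integrable setT (EFin \o u) ->
    mu.-integrable setT (EFin \o v) -> mu.-integrable setT (EFin \o w) ->
    Rintegral mu setT (fun x => c * u x + d * v x + w x) =
    c * Rintegral mu setT u + d * Rintegral mu setT v + Rintegral mu setT w.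
  move=> iu iv iw.
  have icu : mu.-integrable setT (EFin \o (fun x => c * u x)) by exact: (integrableZl measurableT c iu).
  have idv : mu.-integrable setT (EFin \o (fun x => d * v x)) by exact: (integrableZl measurableT d iv).
  rewrite RintegralD//; last exact: (integrableD measurableT icu idv).
  by rewrite RintegralD// !RintegralZl.
apply/eqP; rewrite eq_complex /= ; apply/andP; split; apply/eqP.
  rewrite (_ : _ \o _ = fun x => complex.Re a * (@complex.Re R \o f) x +
      (- complex.Im a) * (@complex.Im R \o f) x + (@complex.Re R \o g) x).
    by rewrite lin// ReD ReM/= mulNr.
  by apply/funext => x /=; rewrite ReD ReM mulNr.
rewrite (_ : _ \o _ = fun x => complex.Re a * (@complex.Im R \o f) x +
    complex.Im a * (@complex.Re R \o f) x + (@complex.Im R \o g) x).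
  by rewrite lin// ImD ImM/=.
by apply/funext => x /=; rewrite ImD ImM.
Qed.

Lemma cintegrable0 : cintegrable (fun=> 0).
Proof. by split; exact: integrable0. Qed.

Lemma cintegralZ (a : R[i]) f : cintegrable f ->
  cintegral (fun x => a * f x) = a * cintegral f.
Proof.
move=> fi; have := cintegralZD a fi cintegrable0.
under eq_fun do rewrite addr0.
by move=> ->; rewrite (_ : cintegral (fun=> 0) = 0) ?addr0// /cintegral /Rintegral !integral0.
Qed.

Lemma cintegral_conj f : cintegrable f -> cintegral (fun x => (f x)^*) = (cintegral f)^*.
Proof.
move=> [rf jf]; rewrite /cintegral /=; congr (_ +i* _).
  by apply: eq_Rintegral => x _; rewrite /= ReJ.
rewrite -mulN1r -RintegralZl//.
by apply: eq_Rintegral => x _; rewrite /= ImJ mulN1r.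
Qed.

Lemma bounded_cintegrable f M : cmeasurable f -> (forall x, Normc.normc (f x) <= M) ->
  cintegrable f.
Proof.
move=> [mr mi] fM; split.
  by apply: (@bounded_integrable _ _ _ mu _ M mr) => x; exact: le_trans (Re_le_normc _) (fM x).
by apply: (@bounded_integrable _ _ _ mu _ M mi) => x; exact: le_trans (Im_le_normc _) (fM x).
Qed.

(** The factor 2 comes from bounding the real and imaginary parts separately. *)
Lemma normc_cintegral f M : cmeasurable f -> (forall x, Normc.normc (f x) <= M) ->
  Normc.normc (cintegral f) <= 2 * (M * fine (mu setT)).
Proof.
move=> mf fM; have [ir ii] := bounded_cintegrable mf fM.
have le (u : 'rV[R]_n -> R) : mu.-integrable setT (EFin \o u) -> (forall x, `|u x| <= M) ->
    `|Rintegral mu setT u| <= M * fine (mu setT).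
  move=> iu uM; apply: (le_trans (le_normr_Rintegral _ iu)) => //.
  rewrite -Rintegral_cst//; apply: le_Rintegral => //; first exact: (integrable_norm iu).
  by apply: (@bounded_integrable _ _ _ _ _ `|M|).
rewrite (le_trans (normc_le_ReIm _))// mulr_natl mulr2n lerD//=.
  by apply: le => // x; exact: le_trans (Re_le_normc _) (fM x).
by apply: le => // x; exact: le_trans (Im_le_normc _) (fM x).
Qed.

End ComplexIntegral.

Section L2Dot.
Context (R : realType) (n : nat).
Let mu := torus_measure R n.
Implicit Types f g h : L2fun R n.

Lemma L2fun_cmeasurable f : cmeasurable f.
Proof. by have := valP f; rewrite inE => -[]. Qed.

Lemma L2funZDE (a : R[i]) f g x : (a *: f + g) x = a * f x + g x.
Proof. by rewrite /= !fctE. Qed.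

Lemma L2funBE f g x : (f - g) x = f x - g x.
Proof. by rewrite /= !fctE. Qed.

Let Q f x := complex.Re (f x) ^+ 2 + complex.Im (f x) ^+ 2.

Let Q_ge0 f x : 0 <= Q f x.
Proof. by rewrite addr_ge0// sqr_ge0. Qed.

Let measurable_Q f : measurable_fun setT (EFin \o Q f).
Proof. exact: (cmeasurable_sqr (L2fun_cmeasurable f)). Qed.

Lemma integrable_sqr f : mu.-integrable setT (EFin \o Q f).
Proof.
apply/integrableP; split; first exact: measurable_Q.
have [_ /Lnorm2_lty] : cmeasurable f /\ (Lnorm2 f < +oo)%E by have := valP f; rewrite inE.
apply: le_lt_trans; rewrite le_eqVlt; apply/orP; left; apply/eqP.
by apply: eq_integral => x _ /=; rewrite ger0_norm// Q_ge0.
Qed.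

(** Both parts of $f\bar g$ are dominated by $|f|^2+|g|^2$: each of the four differences is half a
    sum of squares, one of which is built on the sums or differences of the real and imaginary
    parts. *)
Lemma L2_cintegrable f g : cintegrable (fun x => f x * (g x)^*).
Proof.
have [mfr mfi] := L2fun_cmeasurable f; have [mgr mgi] := L2fun_cmeasurable g.
have dom (u : 'rV[R]_n -> R) : measurable_fun setT u ->
    (forall x, `|u x| <= Q f x + Q g x) -> mu.-integrable setT (EFin \o u).
  move=> mf uM.
  apply: (le_integrable measurableT _ _
    (integrableD measurableT (integrable_sqr f) (integrable_sqr g))) => //.
    exact/measurable_EFinP.
  move=> x _ /=; rewrite lee_fin (le_trans (uM x))//.
  exact: ler_norm.
split; apply: dom.
- rewrite (_ : _ \o _ = fun x => (@complex.Re R \o f) x * (@complex.Re R \o g) x +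
     (@complex.Im R \o f) x * (@complex.Im R \o g) x).
    by apply: measurable_funD; apply: measurable_funM.
  apply/funext => x /=; rewrite ReM ReJ ImJ; ring.
- move=> x; rewrite /= ReM ReJ ImJ /Q; case: (g x) => a b /=; case: (f x) => c d /=.
  rewrite ler_norml; apply/andP; split; rewrite -subr_ge0.
    rewrite (_ : _ - _ = ((a + c) ^+ 2 + (b + d) ^+ 2 + (a ^+ 2 + b ^+ 2 + c ^+ 2 + d ^+ 2)) / 2).
      by rewrite divr_ge0// !addr_ge0// sqr_ge0.
    by field.
  rewrite (_ : _ - _ = ((a - c) ^+ 2 + (b - d) ^+ 2 + (a ^+ 2 + b ^+ 2 + c ^+ 2 + d ^+ 2)) / 2).
    by rewrite divr_ge0// !addr_ge0// sqr_ge0.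
  by field.
- rewrite (_ : _ \o _ = fun x => (@complex.Im R \o f) x * (@complex.Re R \o g) x -
     (@complex.Re R \o f) x * (@complex.Im R \o g) x).
    by apply: measurable_funB; apply: measurable_funM.
  apply/funext => x /=; rewrite ImM ReJ ImJ; ring.
- move=> x; rewrite /= ImM ReJ ImJ /Q; case: (g x) => a b /=; case: (f x) => c d /=.
  rewrite ler_norml; apply/andP; split; rewrite -subr_ge0.
    rewrite (_ : _ - _ = ((a + d) ^+ 2 + (b - c) ^+ 2 + (a ^+ 2 + b ^+ 2 + c ^+ 2 + d ^+ 2)) / 2).
      by rewrite divr_ge0// !addr_ge0// sqr_ge0.
    by field.
  rewrite (_ : _ - _ = ((a - d) ^+ 2 + (b + c) ^+ 2 + (a ^+ 2 + b ^+ 2 + c ^+ 2 + d ^+ 2)) / 2).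
    by rewrite divr_ge0// !addr_ge0// sqr_ge0.
  by field.
Qed.

Definition dot f g : R[i] := cintegral (fun x => f x * (g x)^*).

Arguments dot : simpl never.

Definition sqnorm f : R := Rintegral mu setT (Q f).

Lemma dotC f g : dot g f = (dot f g)^*.
Proof.
rewrite /dot -cintegral_conj; last exact: L2_cintegrable.
congr cintegral; apply/funext => x; rewrite conjcM.
  by rewrite conjcJ mulrC.
Qed.

Lemma dotZDl (a : R[i]) f g h : dot (a *: f + g) h = a * dot f h + dot g h.
Proof.
rewrite /dot -cintegralZD; [|exact: L2_cintegrable..].
congr cintegral; apply/funext => x.
by rewrite L2funZDE mulrDl -mulrA.
Qed.

Lemma dot0l h : dot 0 h = 0.
Proof.
have := dotZDl 1 0 0 h; rewrite scaler0 addr0 mul1r => /eqP.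
by rewrite -subr_eq0 opprD addrA subrr sub0r oppr_eq0 => /eqP.
Qed.

Lemma dotDl f g h : dot (f + g) h = dot f h + dot g h.
Proof. by rewrite -[f in LHS]scale1r dotZDl mul1r. Qed.

Lemma dotZl (a : R[i]) f h : dot (a *: f) h = a * dot f h.
Proof. by rewrite -[_ *: f in LHS]addr0 dotZDl dot0l addr0. Qed.

Lemma dotNl f h : dot (- f) h = - dot f h.
Proof. by rewrite -scaleN1r dotZl mulN1r. Qed.

Lemma dotDr f g h : dot h (f + g) = dot h f + dot h g.
Proof.
by rewrite dotC dotDl conjcD -!dotC. Qed.

Lemma dotZr (a : R[i]) f h : dot h (a *: f) = a^* * dot h f.
Proof.
by rewrite dotC dotZl conjcM -!dotC. Qed.

Lemma dotNr f h : dot h (- f) = - dot h f.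
Proof. by rewrite dotC dotNl conjcN -!dotC. Qed.

Lemma dot_suml I (s : seq I) (F : I -> L2fun R n) h :
  dot (\sum_(i <- s) F i) h = \sum_(i <- s) dot (F i) h.
Proof. by elim: s => [|i s IH]; rewrite ?big_nil ?dot0l// !big_cons dotDl IH. Qed.

Lemma dot_sumr I (s : seq I) (F : I -> L2fun R n) h :
  dot h (\sum_(i <- s) F i) = \sum_(i <- s) dot h (F i).
Proof. by rewrite dotC dot_suml conjc_sum; apply: eq_bigr => i _; rewrite -dotC. Qed.

Lemma dotE f : dot f f = (sqnorm f)%:C.
Proof.
rewrite /dot /cintegral /sqnorm; congr (_ +i* _).
  by apply: eq_Rintegral => x _ /=; rewrite mulcJ/= normc_sqr.
rewrite -[RHS](_ : Rintegral mu setT (fun=> 0) = 0); last by rewrite /Rintegral integral0.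
by apply: eq_Rintegral => x _ /=; rewrite mulcJ.
Qed.

Lemma sqnorm_ge0 f : 0 <= sqnorm f.
Proof. by apply: Rintegral_ge0 => x _; exact: Q_ge0. Qed.

Lemma sqnormZ (a : R[i]) f : sqnorm (a *: f) = Normc.normc a ^+ 2 * sqnorm f.
Proof.
apply: complexI; rewrite -dotE dotZl dotZr mulrA mulcJ dotE.
by rewrite -realcM.
Qed.

Lemma sqnormN f : sqnorm (- f) = sqnorm f.
Proof. by apply: complexI; rewrite -!dotE dotNl dotNr opprK. Qed.

(** The parallelogram law with the term $\|f-g\|^2$ dropped. It replaces the triangle inequality at
    the price of a factor 2. *)
Lemma sqnormD_le f g : sqnorm (f + g) <= 2 * sqnorm f + 2 * sqnorm g.
Proof.
have : 0 <= sqnorm (f - g) by exact: sqnorm_ge0.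
suff : sqnorm (f - g) = 2 * sqnorm f + 2 * sqnorm g - sqnorm (f + g) by move=> ->; rewrite subr_ge0.
apply: complexI; rewrite realcB realcD 2!(realcM 2) -!dotE.
by rewrite !dotDl !dotDr !dotNl !dotNr; ring.
Qed.

Lemma L2norm_sqnorm f : L2norm (L2class f) = Num.sqrt (sqnorm f).
Proof.
apply: EFin_inj; rewrite L2normE /Lnorm2 unlock.
have -> : (\int[mu]_x (`|(Normc.normc (f x))%:E| `^ 2) = (sqnorm f)%:E)%E.
  rewrite /sqnorm /Rintegral fineK; last exact: (integrable_fin_num _ (integrable_sqr f)).
  apply: eq_integral => x _; rewrite /Q -normc_sqr abse_EFin poweR_EFin.
  by rewrite powR_mulrn// real_normK// num_real.
by rewrite poweR_EFin powR12_sqrt// sqnorm_ge0.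
Qed.

Lemma eq_dotl f g h : L2class f = L2class g -> dot f h = dot g h.
Proof.
move=> /L2classP fg; apply/eqP; rewrite -subr_eq0 -dotNl -dotDl; apply/eqP.
have [ir ii] := L2_cintegrable (f - g) h.
have i0 (u : R[i] -> R) : u 0 = 0 ->
    mu.-integrable setT (EFin \o (u \o (fun x => (f - g) x * (h x)^*))) ->
    Rintegral mu setT (u \o (fun x => (f - g) x * (h x)^*)) = 0.
  move=> u0 iu; rewrite /Rintegral (ae_eq_integral (cst 0%E)) ?integral0//.
    exact: measurable_int iu.
  apply: filterS fg => x fx _; rewrite -[LHS]/((u ((f - g) x * (h x)^*))%:E).
  by rewrite L2funBE fx subrr mul0r u0.
by rewrite /dot /cintegral !i0.
Qed.

Lemma sqnorm_eq0 f : sqnorm f = 0 -> L2class f = 0.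
Proof.
move=> f0; rewrite -[RHS](raddf0 (\pi_(Quotient.quot (@L2null R n)))%qT).
apply/L2classP.
have : (\int[mu]_x `|(EFin \o Q f) x| = 0)%E.
  transitivity (sqnorm f)%:E; last by rewrite f0.
  rewrite /sqnorm /Rintegral fineK; last exact: (integrable_fin_num _ (integrable_sqr f)).
  by apply: eq_integral => x _ /=; rewrite ger0_norm// Q_ge0.
move/(ae_eq_integral_abs _ measurableT (@measurable_Q f)).
apply: filterS => x /(_ Logic.I) /= [] /eqP; rewrite paddr_eq0 ?sqr_ge0//.
by rewrite !sqrf_eq0; case: (f x) => a b /= /andP[/eqP -> /eqP ->].
Qed.

Section Orthogonal.
Context (I : eqType) (v : I -> L2fun R n) (V : R).
Hypothesis V0 : 0 < V.
Hypothesis orthv : forall i j, dot (v i) (v j) = (if i == j then V else 0)%:C.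

Lemma dot_sum_orthogonal (c : I -> R[i]) (s : seq I) j : uniq s -> j \in s ->
  dot (\sum_(i <- s) c i *: v i) (v j) = V%:C * c j.
Proof.
move=> us js; rewrite dot_suml (bigD1_seq j)//= big1 => [|i ij].
  by rewrite addr0 dotZl orthv eqxx mulrC.
by rewrite dotZl orthv (negbTE ij) mulr0.
Qed.

Lemma sqnorm_sum_orthogonal (c : I -> R[i]) (s : seq I) : uniq s ->
  sqnorm (\sum_(i <- s) c i *: v i) = V * \sum_(i <- s) Normc.normc (c i) ^+ 2.
Proof.
move=> us; apply: complexI; rewrite -dotE dot_sumr realcM realc_sum mulr_sumr.
rewrite big_seq [RHS]big_seq; apply: eq_bigr => j js.
by rewrite dotZr dot_sum_orthogonal// -mulcJ; ring.
Qed.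

(** With $p$ the orthogonal projection of $f$ on the span of the [v i], the products $\langle
    p,f\rangle$, $\langle f,p\rangle$ and $\langle p,p\rangle$ coincide, so $\|f-p\|^2\ge 0$ is the
    inequality. The vectors keep their common squared norm [V], as the characters are not
    normalised. *)
Lemma bessel f (s : seq I) : uniq s ->
  V * \sum_(i <- s) Normc.normc (dot f (v i) / V%:C) ^+ 2 <= sqnorm f.
Proof.
move=> us; pose c i := dot f (v i) / V%:C.
pose p := \sum_(i <- s) c i *: v i.
have V0' : V%:C != 0 by rewrite eq_complex /= eqxx andbT gt_eqF.
have pE : dot p f = (V * \sum_(i <- s) Normc.normc (c i) ^+ 2)%:C.
  rewrite dot_suml realcM realc_sum mulr_sumr; apply: eq_bigr => i _.
  rewrite dotZl -mulcJ dotC /c conjcM conjcV conjcR.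
  by field.
rewrite -subr_ge0; suff <- : sqnorm (f - p) = sqnorm f - V * \sum_(i <- s) Normc.normc (c i) ^+ 2.
  exact: sqnorm_ge0.
apply: complexI; rewrite realcB -!dotE dotDl !dotDr !dotNl !dotNr -pE dotE.
rewrite (_ : dot p p = dot p f); last by rewrite pE dotE sqnorm_sum_orthogonal.
rewrite (_ : dot f p = dot p f); last by rewrite dotC pE conjcR.
by rewrite subrr addr0.
Qed.

End Orthogonal.

End L2Dot.

(** * Smooth functions on the torus *)

Section SmoothRow.
Context (R : realType) (n : nat).
Implicit Types (g h : 'rV[R]_n -> R) (i : 'I_n) (s : seq 'I_n).

Lemma smooth_continuous g : smooth g -> continuous g.
Proof. by move=> /(_ [::])[]. Qed.

Lemma smooth_derivable g x i : smooth g -> derivable g x (delta_mx 0 i).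
Proof. by move=> /(_ [::])[_]. Qed.

Lemma smooth_partial i g : smooth g -> smooth (partial i g).
Proof.
move=> sg s; have -> : partials s (partial i g) = partials (rcons s i) g.
  by rewrite /partials foldr_rcons.
exact: sg.
Qed.

Lemma periodic_partial i g (p : 'rV[R]_n) : periodic g p -> periodic (partial i g) p.
Proof.
move=> pg x; rewrite /partial.
have E (h : R) : h *: delta_mx 0 i + x + p = h *: delta_mx 0 i + (x + p) by rewrite addrA.
rewrite -(@derive_shift_comp _ _ _ g (fun y => y + p) x _ _ E).2.
by rewrite (_ : g \o _ = g)//; apply/funext => y; rewrite /= pg.
Qed.

Lemma partialM i g h x : derivable g x (delta_mx 0 i) -> derivable h x (delta_mx 0 i) ->
  partial i (fun y => g y * h y) x = partial i g x * h x + g x * partial i h x.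
Proof.
by move=> dg dh; rewrite [LHS](deriveM dg dh) addrC [partial i g x * _]mulrC.
Qed.

Let derivable_mul i g h x : derivable g x (delta_mx 0 i) -> derivable h x (delta_mx 0 i) ->
  derivable (fun y => g y * h y) x (delta_mx 0 i).
Proof. by move=> dg dh; exact: (derivableM dg dh). Qed.

Let derivable_add i g h x : derivable g x (delta_mx 0 i) -> derivable h x (delta_mx 0 i) ->
  derivable (fun y => g y + h y) x (delta_mx 0 i).
Proof. by move=> dg dh; exact: (derivableD dg dh). Qed.

Lemma partialD i g h x : derivable g x (delta_mx 0 i) -> derivable h x (delta_mx 0 i) ->
  partial i (fun y => g y + h y) x = partial i g x + partial i h x.
Proof. by move=> dg dh; rewrite [LHS](deriveD dg dh). Qed.

(** The Leibniz rule with repetitions in place of binomial coefficients: the existence of some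
    finite list of pairs is enough to deduce smoothness of a product. *)
Lemma partials_mul s g h : smooth g -> smooth h ->
  exists L : seq (seq 'I_n * seq 'I_n), partials s (fun x => g x * h x) =
    fun x => \sum_(p <- L) partials p.1 g x * partials p.2 h x.
Proof.
move=> sg sh; elim: s => [|i s [L /= ->]].
  by exists [:: ([::], [::])]; apply/funext => x; rewrite big_seq1.
exists (flatten [seq [:: (i :: p.1, p.2); (p.1, i :: p.2)] | p <- L]).
apply/funext => x.
(* Derivability is proved together with the formula, since differentiating the sum term by term
   needs it for the tail. *)
suff [_ ->] : derivable (fun x => \sum_(p <- L) partials p.1 g x * partials p.2 h x) x
    (delta_mx 0 i) /\
  partial i (fun x => \sum_(p <- L) partials p.1 g x * partials p.2 h x) x =
  \sum_(p <- L) (partials (i :: p.1) g x * partials p.2 h x +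
     partials p.1 g x * partials (i :: p.2) h x).
  rewrite big_flatten big_map; apply: eq_bigr => p _.
  by rewrite !big_cons big_nil /= addr0.
elim: L => [|[p q] L [IH1 IH2]].
  rewrite (_ : (fun y : 'rV[R]_n => \sum_(p <- [::]) _) = cst 0); last first.
    by apply/funext => y; rewrite big_nil.
  by rewrite big_nil /partial derive_cst; split => //; exact: derivable_cst.
rewrite (_ : (fun y : 'rV[R]_n => \sum_(p <- (p, q) :: L) _) =
    (fun y => partials p g y * partials q h y +
      \sum_(p <- L) partials p.1 g y * partials p.2 h y)); last first.
  by apply/funext => y; rewrite big_cons.
have dg := (sg p).2 x i; have dh := (sh q).2 x i.
have dgh := derivable_mul dg dh.
split; first exact: (derivable_add dgh IH1).
by rewrite big_cons -IH2 (partialD dgh IH1) partialM.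
Qed.

Lemma smoothM g h : smooth g -> smooth h -> smooth (fun x => g x * h x).
Proof.
move=> sg sh s; have [L ->] := partials_mul s sg sh.
elim: L => [|[p q] L [IH1 IH2]].
  rewrite (_ : (fun y : 'rV[R]_n => \sum_(p <- [::]) _) = cst 0); last first.
    by apply/funext => y; rewrite big_nil.
  by split => [|x i]; [exact: cst_continuous|exact: derivable_cst].
rewrite (_ : (fun y : 'rV[R]_n => \sum_(p <- (p, q) :: L) _) =
    (fun y => partials p g y * partials q h y +
      \sum_(p <- L) partials p.1 g y * partials p.2 h y)); last first.
  by apply/funext => y; rewrite big_cons.
have [cg dg] := sg p; have [ch dh] := sh q; split => [x|x i].
  exact: (cvgD (cvgM (cg x) (ch x)) (IH1 x)).
exact: (derivable_add (derivable_mul (dg x i) (dh x i)) (IH2 x i)).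
Qed.

Lemma derive_scalar (f : R -> R) (t w : R) : derivable f t 1 ->
  derivable f t w /\ 'D_w f t = w * derive1 f t.
Proof.
move=> /derivable1_diffP df; split; first exact: diff_derivable.
by rewrite derive1E !deriveE// -[w in LHS]mulr1 -[_ * 1]/(w *: (1 : R^o)) linearZ.
Qed.

Lemma partial_dotz (f : R -> R) i x (xi : 'rV[int]_n) : derivable f (dotz x xi) 1 ->
  partial i (fun y => f (dotz y xi)) x = (xi 0 i)%:~R * derive1 f (dotz x xi).
Proof.
move=> df.
have E (h : R) : dotz (h *: delta_mx 0 i + x) xi = h *: (xi 0 i)%:~R + dotz x xi.
  by rewrite dotzD dotzZ dotz_delta.
rewrite /partial (@derive_shift_comp _ _ _ f (fun y => dotz y xi) x _ _ E).2.
by have [_ ->] := @derive_scalar f (dotz x xi) (xi 0 i)%:~R df.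
Qed.

Lemma periodic_translate (V : zmodType) (f : 'rV[R]_n -> V) (k : 'I_n -> int) x :
  (forall i, periodic f (2 * pi *: delta_mx 0 i)) ->
  f (x + \row_i (2 * pi * (k i)%:~R)) = f x.
Proof.
move=> pf.
have pn i m y : f (y + (2 * pi * m%:R) *: delta_mx 0 i) = f y.
  elim: m y => [|m IH] y; first by rewrite mulr0 scale0r addr0.
  by rewrite -(natr1 m) mulrDr mulr1 scalerDl addrA pf IH.
have pz i (m : int) y : f (y + (2 * pi * m%:~R) *: delta_mx 0 i) = f y.
  case: m => m; first exact: pn.
  by rewrite NegzE mulrNz mulrN scaleNr -[LHS](pn i m.+1) subrK.
rewrite [X in x + X]row_sum_delta; elim: (index_enum _) => [|i s IH] in x *.
  by rewrite big_nil addr0.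
by rewrite big_cons addrA IH mxE pz.
Qed.

Lemma translate_cube x : exists k : 'I_n -> int,
  @cube R n (x + \row_i (2 * pi * (k i)%:~R)).
Proof.
have pi20 : 0 < 2 * pi :> R by rewrite mulr_gt0// pi_gt0.
exists (fun i => - Num.floor (x 0 i / (2 * pi))) => i.
rewrite /= /period /= !mxE in_itv/=.
have := floor_le (x 0 i / (2 * pi)).
have := floorD1_gt (x 0 i / (2 * pi)).
rewrite intrD rmorph1 rmorphN/=; move: (_%:~R) => m.
rewrite ltr_pdivrMr// ler_pdivlMr// => h1 h2; apply/andP; split; lra.
Qed.

Lemma periodic_bounded g : continuous g ->
  (forall i, periodic g (2 * pi *: delta_mx 0 i)) ->
  exists M, forall x, `|g x| <= M.
Proof.
move=> cg pg.
have pi20 : 0 < 2 * pi :> R by rewrite mulr_gt0// pi_gt0.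
have ccube : compact (@cube R n).
  by apply: (@rV_compact R n (fun=> `[0, 2 * pi]%classic)) => i; exact: segment_compact.
have cube0 : @cube R n !=set0.
  by exists 0 => i; rewrite mxE/= /period /= in_itv/= lexx ltW.
have [|c _ cM] := @EVT_max_rV R n (fun x => `|g x|) (@cube R n) cube0 ccube.
  by apply: continuous_subspaceT => x; exact: cvg_norm (cg x).
exists `|g c| => x; have [k kx] := translate_cube x.
rewrite -(periodic_translate k x pg).
by apply: cM; rewrite inE.
Qed.

End SmoothRow.

Section CinfAlgebra.
Context (R : realType) (n : nat).
Implicit Types (f g : Cinf R n) (i : 'I_n) (xi eta : 'rV[int]_n).

Lemma CinfP f : [/\ torus_periodic f, smooth (@complex.Re R \o f) & smooth (@complex.Im R \o f)].
Proof. by have := valP f; rewrite inE => -[pf [sr si]]; split. Qed.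

Lemma Cinf_eq f g : (forall x, f x = g x) -> f = g.
Proof. by move=> fg; apply: val_inj; apply/funext. Qed.

Lemma CinfZDE (a : R[i]) f g x : (a *: f + g) x = a * f x + g x.
Proof. by rewrite /= !fctE. Qed.

Lemma CinfZE (a : R[i]) f x : (a *: f) x = a * f x.
Proof. by rewrite /= !fctE. Qed.

Lemma CinfDE f g x : (f + g) x = f x + g x.
Proof. by rewrite /= !fctE. Qed.

Lemma CinfBE f g x : (f - g) x = f x - g x.
Proof. by rewrite /= !fctE. Qed.

Lemma Cinf_sumE I (s : seq I) (F : I -> Cinf R n) x :
  (\sum_(i <- s) F i) x = \sum_(i <- s) F i x.
Proof. by elim: s => [|j s IH]; rewrite ?big_nil// !big_cons CinfDE IH. Qed.

Lemma Re_comp_periodic f i : periodic (@complex.Re R \o f) (2 * pi *: delta_mx 0 i).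
Proof. by move=> x; have [pf _ _] := CinfP f; rewrite /= pf. Qed.

Lemma Im_comp_periodic f i : periodic (@complex.Im R \o f) (2 * pi *: delta_mx 0 i).
Proof. by move=> x; have [pf _ _] := CinfP f; rewrite /= pf. Qed.

Let dc_fun i f : 'rV[R]_n -> R[i] := fun x =>
  partial i (@complex.Re R \o f) x +i* partial i (@complex.Im R \o f) x.

Let dc_smooth i f : dc_fun i f \in @torus_smooth R n.
Proof.
have [pf sr si] := CinfP f; rewrite inE; split.
  move=> j x; rewrite /dc_fun (periodic_partial i (@Re_comp_periodic f j)).
  by rewrite (periodic_partial i (@Im_comp_periodic f j)).
by split; [exact: (smooth_partial i sr)|exact: (smooth_partial i si)].
Qed.

(** Differentiation as an operator from [Cinf] to itself, so that it can be iterated; [DmE] relates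
    it to [cmpartial]. *)
Definition Dc i f : Cinf R n := MkCinf (dc_smooth i f).

Lemma DcE i f x : Dc i f x =
  partial i (@complex.Re R \o f) x +i* partial i (@complex.Im R \o f) x.
Proof. by []. Qed.

Lemma DcZD i (a : R[i]) f g : Dc i (a *: f + g) = a *: Dc i f + Dc i g.
Proof.
apply: Cinf_eq => x; rewrite CinfZDE !DcE.
have [_ fr fi] := CinfP f; have [_ gr gi] := CinfP g.
have sd (u : 'rV[R]_n -> R) : smooth u -> forall y j, derivable u y (delta_mx 0 j).
  by move=> su y j; exact: smooth_derivable.
have lin (c d : R) (u v w : 'rV[R]_n -> R) : smooth u -> smooth v -> smooth w ->
    partial i (fun y => c * u y + (d * v y + w y)) x =
    c * partial i u x + (d * partial i v x + partial i w x).
  by move=> su sv sw; rewrite (partialZD c i (sd _ su) (sd _ (smoothZD d sv sw)))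
    (partialZD d i (sd _ sv) (sd _ sw)).
rewrite (_ : @complex.Re R \o _ = fun y => complex.Re a * (@complex.Re R \o f) y +
    (- complex.Im a * (@complex.Im R \o f) y + (@complex.Re R \o g) y)); last first.
  by apply/funext => y; rewrite /comp CinfZDE ReD ReM mulNr addrA.
rewrite (_ : @complex.Im R \o (a *: f + g) = fun y => complex.Re a * (@complex.Im R \o f) y +
    (complex.Im a * (@complex.Re R \o f) y + (@complex.Im R \o g) y)); last first.
  by apply/funext => y; rewrite /comp CinfZDE ImD ImM addrA.
rewrite !lin//; case: a => a b.
by apply/eqP; rewrite eq_complex /=; apply/andP; split; apply/eqP; ring.
Qed.

Lemma DcD i f g : Dc i (f + g) = Dc i f + Dc i g.
Proof. by rewrite -[f in LHS]scale1r DcZD scale1r. Qed.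

Lemma Dc0 i : Dc i 0 = 0.
Proof. by have := DcZD i (-1) 0 0; rewrite !scaleN1r !addNr. Qed.

Lemma DcZ i (a : R[i]) f : Dc i (a *: f) = a *: Dc i f.
Proof. by rewrite -[_ *: f in LHS]addr0 DcZD Dc0 addr0. Qed.

Lemma Dc_sum i I (s : seq I) (F : I -> Cinf R n) :
  Dc i (\sum_(j <- s) F j) = \sum_(j <- s) Dc i (F j).
Proof. by elim: s => [|j s IH]; rewrite ?big_nil ?Dc0// !big_cons DcD IH. Qed.

Let mul_fun f g : 'rV[R]_n -> R[i] := fun x => f x * g x.

Let mul_smooth f g : mul_fun f g \in @torus_smooth R n.
Proof.
have [pf fr fi] := CinfP f; have [pg gr gi] := CinfP g; rewrite inE; split.
  by move=> j x; rewrite /mul_fun pf pg.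
have [s1 s2] := (smoothM fr gr, smoothM fi gi); have [s3 s4] := (smoothM fr gi, smoothM fi gr).
split.
  rewrite (_ : _ \o _ = fun x => -1 * ((@complex.Im R \o f) x * (@complex.Im R \o g) x) +
      (@complex.Re R \o f) x * (@complex.Re R \o g) x); first exact: smoothZD.
  by apply/funext => x; rewrite /comp /mul_fun ReM; ring.
rewrite (_ : _ \o _ = fun x => 1 * ((@complex.Im R \o f) x * (@complex.Re R \o g) x) +
    (@complex.Re R \o f) x * (@complex.Im R \o g) x); first exact: smoothZD.
by apply/funext => x; rewrite /comp /mul_fun ImM; ring.
Qed.

Definition mulC f g : Cinf R n := MkCinf (mul_smooth f g).

Lemma mulCE f g x : mulC f g x = f x * g x.
Proof. by []. Qed.

Lemma DcM i f g : Dc i (mulC f g) = mulC (Dc i f) g + mulC f (Dc i g).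
Proof.
apply: Cinf_eq => x; rewrite CinfDE !mulCE !DcE.
have [pf fr fi] := CinfP f; have [pg gr gi] := CinfP g.
have d (u : 'rV[R]_n -> R) : smooth u -> forall y j, derivable u y (delta_mx 0 j).
  by move=> su y j; exact: smooth_derivable.
rewrite (_ : @complex.Re R \o _ = fun y => -1 * ((@complex.Im R \o f) y * (@complex.Im R \o g) y) +
    (@complex.Re R \o f) y * (@complex.Re R \o g) y); last first.
  by apply/funext => y; rewrite /comp mulCE ReM; ring.
rewrite (_ : @complex.Im R \o (mulC f g) = fun y =>
    1 * ((@complex.Im R \o f) y * (@complex.Re R \o g) y) +
    (@complex.Re R \o f) y * (@complex.Im R \o g) y); last first.
  by apply/funext => y; rewrite /comp mulCE ImM; ring.
have dM u v su sv := d _ (@smoothM R n u v su sv).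
rewrite (partialZD _ i (dM _ _ fi gi) (dM _ _ fr gr)) (partialZD _ i (dM _ _ fi gr) (dM _ _ fr gi)).
rewrite (partialM (d _ fr _ _) (d _ gr _ _)) (partialM (d _ fi _ _) (d _ gi _ _)).
rewrite (partialM (d _ fr _ _) (d _ gi _ _)) (partialM (d _ fi _ _) (d _ gr _ _)).
rewrite /comp; case: (f x) => a b; case: (g x) => a' b'.
by apply/eqP; rewrite eq_complex /=; apply/andP; split; apply/eqP; ring.
Qed.

Lemma Dc_character i xi : Dc i (e_ xi) = (0 +i* (xi 0 i)%:~R) *: e_ xi.
Proof.
apply: Cinf_eq => x; rewrite CinfZE DcE.
have [dc ds] : derivable (@cos R) (dotz x xi) 1 /\ derivable (@sin R) (dotz x xi) 1.
  by split; [exact: ex_derive|exact: ex_derive].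
rewrite (partial_dotz i dc) (partial_dotz i ds) !derive1E.
rewrite (@derive_val _ _ _ _ _ _ _ (is_derive_cos _)) (@derive_val _ _ _ _ _ _ _ (is_derive_sin _)).
by apply/eqP; rewrite eq_complex /= /character /expi/=; apply/andP; split; apply/eqP; ring.
Qed.

Lemma characterN xi x : e_ (- xi) x = (e_ xi x : R[i])^*.
Proof.
rewrite /= /character -expiN; congr expi.
by rewrite /dotz -sumrN; apply: eq_bigr => i _; rewrite mxE mulrNz mulrN.
Qed.

Lemma characterD xi eta x : e_ (xi + eta) x = e_ xi x * e_ eta x :> R[i].
Proof.
rewrite /= /character -expiDM; congr expi.
by rewrite /dotz -big_split/=; apply: eq_bigr => i _; rewrite mxE intrD mulrDr.
Qed.

Lemma character0 (x : 'rV[R]_n) : e_ 0 x = 1 :> R[i].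
Proof.
rewrite /= /character (_ : dotz x 0 = 0) ?expi0//.
by rewrite /dotz big1// => i _; rewrite mxE mulr0.
Qed.

Lemma normc_character xi x : Normc.normc (e_ xi x : R[i]) = 1.
Proof. exact: normc_expi. Qed.

Definition Dm (b : 'I_n -> nat) f : Cinf R n :=
  foldr (fun i h => iter (b i) (Dc i) h) f (enum 'I_n).

Lemma DmE b f x : Dm b f x = cmpartial b f x.
Proof.
have RI : @complex.Re R \o Dm b f = mpartial b (@complex.Re R \o f) /\
    @complex.Im R \o Dm b f = mpartial b (@complex.Im R \o f).
  rewrite /Dm /mpartial; elim: (enum _) => //= i s [IH1 IH2].
  elim: (b i) => //= k [IHr IHi].
  by rewrite -IHr -IHi; split; apply/funext => y.
have [Er Ei] := RI; rewrite /cmpartial -Er -Ei /=.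
by case: (Cinf_fun _ _).
Qed.

Lemma Cinf_bounded f : exists M, forall x, Normc.normc (f x) <= M.
Proof.
have [_ fr fi] := CinfP f.
have [M fM] := periodic_bounded (smooth_continuous fr) (Re_comp_periodic f).
have [N fN] := periodic_bounded (smooth_continuous fi) (Im_comp_periodic f).
exists (M + N) => x; apply: (le_trans (normc_le_ReIm _)); apply: lerD; [exact: fM|exact: fN].
Qed.

Lemma Cinf_cmeasurable f : cmeasurable (f : 'rV[R]_n -> R[i]).
Proof.
have [_ fr fi] := CinfP f; split; apply: continuous_measurable_row; exact: smooth_continuous.
Qed.

Lemma Cinf_cintegrable f : cintegrable (f : 'rV[R]_n -> R[i]).
Proof.
have [M fM] := Cinf_bounded f.
exact: (bounded_cintegrable (Cinf_cmeasurable f) fM).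
Qed.

Lemma cintegral_Dc i f : cintegral (Dc i f : 'rV[R]_n -> R[i]) = 0.
Proof.
have [_ fr fi] := CinfP f.
have [M fM] := Cinf_bounded (Dc i f).
have i0 (u : 'rV[R]_n -> R) : smooth u -> (forall x, `|partial i u x| <= M) ->
    (forall j, periodic u (2 * pi *: delta_mx 0 j)) ->
    Rintegral (torus_measure R n) setT (partial i u) = 0.
  move=> su uM pu; rewrite /Rintegral (@integral_partial_eq0 _ _ u i M)//.
  - exact: smooth_continuous.
  - exact: (smooth_continuous (smooth_partial i su)).
  - by move=> x; exact: smooth_derivable.
have := i0 _ fr; have := i0 _ fi; rewrite /cintegral => Ei Er.
apply/eqP; rewrite eq_complex; apply/andP; split; apply/eqP.
  by apply: Er; [move=> x; exact: le_trans (Re_le_normc _) (fM x)|exact: Re_comp_periodic].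
by apply: Ei; [move=> x; exact: le_trans (Im_le_normc _) (fM x)|exact: Im_comp_periodic].
Qed.

Definition toL2 f : L2fun R n := MkL2fun (torus_smooth_square_integrable (valP f)).

Lemma toL2E f x : toL2 f x = f x.
Proof. by []. Qed.

Lemma toL2ZD (a : R[i]) f g : toL2 (a *: f + g) = a *: toL2 f + toL2 g.
Proof. exact: val_inj. Qed.

Lemma toL2D f g : toL2 (f + g) = toL2 f + toL2 g.
Proof. exact: val_inj. Qed.

Lemma toL2B f g : toL2 (f - g) = toL2 f - toL2 g.
Proof. exact: val_inj. Qed.

Lemma toL2Z (a : R[i]) f : toL2 (a *: f) = a *: toL2 f.
Proof. exact: val_inj. Qed.

Lemma toL2_sum I (s : seq I) (F : I -> Cinf R n) :
  toL2 (\sum_(j <- s) F j) = \sum_(j <- s) toL2 (F j).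
Proof.
elim: s => [|j s IH]; first by rewrite !big_nil; exact: val_inj.
by rewrite !big_cons toL2D IH.
Qed.

Lemma dot_toL2 f g : dot (toL2 f) (toL2 g) = cintegral (fun x => f x * (g x)^*).
Proof. by []. Qed.

Definition vol : R := fine (torus_measure R n setT).

Lemma vol_gt0 : 0 < vol.
Proof. exact: torus_measure_setT_gt0. Qed.

Lemma cintegral_cst (c : R[i]) : cintegral (fun _ : 'rV[R]_n => c) = vol%:C * c.
Proof.
transitivity ((complex.Re c * vol) +i* (complex.Im c * vol)).
  by congr (_ +i* _); exact: Rintegral_cst.
case: c => a b; apply/eqP; rewrite eq_complex /=; apply/andP; split; apply/eqP; rewrite /=; ring.
Qed.

(** If some $\xi_i\ne 0$, then $e_\xi$ is, up to the nonzero factor $i\xi_i$, a partial derivative,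
    and its integral vanishes. *)
Lemma cintegral_character xi : cintegral (e_ xi : 'rV[R]_n -> R[i]) = (if xi == 0 then vol else 0)%:C.
Proof.
have [->|xi0] := eqVneq xi 0.
  rewrite (_ : (e_ 0 : _ -> _) = fun _ : 'rV[R]_n => 1); first by rewrite cintegral_cst mulr1.
  by apply/funext => x; exact: character0.
have [i xii] : exists i, xi 0 i != 0.
  apply/existsP; apply: contraR xi0; rewrite negb_exists => /forallP h.
  by apply/eqP/rowP => i; have := h i; rewrite negbK mxE => /eqP.
have := cintegral_Dc i (e_ xi); rewrite Dc_character.
rewrite (_ : cintegral _ = (0 +i* (xi 0 i)%:~R) * cintegral (e_ xi : 'rV[R]_n -> R[i])); last first.
  rewrite -cintegralZ; last exact: Cinf_cintegrable.
  by congr cintegral; apply/funext => x; exact: CinfZE.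
move/eqP; rewrite mulf_eq0 eq_complex /= eqxx intr_eq0 (negbTE xii) /=.
by move=> /eqP.
Qed.

Lemma dot_character xi eta : dot (toL2 (e_ xi)) (toL2 (e_ eta)) =
  (if xi == eta then vol else 0)%:C.
Proof.
rewrite dot_toL2 -subr_eq0 -cintegral_character; congr cintegral; apply/funext => x.
by rewrite -characterN -characterD.
Qed.

End CinfAlgebra.

(** * Uniqueness of Fourier coefficients *)

Section Uniqueness.
Context (R : realType) (n : nat).
Implicit Types (F G : 'rV[R]_n -> R[i]) (a x : 'rV[R]_n).

Lemma cmeasurableM F G : cmeasurable F -> cmeasurable G -> cmeasurable (fun x => F x * G x).
Proof.
move=> [fr fi] [gr gi]; split.
  rewrite (_ : _ \o _ = fun x => (@complex.Re R \o F) x * (@complex.Re R \o G) x -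
      (@complex.Im R \o F) x * (@complex.Im R \o G) x); last first.
    by apply/funext => x; rewrite /comp ReM.
  by apply: measurable_funB; apply: measurable_funM.
rewrite (_ : _ \o _ = fun x => (@complex.Re R \o F) x * (@complex.Im R \o G) x +
    (@complex.Im R \o F) x * (@complex.Re R \o G) x); last first.
  by apply/funext => x; rewrite /comp ImM.
by apply: measurable_funD; apply: measurable_funM.
Qed.

Lemma bounded_normcM F G M N : (forall x, Normc.normc (F x) <= M) ->
  (forall x, Normc.normc (G x) <= N) -> forall x, Normc.normc (F x * G x) <= M * N.
Proof. by move=> FM GN x; rewrite Normc.normcM ler_pM// normc_ge0. Qed.

(** This class is stable under linear combinations and under multiplication by characters, hence by
    every trigonometric polynomial, in particular by powers of [peak]. Measurability and boundedness
    keep all these products integrable. *)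
Definition zero_coefficients F := [/\ cmeasurable F, exists M, forall x, Normc.normc (F x) <= M &
  forall xi, cintegral (fun x => F x * e_ xi x) = 0].

Let zero_integrable F xi : zero_coefficients F -> cintegrable (fun x => F x * e_ xi x).
Proof.
move=> [mF [M FM] _]; apply: (@bounded_cintegrable _ _ _ (M * 1)).
  exact: (cmeasurableM mF (Cinf_cmeasurable _)).
by apply: bounded_normcM => // x; rewrite normc_character.
Qed.

Let zeroZD (c : R[i]) F G : zero_coefficients F -> zero_coefficients G ->
  zero_coefficients (fun x => c * F x + G x).
Proof.
move=> zF zG; have [mF [M FM] F0] := zF; have [mG [N GN] G0] := zG; split.
- exact: (@cmeasurableZD R n c F G mF mG).
- exists (Normc.normc c * M + N) => x; apply: (le_trans (le_normcD _ _)).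
  by rewrite Normc.normcM lerD// ler_wpM2l// normc_ge0.
- move=> xi.
  under eq_fun do rewrite mulrDl -mulrA.
  rewrite (cintegralZD c (zero_integrable xi zF) (zero_integrable xi zG)).
  by rewrite F0 G0 mulr0 addr0.
Qed.

Let zeroZ (c : R[i]) F : zero_coefficients F -> zero_coefficients (fun x => c * F x).
Proof.
move=> zF; have := zeroZD (c - 1) zF zF.
by under eq_fun do rewrite mulrBl mul1r subrK.
Qed.

Let zero_character F eta : zero_coefficients F ->
  zero_coefficients (fun x => F x * e_ eta x).
Proof.
move=> zF; have [mF [M FM] F0] := zF; split.
- exact: (cmeasurableM mF (Cinf_cmeasurable _)).
- by exists (M * 1); apply: bounded_normcM => // x; rewrite normc_character.
- move=> xi; rewrite -(F0 (eta + xi)); congr cintegral; apply/funext => x.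
  by rewrite characterD mulrA.
Qed.

(** A trigonometric polynomial with values in $[0,1]$ that equals 1 at $a$ and, on the cube with $a$
    in its interior, is less than 1 elsewhere, so its powers concentrate at $a$. *)
Definition peak a x : R := \prod_(i < n) ((1 + cos (x 0 i - a 0 i)) / 2).

(** Euler's formula writes the factor as a combination of 1 and the two characters of frequency
    $\pm1$ in the coordinate $i$. *)
Let peak_factor a i x : ((1 + cos (x 0 i - a 0 i)) / 2)%:C =
  2^-1 + (4^-1 * expi (- a 0 i)) * e_ (delta_mx 0 i) x +
  (4^-1 * expi (a 0 i)) * e_ (- delta_mx 0 i) x.
Proof.
rewrite /= /character.
have -> : dotz x (- delta_mx 0 i) = - x 0 i.
  rewrite /dotz (bigD1 i)//= big1 ?addr0 => [|j /negbTE ji].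
    by rewrite !mxE !eqxx mulrN1z mulrN1.
  by rewrite !mxE eqxx ji oppr0 mulr0.
have -> : dotz x (delta_mx 0 i) = x 0 i.
  rewrite /dotz (bigD1 i)//= big1 ?addr0 => [|j /negbTE ji].
    by rewrite !mxE !eqxx mulr1.
  by rewrite !mxE eqxx ji mulr0.
rewrite -!mulrA -!expiDM -addrA -mulrDr.
rewrite [- a 0 i + _]addrC -[a 0 i - _]opprB; set t := x 0 i - a 0 i.
have -> : expi t + expi (- t) = (2 * cos t)%:C.
  rewrite /expi cosN sinN; apply/eqP; rewrite eq_complex /=.
  by rewrite subrr eqxx andbT; apply/eqP; ring.
have -> : (4 : R[i]) = (4 : R)%:C by rewrite rmorph_nat.
have -> : (2 : R[i]) = (2 : R)%:C by rewrite rmorph_nat.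
rewrite -!fmorphV -rmorphM -rmorphD /=; congr (_ %:C).
by field.
Qed.

Let zero_peak a F : zero_coefficients F -> zero_coefficients (fun x => F x * (peak a x)%:C).
Proof.
rewrite /peak; elim: (index_enum _) => [|i s IH] in F * => zF.
  by under eq_fun do rewrite big_nil mulr1.
under eq_fun do rewrite big_cons realcM mulrA.
apply: IH.
under eq_fun do rewrite peak_factor.
have zi := zeroZD (2^-1) zF (zeroZD (4^-1 * expi (- a 0 i)) (zero_character (delta_mx 0 i) zF)
  (zeroZ (4^-1 * expi (a 0 i)) (zero_character (- delta_mx 0 i) zF))).
congr zero_coefficients: zi; apply/funext => x; ring.
Qed.

Let zero_peak_exp a N F : zero_coefficients F ->
  zero_coefficients (fun x => F x * (peak a x ^+ N)%:C).
Proof.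
elim: N => [|N IH] in F *; first by under eq_fun do rewrite expr0 mulr1.
move=> zF; under eq_fun do rewrite exprS realcM mulrA.
exact/IH/zero_peak.
Qed.

Lemma zero_coefficients_peak a N F : zero_coefficients F ->
  Rintegral (torus_measure R n) setT (fun x => complex.Re (F x) * peak a x ^+ N) = 0 /\
  Rintegral (torus_measure R n) setT (fun x => complex.Im (F x) * peak a x ^+ N) = 0.
Proof.
move=> /(zero_peak_exp a N) [_ _ /(_ 0)].
under eq_fun do rewrite character0 mulr1.
rewrite /cintegral => /eqP; rewrite eq_complex /= => /andP[/eqP hr /eqP hi].
by rewrite -[X in _ = X /\ _]hr -[X in _ /\ _ = X]hi; split; apply: eq_Rintegral => x _ /=;
  rewrite ?ReM ?ImM /= mulr0 ?subr0 ?add0r.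
Qed.

End Uniqueness.

(** * Concentration of the peaks *)

Section Peak.
Context (R : realType) (n : nat).
Implicit Types (f : 'rV[R]_n -> R) (a x : 'rV[R]_n).
Let mu := torus_measure R n.

Lemma peak_ge0 a x : 0 <= peak a x.
Proof.
by apply: prodr_ge0 => i _; have := cos_geN1 (x 0 i - a 0 i); lra.
Qed.

Lemma peak_le1 a x : peak a x <= 1.
Proof.
rewrite /peak; apply: prodr_ile1 => i _; apply/andP; split.
  by have := cos_geN1 (x 0 i - a 0 i); lra.
by have := cos_le1 (x 0 i - a 0 i); lra.
Qed.

Lemma peak_center a : peak a a = 1.
Proof. by rewrite /peak big1// => i _; rewrite subrr cos0; lra. Qed.

Lemma peak_le_factor a x i : peak a x <= (1 + cos (x 0 i - a 0 i)) / 2.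
Proof.
rewrite /peak (bigD1 i)//=; apply: ler_piMr; first by have := cos_geN1 (x 0 i - a 0 i); lra.
apply: prodr_ile1 => j _; apply/andP; split.
  by have := cos_geN1 (x 0 j - a 0 j); lra.
by have := cos_le1 (x 0 j - a 0 j); lra.
Qed.

Lemma continuous_peak a : continuous (peak a).
Proof.
rewrite /peak; elim: (index_enum _) => [|i s IH].
  by under eq_fun do rewrite big_nil; exact: cst_continuous.
under eq_fun do rewrite big_cons.
move=> x; apply: (cvgM _ (IH x)).
apply: (cvgM _ (cvg_cst _)); apply: (cvgD (cvg_cst _)).
have cx : (y 0 i - a 0 i) @[y --> x] --> x 0 i - a 0 i.
  exact: (cvgB (@coord_continuous R 1 n 0 i x) (cvg_cst _)).
exact: (cvg_comp _ _ cx (@continuous_cos _ _)).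
Qed.

(** Cosine is even and decreasing on $[0,\pi]$; beyond $\pi$ the reflection $t\mapsto 2\pi-t$ brings
    the argument back. The upper bound on $|t|$ excludes a return close to the next maximum. *)
Lemma cos_le_of_far (d t : R) : 0 <= d -> d <= `|t| -> `|t| <= 2 * pi - d -> cos t <= cos d.
Proof.
move=> d0 dt td.
have -> : cos t = cos `|t| by case: ger0P => // _; rewrite cosN.
move: (`|t|) dt td => {}t dt td.
have [tp|tp] := leP t pi.
  by rewrite leNgt ltr_cos ?in_itv/= ?d0 ?tp ?(le_trans d0 dt) ?(le_trans dt tp)// -leNgt.
have -> : cos t = cos (2 * pi - t).
  by rewrite -[RHS]cosN opprB; have := @cosD2pi R (t - 2 * pi); rewrite mulr_natl subrK.
have [h1 h2 h3 h4] : [/\ 0 <= 2 * pi - t, 2 * pi - t <= pi, d <= pi & d <= 2 * pi - t].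
  by split; lra.
by rewrite leNgt ltr_cos ?in_itv/= ?h1 ?h2 ?d0 ?h3// -leNgt.
Qed.

Lemma continuous_gt_box f a (c : R) : continuous f -> c < f a ->
  exists2 d : R, 0 < d & forall x, (forall i, `|x 0 i - a 0 i| < d) -> c < f x.
Proof.
move=> cf cfa; have : nbhs a [set x | c < f x] by exact: (cvgr_gt _ (cf a) _ cfa).
move=> /nbhs_ballP[d /= d_0 dP]; exists d => // x xd.
by apply: dP; split => // j i; rewrite ord1 /ball/= distrC.
Qed.

(* If [f a > 0], the powers of the peak at [a] grow near [a] exponentially faster
   than they do away from [a], where they may meet negative values of [f]. *)
Lemma le0_of_peak_integral f a (d0 M : R) : continuous f -> (forall x, `|f x| <= M) ->
  0 < d0 -> (forall i, d0 <= a 0 i /\ a 0 i <= 2 * pi - d0) ->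
  (forall N, Rintegral mu setT (fun x => f x * peak a x ^+ N) = 0) -> f a <= 0.
Proof.
move=> cf fM d00 ad0 f0; rewrite leNgt; apply/negP => fa0.
pose ep := f a / 2.
have ep0 : 0 < ep by rewrite divr_gt0.
have [d1 d10 fd1] : exists2 d : R, 0 < d & forall x, (forall i, `|x 0 i - a 0 i| < d) -> ep < f x.
  by apply: continuous_gt_box => //; rewrite /ep; lra.
(* Three demands on [d]: below [d1], [f] stays above [ep]; below [d0], the distance $|x_i-a_i|$ is
   at most $2\pi-d$ on the cube; below 1, [cos d] is less than 1. *)
pose d := Num.min d0 (Num.min d1 1).
have dpos : 0 < d by rewrite !lt_min d00 d10 ltr01.
have [dd0 dd1 d1'] : [/\ d <= d0, d <= d1 & d <= 1].
  by split; rewrite /d !ge_min lexx ?orbT.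
have pi2 := pi_ge2 R.
(* [r1] bounds the peak on the cube as soon as one coordinate is at distance at least [d] from
   [a]. *)
pose r1 := (1 + cos d) / 2.
have cosd1 : cos d < 1.
  by rewrite -[ltRHS]cos0 ltr_cos ?in_itv/= ?lexx ?(ltW dpos)//=; lra.
have [r10 r11] : 0 <= r1 /\ r1 < 1.
  by have := cos_geN1 d; rewrite /r1; split; lra.
(* A value strictly between [r1] and 1, which the peak exceeds on the smaller box [Q]. The two
   contributions then compare like $(r_1/r_2)^N$. *)
pose r2 := (1 + r1) / 2.
have [r20 r12] : 0 < r2 /\ r1 < r2 by rewrite /r2; split; lra.
have [d2 d20 qd2] : exists2 d : R, 0 < d & forall x, (forall i, `|x 0 i - a 0 i| < d) -> r2 < peak a x.
  by apply: continuous_gt_box; [exact: continuous_peak|rewrite peak_center /r2; lra].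
pose d' := Num.min d d2.
have d'0 : 0 < d' by rewrite lt_min dpos.
have [d'd d'd2] : d' <= d /\ d' <= d2 by split; rewrite /d' ge_min lexx ?orbT.
pose Q := [set x : 'rV[R]_n | forall i, x 0 i \in `]a 0 i - d', a 0 i + d'[].
have Q0 : 0 < fine (mu Q).
  apply: torus_measure_box_gt0 => i; have [] := ad0 i => h1 h2; lra.
have QP x : Q x -> forall i, `|x 0 i - a 0 i| < d'.
  by move=> Qx i; have := Qx i; rewrite in_itv/= -ltr_distl.
have mQ : measurable Q.
  apply: (@measurable_row_box R n (fun i => [set` `]a 0 i - d', a 0 i + d'[])) => i.
  exact: measurable_itv.
have M0 : 0 <= M by exact: le_trans (normr_ge0 _) (fM a).
pose K := M * fine (mu (~` Q)).
suff key N : ep * fine (mu Q) <= K * (r1 / r2) ^+ N.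
  have : (fun N => K * (r1 / r2) ^+ N) @ \oo --> 0.
    rewrite -[X in _ --> X](mulr0 K); apply: cvgMr; apply: cvg_expr.
    have q0 : 0 <= r1 / r2 by exact: divr_ge0 r10 (ltW r20).
    by rewrite (ger0_norm q0) (ltr_pdivrMr _ _ r20) mul1r.
  move=> cv; have epQ : 0 < ep * fine (mu Q) by exact: mulr_gt0.
  have [N _ hN] := cvgr_lt _ cv _ epQ.
  by have := hN N (leqnn N); rewrite /= ltNge key.
have mf : measurable_fun setT f by exact: continuous_measurable_row.
have mq : measurable_fun setT (peak a) by apply: continuous_measurable_row; exact: continuous_peak.
have ifq : mu.-integrable setT (EFin \o (fun x => f x * peak a x ^+ N)).
  apply: (@bounded_integrable _ _ _ mu _ M).
    by apply: measurable_funM => //; exact: measurable_funX.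
  move=> x; rewrite normrM normrX (ger0_norm (peak_ge0 _ _)).
  by rewrite -[leRHS]mulr1 ler_pM// ?exprn_ge0 ?peak_ge0// exprn_ile1 ?peak_ge0 ?peak_le1.
have iS (D : set 'rV[R]_n) g : measurable D -> mu.-integrable setT g -> mu.-integrable D g.
  by move=> mD; exact: integrableS.
have split0 : Rintegral mu Q (fun x => f x * peak a x ^+ N) +
    Rintegral mu (~` Q) (fun x => f x * peak a x ^+ N) = 0.
  rewrite -Rintegral_setU ?setUv//; first exact: measurableC.
  by rewrite disj_set2E setICr.
have cst_int (c : R) : mu.-integrable setT (EFin \o (fun=> c)).
  by apply: (@bounded_integrable _ _ _ mu _ `|c|).
have lowQ : ep * r2 ^+ N * fine (mu Q) <= Rintegral mu Q (fun x => f x * peak a x ^+ N).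
  rewrite -Rintegral_cst//; apply: le_Rintegral => //.
  - exact: iS.
  - exact: iS.
  - move=> x Qx; have xd i : `|x 0 i - a 0 i| < d' := QP x Qx i.
    have h1 : ep <= f x.
      by apply/ltW/fd1 => i; exact: lt_le_trans (xd i) (le_trans d'd dd1).
    have h2 : r2 <= peak a x.
      by apply/ltW/qd2 => i; exact: lt_le_trans (xd i) d'd2.
    have h3 : r2 ^+ N <= peak a x ^+ N.
      by rewrite lerXn2r ?nnegrE ?peak_ge0 ?(ltW r20).
    apply: ler_pM => //; [exact: ltW|by rewrite exprn_ge0// ltW].
have mcQ : measurable (~` Q) by exact: measurableC.
have mcube : measurable (~` Q `&` @cube R n).
  by apply: measurableI => //; exact: measurable_cube.
have lowC : - (M * r1 ^+ N) * fine (mu (~` Q)) <=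
    Rintegral mu (~` Q) (fun x => f x * peak a x ^+ N).
  (* The part outside the cube is discarded, since [peak] is 1 at the translates of [a] by periods
     and the bound [r1] fails there. *)
  have cubeE (g : 'rV[R]_n -> R) : mu.-integrable setT (EFin \o g) ->
      Rintegral mu (~` Q) g = Rintegral mu (~` Q `&` @cube R n) g.
    move=> ig; rewrite /Rintegral (@negligible_integral _ _ _ mu (~` Q) (~` @cube R n))//.
    - by rewrite setDE setCK.
    - by apply: measurableC; exact: measurable_cube.
    - exact: iS.
    - exact: torus_measure_setC_cube.
  rewrite -Rintegral_cst// !cubeE//.
  apply: le_Rintegral => //; [exact: iS|exact: iS|move=> x [nQx cx]].
  (* Off [Q] but within [d] of [a] the integrand is nonnegative; farther away the peak is at most
     [r1]. *)
  have [near_a|/existsNP[i /negP]] := pselect (forall i, `|x 0 i - a 0 i| < d).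
    apply: (@le_trans _ _ 0); first by rewrite oppr_le0 mulr_ge0// exprn_ge0.
    rewrite mulr_ge0 ?exprn_ge0 ?peak_ge0//; apply/ltW/(lt_trans ep0)/fd1 => i.
    exact: lt_le_trans (near_a i) dd1.
  rewrite -leNgt => nxi.
  rewrite lerNl -mulNr; apply: (le_trans (ler_norm _)).
  rewrite normrM normrN; apply: ler_pM => //.
  have pp : peak a x <= r1.
    apply: (le_trans (peak_le_factor a x i)); rewrite /r1.
    have := cx i; rewrite /period /= in_itv/= => /andP[x0 x2].
    have [h1 h2] := ad0 i.
    have : cos (x 0 i - a 0 i) <= cos d.
      apply: cos_le_of_far => //; first exact: ltW.
      by rewrite ler_norml; apply/andP; split; lra.
    by lra.
  rewrite ger0_norm ?exprn_ge0 ?peak_ge0//.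
  by rewrite lerXn2r ?nnegrE ?peak_ge0.
have r2N : 0 < r2 ^+ N by rewrite exprn_gt0.
rewrite expr_div_n mulrA ler_pdivlMr// /K.
by move: lowQ lowC split0; lra.
Qed.


End Peak.

Section Vanish.
Context (R : realType) (n : nat).

(* [le0_of_peak_integral] needs an interior point of the cube: a point of the cube
   is moved slightly towards the centre. *)
Lemma le0_of_all_peaks (f : 'rV[R]_n -> R) M : continuous f -> (forall x, `|f x| <= M) ->
  (forall i, periodic f (2 * pi *: delta_mx 0 i)) ->
  (forall a N, Rintegral (torus_measure R n) setT (fun x => f x * peak a x ^+ N) = 0) ->
  forall x, f x <= 0.
Proof.
move=> cf fM pf f0 x; have [k cy] := translate_cube x.
rewrite -(periodic_translate k x pf); set y := x + _ in cy *.
rewrite leNgt; apply/negP => fy0.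
have [d d_0 dP] := continuous_gt_box cf fy0.
have pi0 := pi_gt0 R.
pose s := Num.min 1 (d / (2 * pi)).
have s0 : 0 < s by rewrite lt_min ltr01 divr_gt0// mulr_gt0.
have s1 : s <= 1 by rewrite /s ge_min lexx.
have spi : s * pi < d.
  apply: (@le_lt_trans _ _ (d / 2)); last by rewrite gtr_pMr// invf_lt1// ltr1n.
  have -> : d / 2 = d / (2 * pi) * pi by rewrite invfM mulrA -mulrA mulVf ?mulr1// gt_eqF.
  by rewrite ler_wpM2r ?(ltW pi0)// /s ge_min lexx orbT.
(* The convex combination of [y] and the centre with weight [s] on the centre: its coordinates lie
   in $[s\pi,2\pi-s\pi]$, and each differs from that of [y] by at most $s\pi<d$. *)
pose a : 'rV[R]_n := \row_i (y 0 i + s * (pi - y 0 i)).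
have y02 i : 0 <= y 0 i /\ y 0 i <= 2 * pi.
  by have := cy i; rewrite /period /= in_itv/= => /andP.
have fa : f a <= 0.
  apply: (@le0_of_peak_integral R n f a (s * pi) M) => //; first exact: mulr_gt0.
  move=> i; rewrite mxE; have [h1 h2] := y02 i.
  have h3 : 0 <= (1 - s) * y 0 i by rewrite mulr_ge0// subr_ge0.
  have h4 : (1 - s) * y 0 i <= (1 - s) * (2 * pi) by rewrite ler_wpM2l// subr_ge0.
  split.
    have -> : y 0 i + s * (pi - y 0 i) = (1 - s) * y 0 i + s * pi by ring.
    lra.
  have -> : y 0 i + s * (pi - y 0 i) = (1 - s) * y 0 i + s * pi by ring.
  have -> : 2 * pi - s * pi = (1 - s) * (2 * pi) + s * pi by ring.
  by rewrite lerD2r.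
have : 0 < f a.
  apply: dP => i; rewrite mxE addrAC subrr add0r normrM (gtr0_norm s0).
  apply: le_lt_trans spi; rewrite ler_wpM2l ?(ltW s0)//.
  have [h1 h2] := y02 i.
  by rewrite ler_norml; apply/andP; split; lra.
by rewrite ltNge fa.
Qed.

(** The real and imaginary parts and their negatives all integrate to zero against the powers of the
    peaks, hence are nonpositive. *)
Lemma continuous_zero_coefficients (F : 'rV[R]_n -> R[i]) M :
  continuous (@complex.Re R \o F) -> continuous (@complex.Im R \o F) ->
  torus_periodic F -> (forall x, Normc.normc (F x) <= M) ->
  (forall xi, cintegral (fun x => F x * e_ xi x) = 0) -> forall x, F x = 0.
Proof.
move=> cr ci pF FM F0 x.
have zF : zero_coefficients F.
  split=> //; last by exists M.
  by split; exact: continuous_measurable_row.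
have vanish (f : 'rV[R]_n -> R) : continuous f -> (forall x, `|f x| <= M) ->
    (forall i, periodic f (2 * pi *: delta_mx 0 i)) ->
    (forall a N, Rintegral (torus_measure R n) setT (fun x => f x * peak a x ^+ N) = 0) ->
    f x = 0.
  move=> cf fM pf f0; apply/eqP; rewrite eq_le (le0_of_all_peaks cf fM pf f0)/=.
  rewrite -oppr_le0; apply: (@le0_of_all_peaks (fun y => - f y) M).
  - by move=> y; exact: cvgN (cf y).
  - by move=> y; rewrite normrN.
  - by move=> i y; rewrite pf.
  - move=> a N; rewrite -[RHS]oppr0 -(f0 a N) -mulN1r -RintegralZl//.
      by apply: eq_Rintegral => y _; rewrite mulN1r mulNr.
    apply: (@bounded_integrable _ _ _ (torus_measure R n) _ M).
      apply: measurable_funM; first exact: continuous_measurable_row.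
      by apply: measurable_funX; apply: continuous_measurable_row; exact: continuous_peak.
    move=> y; rewrite normrM normrX (ger0_norm (peak_ge0 _ _)).
    rewrite -[leRHS]mulr1 ler_pM// ?exprn_ge0 ?peak_ge0// exprn_ile1 ?peak_ge0 ?peak_le1//.
apply/eqP; rewrite eq_complex /=; apply/andP; split; apply/eqP.
  apply: (vanish (@complex.Re R \o F)) => //.
  - by move=> y; exact: le_trans (Re_le_normc _) (FM y).
  - by move=> i y; rewrite /= pF.
  - by move=> a N; have [] := zero_coefficients_peak a N zF.
apply: (vanish (@complex.Im R \o F)) => //.
- by move=> y; exact: le_trans (Im_le_normc _) (FM y).
- by move=> i y; rewrite /= pF.
- by move=> a N; have [] := zero_coefficients_peak a N zF.
Qed.

End Vanish.

(** * Lattice sums *)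

Section LatticeSums.
Context (R : realType).

Lemma ler_sum_sub (T : eqType) (F : T -> R) (s t : seq T) :
  (forall x, 0 <= F x) -> uniq s -> {subset s <= t} ->
  \sum_(x <- s) F x <= \sum_(x <- t) F x.
Proof.
move=> F0; elim: s t => [|x s IH] t /=; first by rewrite big_nil sumr_ge0.
move=> /andP[xs us] st.
have xt : x \in t by apply: st; rewrite mem_head.
rewrite big_cons (perm_big _ (perm_to_rem xt)) big_cons lerD2l.
apply: IH => // y ys; have yx : y != x by apply: contraNneq xs => <-.
by have := st y; rewrite inE ys orbT => /(_ isT); rewrite (perm_mem (perm_to_rem xt)) inE (negbTE yx).
Qed.

(** Compares $1/(b+1)^2$ with $1/b-1/(b+1)$. *)
Let telescope (a : R) N : 0 < a ->
  \sum_(0 <= m < N) ((a + m.+1%:R) ^+ 2)^-1 <= a^-1 - (a + N%:R)^-1.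
Proof.
move=> a0; elim: N => [|N IH]; first by rewrite big_geq// addr0 subrr.
rewrite big_nat_recr//=; apply: (le_trans (lerD IH (lexx _))).
rewrite -addrA lerD2l; set b := a + N%:R.
have b0 : 0 < b by rewrite ltr_wpDr.
have -> : a + N.+1%:R = b + 1 by rewrite /b -natr1 addrA.
rewrite -subr_ge0.
have -> : - (b + 1)^-1 - (- b^-1 + ((b + 1) ^+ 2)^-1) = (b * (b + 1) ^+ 2)^-1.
  by field; rewrite !gt_eqF// ltr_wpDr.
by rewrite invr_ge0 mulr_ge0// ?sqr_ge0// ltW.
Qed.

(** Each of the three groups $k=0$, $k>0$ and $k<0$ contributes at most $1/a$: the first because
    $a\ge 1$, the others by telescoping. Note that [Negz j] is $-(j+1)$. *)
Let sum_int (a : R) (t : seq int) : 1 <= a -> uniq t ->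
  \sum_(k <- t) ((a + `|k|%:~R) ^+ 2)^-1 <= 3 / a.
Proof.
move=> a1 ut; have a0 : 0 < a by exact: lt_le_trans a1.
pose N := (\max_(k <- t) `|k|%N).+1.
have tN : {subset t <= map Posz (iota 0 N) ++ map Negz (iota 0 N)}.
  move=> k kt; have kN : (`|k| < N)%N.
    by rewrite ltnS; exact: (leq_bigmax_seq k kt isT).
  rewrite mem_cat; apply/orP; case: k kt kN => m kt kN; [left|right].
    by apply/mapP; exists m; rewrite // mem_iota.
  by apply/mapP; exists m; rewrite // mem_iota /= add0n ltnW.
apply: (le_trans (ler_sum_sub _ ut tN)) => [k|].
  by rewrite invr_ge0 sqr_ge0.
rewrite big_cat !big_map/=.
have E1 : \sum_(j <- iota 0 N) ((a + `|Posz j|%:~R) ^+ 2)^-1 <= a^-1 + a^-1 :> R.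
  rewrite /N /= big_cons; apply: lerD.
    rewrite addr0 lef_pV2 ?posrE ?exprn_gt0//; rewrite expr2.
    exact: ler_peMl (ltW a0) a1.
  rewrite -[1%N]addn0 iotaDl big_map.
  apply: (@le_trans _ _ (a^-1 - (a + (\max_(k <- t) `|k|%N)%:R)^-1)).
    apply: le_trans (telescope _ a0); rewrite /index_iota subn0 le_eqVlt.
    by apply/orP; left; apply/eqP; apply: eq_bigr => j _; rewrite add1n.
  by rewrite gerBl invr_ge0 addr_ge0// ltW.
have E2 : \sum_(j <- iota 0 N) ((a + `|Negz j|%:~R) ^+ 2)^-1 <= a^-1 :> R.
  apply: (@le_trans _ _ (a^-1 - (a + N%:R)^-1)).
    by apply: le_trans (telescope _ a0); rewrite /index_iota subn0.
  by rewrite gerBl invr_ge0 addr_ge0// ltW.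
by apply: (le_trans (lerD E1 E2)); lra.
Qed.

Let consz n (k : int) (xi : 'rV[int]_n) : 'rV[int]_n.+1 :=
  \row_i if unlift 0 i is Some j then xi 0 j else k.

Let den_ge0 n m (a : R) (xi : 'rV[int]_n) : 0 < a ->
  0 <= ((a + \sum_(i < n) `|xi 0 i|%:~R) ^+ m)^-1.
Proof.
move=> a0; rewrite invr_ge0 exprn_ge0// addr_ge0//; first exact: ltW.
by apply: sumr_ge0 => i _; rewrite ler0z.
Qed.

(* Dimension by dimension: summing over one coordinate costs one power of the
   denominator. *)
Lemma lattice_sum_le n (a : R) (s : seq 'rV[int]_n) : 1 <= a -> uniq s ->
  \sum_(xi <- s) ((a + \sum_(i < n) `|xi 0 i|%:~R) ^+ n.+1)^-1 <= 3 ^+ n / a.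
Proof.
elim: n a s => [|n IH] a s a1 us; have a0 : 0 < a by exact: lt_le_trans a1.
  have s0 : {subset s <= [:: 0]} by move=> x _; rewrite inE; apply/eqP/rowP; case.
  apply: (le_trans (ler_sum_sub _ us s0)) => [x|].
    exact: den_ge0.
  by rewrite big_seq1 big_ord0 addr0 expr1 mul1r.
pose K := undup [seq xi 0 ord0 | xi : 'rV[int]_n.+1 <- s].
pose T := undup [seq \row_j xi 0 (lift ord0 j) | xi : 'rV[int]_n.+1 <- s].
(* The finite set is enlarged to a product of a set of first coordinates and a set of tails, over
   which the sum can be iterated. *)
have sKT : {subset s <= [seq consz k xi | k <- K, xi <- T]}.
  move=> xi xis; apply/allpairsP; exists (xi 0 ord0, \row_j xi 0 (lift ord0 j)); split => /=.
  - by rewrite mem_undup; apply/mapP; exists xi.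
  - by rewrite mem_undup; apply/mapP; exists xi.
  - by apply/rowP => i; rewrite mxE; case: unliftP => [j ->|->//]; rewrite mxE.
apply: (le_trans (ler_sum_sub _ us sKT)) => [x|].
  exact: den_ge0.
rewrite big_allpairs_dep/=.
(* The induction hypothesis is used at $a+|k|$. One of the $n+2$ factors of the denominator is
   bounded below by $a+|k|$, the sum over the others gives $3^n/(a+|k|)$, and the square that
   results is summable over $k$. *)
have IHk k : \sum_(xi <- T) ((a + \sum_(i < n.+1) `|consz k xi 0 i|%:~R) ^+ n.+2)^-1 <=
    3 ^+ n * ((a + `|k|%:~R) ^+ 2)^-1 :> R.
  have b1 : 1 <= a + `|k|%:~R by rewrite ler_wpDr.
  have b0 : 0 < a + `|k|%:~R by exact: lt_le_trans b1.
  rewrite expr2 invfM mulrA -ler_pdivrMr ?invr_gt0// invrK mulrC mulr_sumr.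
  apply: le_trans (IH _ T b1 (undup_uniq _)); apply: ler_sum => xi _.
  rewrite big_ord_recl mxE unlift_none addrA.
  under eq_bigr do rewrite mxE liftK.
  set c := (_ + \sum_(i < n) _).
  have c0 : a + `|k|%:~R <= c by rewrite lerDl sumr_ge0.
  have c00 : 0 < c by exact: lt_le_trans c0.
  rewrite exprS invfM mulrA -[leRHS]mul1r ler_wpM2r ?invr_ge0 ?exprn_ge0 ?(ltW c00)//.
  by rewrite ler_pdivrMr// mul1r.
apply: (le_trans (ler_sum _ (fun k _ => IHk k))).
rewrite -mulr_sumr exprSr -mulrA ler_wpM2l ?exprn_ge0//.
exact: sum_int (undup_uniq _).
Qed.

Definition weight n k (xi : 'rV[int]_n) : R :=
  1 + \sum_(i < n) ((xi 0 i)%:~R ^+ k) ^+ 2.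

Lemma weight_ge1 n k (xi : 'rV[int]_n) : 1 <= weight k xi.
Proof. by rewrite lerDl sumr_ge0// => i _; exact: sqr_ge0. Qed.

Lemma weight_gt0 n k (xi : 'rV[int]_n) : 0 < weight k xi.
Proof. exact: lt_le_trans (weight_ge1 _ _). Qed.

(** With $m=\max(1,\max_i|\xi_i|)$ one has $1+\sum_i|\xi_i|\le(n+1)m$ and $m^{2k}\le w(\xi)$, while
    $m^{n+1}\le m^{2k}$ because $m\ge1$ and $n+1\le 2k$. *)
Let weight_lower n k (xi : 'rV[int]_n) : (n.+1 <= k.*2)%N ->
  (1 + \sum_(i < n) `|xi 0 i|%:~R) ^+ n.+1 <= n.+1%:R ^+ n.+1 * weight k xi.
Proof.
move=> nk; have [m [m1 xm mw]] : exists m : R, [/\ 1 <= m,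
    forall i : 'I_n, `|xi 0 i|%:~R <= m & m ^+ k.*2 <= weight k xi].
  suff [m [m1 xm mw]] : exists m : R, [/\ 1 <= m,
      forall i : 'I_n, i \in index_enum 'I_n -> `|xi 0 i|%:~R <= m & m ^+ k.*2 <= weight k xi].
    by exists m; split => // i; apply: xm; rewrite mem_index_enum.
  rewrite /weight; elim: (index_enum _) => [|i s [m [m1 xm mw]]].
    by exists 1; split => //; rewrite big_nil addr0 expr1n.
  rewrite big_cons addrCA; have [le_m|lt_m] := leP (`|xi 0 i|%:~R : R) m.
    exists m; split => //.
      by move=> j; rewrite inE => /orP[/eqP ->//|]; exact: xm.
    by apply: (le_trans mw); rewrite lerDr sqr_ge0.
  exists `|xi 0 i|%:~R; split.
  - exact: le_trans m1 (ltW lt_m).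
  - by move=> j; rewrite inE => /orP[/eqP ->//|/xm/le_trans]; apply; exact: ltW.
  - rewrite -muln2 exprM intr_norm -normrX real_normK ?num_real// lerDl.
    by rewrite addr_ge0// sumr_ge0// => j _; exact: sqr_ge0.
apply: (@le_trans _ _ ((n.+1%:R * m) ^+ n.+1)).
  rewrite lerXn2r ?nnegrE//.
  - by rewrite addr_ge0// sumr_ge0.
  - by rewrite mulr_ge0// (le_trans _ m1).
  - rewrite -nat1r mulrDl mul1r lerD//.
    apply: (le_trans (ler_sum _ (fun i _ => xm i))).
    by rewrite sumr_const card_ord mulr_natl.
rewrite exprMn ler_wpM2l ?exprn_ge0//; apply: le_trans mw.
by apply: ler_weXn2l.
Qed.

(** The factor $(n+1)^{n+1}$ comes from comparing the weight with a power of $1+\sum_i|\xi_i|$, the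
    factor $3^n$ from the lattice sum at $a=1$. *)
Lemma sum_weight_le n k (s : seq 'rV[int]_n) : (n.+1 <= k.*2)%N -> uniq s ->
  \sum_(xi <- s) (weight k xi)^-1 <= n.+1%:R ^+ n.+1 * 3 ^+ n.
Proof.
move=> nk us; have := @lattice_sum_le n 1 s (lexx _) us; rewrite divr1.
move=> /(ler_wpM2l (exprn_ge0 n.+1 (ler0n R n.+1))); apply: le_trans.
rewrite mulr_sumr; apply: ler_sum => xi _.
have p0 : 0 < (1 + \sum_(i < n) `|xi 0 i|%:~R) ^+ n.+1 :> R.
  by rewrite exprn_gt0// ltr_pwDl// sumr_ge0.
rewrite ler_pdivlMr// mulrC ler_pdivrMr ?weight_gt0//.
exact: weight_lower.
Qed.

End LatticeSums.

(** * Fourier series *)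

Section FourierSeries.
Context (R : realType) (n : nat).
Implicit Types (f g : Cinf R n) (u v : L2fun R n) (i : 'I_n) (xi : 'rV[int]_n).

Definition hat u xi : R[i] := dot u (toL2 (e_ xi)) / (vol R n)%:C.

#[global] Arguments hat : simpl never.

Lemma vol_neq0 : (vol R n)%:C != 0.
Proof. by rewrite eq_complex /= eqxx andbT gt_eqF// vol_gt0. Qed.

Lemma hatZD (a : R[i]) u v xi : hat (a *: u + v) xi = a * hat u xi + hat v xi.
Proof. by rewrite /hat dotZDl mulrDl mulrA. Qed.

Lemma eq_hat u v : L2class u = L2class v -> hat u =1 hat v.
Proof. by move=> uv xi; rewrite /hat (eq_dotl _ uv). Qed.

Lemma bessel_hat u (s : seq 'rV[int]_n) : uniq s ->
  vol R n * \sum_(xi <- s) Normc.normc (hat u xi) ^+ 2 <= sqnorm u.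
Proof.
move=> us; have := @bessel R n _ (fun xi : 'rV[int]_n => toL2 (e_ xi)) (vol R n) (vol_gt0 R n) _ u s us.
by apply => xi eta; exact: dot_character.
Qed.

Lemma sqnorm_trig (c : 'rV[int]_n -> R[i]) (s : seq 'rV[int]_n) : uniq s ->
  sqnorm (toL2 (\sum_(xi <- s) c xi *: e_ xi)) = vol R n * \sum_(xi <- s) Normc.normc (c xi) ^+ 2.
Proof.
move=> us; rewrite toL2_sum.
under eq_bigr do rewrite toL2Z.
rewrite (@sqnorm_sum_orthogonal R n _ (fun xi : 'rV[int]_n => toL2 (e_ xi)) (vol R n))//.
by move=> xi eta; exact: dot_character.
Qed.

Let dot_mulC f xi : dot (toL2 f) (toL2 (e_ xi)) = cintegral (mulC f (e_ (- xi)) : 'rV[R]_n -> R[i]).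
Proof.
rewrite dot_toL2; congr cintegral; apply/funext => x.
by rewrite -characterN.
Qed.

(** Integration by parts: the integral of $\partial_i(f e_{-\xi})$ vanishes. *)
Lemma hat_Dc i f xi : hat (toL2 (Dc i f)) xi = (0 +i* (xi 0 i)%:~R) * hat (toL2 f) xi.
Proof.
rewrite /hat mulrA; congr (_ / _); rewrite !dot_mulC.
have := cintegral_Dc i (mulC f (e_ (- xi))); rewrite DcM Dc_character.
rewrite (_ : cintegral _ = - (0 +i* (xi 0 i)%:~R) * cintegral (mulC f (e_ (- xi)) : 'rV[R]_n -> R[i]) +
   cintegral (mulC (Dc i f) (e_ (- xi)) : 'rV[R]_n -> R[i])); last first.
  rewrite -cintegralZD; [|exact: Cinf_cintegrable..].
  congr cintegral; apply/funext => x; rewrite CinfDE !mulCE CinfZE addrC; congr (_ + _).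
  rewrite mxE mulrNz mulrCA; congr (_ * _).
  by apply/eqP; rewrite eq_complex /= oppr0 !eqxx.
by move/eqP; rewrite mulNr addrC subr_eq0 => /eqP.
Qed.

Lemma hat_iter_Dc i k f xi :
  hat (toL2 (iter k (Dc i) f)) xi = (0 +i* (xi 0 i)%:~R) ^+ k * hat (toL2 f) xi.
Proof.
elim: k => [|k IH]; first by rewrite expr0 mul1r.
by rewrite iterS hat_Dc IH exprS mulrA.
Qed.

Lemma sqnorm_le f (D : R) : (forall x, Normc.normc (f x) <= D) -> sqnorm (toL2 f) <= vol R n * D ^+ 2.
Proof.
move=> fD; rewrite mulrC -(Rintegral_cst (torus_measure R n) measurableT).
have D0 : 0 <= D by apply: le_trans (fD 0); exact: normc_ge0.
apply: le_Rintegral => //.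
- exact: (integrable_sqr (toL2 f)).
- by apply: (@bounded_integrable _ _ _ (torus_measure R n) _ `|D ^+ 2|).
- move=> x _; rewrite -normc_sqr ler_pXn2r ?nnegrE ?normc_ge0//.
  exact: fD.
Qed.

Let normc_imag_exp (t : R) k : Normc.normc ((0 +i* t) ^+ k) ^+ 2 = (t ^+ k) ^+ 2.
Proof.
elim: k => [|k IH]; first by rewrite !expr0 Normc.normc1.
rewrite [(0 +i* t) ^+ k.+1]exprS Normc.normcM exprMn IH [t ^+ k.+1]exprS exprMn; congr (_ * _).
by rewrite normc_sqr /= expr0n add0r.
Qed.

(** The factor [vol] in Bessel's inequality cancels against the one in [sqnorm_le], which is why it
    is absent from the bound. *)
Lemma weighted_bessel k f (D : R) (s : seq 'rV[int]_n) : uniq s ->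
  (forall x, Normc.normc (f x) <= D) ->
  (forall i x, Normc.normc (iter k (Dc i) f x) <= D) ->
  \sum_(xi <- s) weight R k xi * Normc.normc (hat (toL2 f) xi) ^+ 2 <= n.+1%:R * D ^+ 2.
Proof.
move=> us fD dD.
have B g : (forall x, Normc.normc (g x) <= D) ->
    \sum_(xi <- s) Normc.normc (hat (toL2 g) xi) ^+ 2 <= D ^+ 2.
  move=> gD; rewrite -(ler_pM2l (vol_gt0 R n)).
  exact: le_trans (bessel_hat (toL2 g) us) (sqnorm_le gD).
under eq_bigr do rewrite mulrDl mul1r.
rewrite big_split -nat1r mulrDl mul1r lerD//=; first exact: B.
under eq_bigr do rewrite mulr_suml.
rewrite exchange_big/=; apply: (@le_trans _ _ (\sum_(i < n) D ^+ 2)); last first.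
  by rewrite sumr_const card_ord mulr_natl.
apply: ler_sum => i _; apply: le_trans (B _ (dD i)).
rewrite le_eqVlt; apply/orP; left; apply/eqP; apply: eq_bigr => xi _.
by rewrite hat_iter_Dc Normc.normcM exprMn normc_imag_exp.
Qed.

#[global] Arguments Normc.normc : simpl never.

(** Sums $2h\le w h^2+1/w$, with $h=|\hat f(\xi)|$ and $w$ the weight: the first terms are
    controlled by the weighted Bessel inequality, the second by the lattice sum. *)
Lemma hat_summable f : exists B, forall s : seq 'rV[int]_n, uniq s ->
  \sum_(xi <- s) Normc.normc (hat (toL2 f) xi) <= B.
Proof.
pose k := (n./2).+1.
have nk : (n.+1 <= k.*2)%N by rewrite /k; lia.
have [D [fD dD]] : exists D, (forall x, Normc.normc (f x) <= D) /\
    (forall i x, Normc.normc (iter k (Dc i) f x) <= D).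
  have [M fM] := Cinf_bounded f.
  have /choice[N dN] : forall i, exists N, forall x, Normc.normc (iter k (Dc i) f x) <= N.
    by move=> i; exact: Cinf_bounded.
  exists (`|M| + \sum_i `|N i|); split => [x|i x].
    by rewrite (le_trans (fM x))// (le_trans (ler_norm _))// lerDl sumr_ge0.
  rewrite (le_trans (dN i x))// (le_trans (ler_norm _))// ler_wpDl//.
  by rewrite (bigD1 i)//= lerDl sumr_ge0.
exists ((n.+1%:R * D ^+ 2 + n.+1%:R ^+ n.+1 * 3 ^+ n) / 2) => s us.
have h1 := weighted_bessel us fD dD; have h2 := @sum_weight_le R n k s nk us.
rewrite ler_pdivlMr//; apply: le_trans (lerD h1 h2).
rewrite -big_split mulr_suml; apply: ler_sum => xi _ /=.
set w := weight _ _ _; set h := Normc.normc _.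
have w0 : 0 < w by exact: weight_gt0.
rewrite -subr_ge0.
have -> : w * h ^+ 2 + w^-1 - h * 2 = (w * h - 1) ^+ 2 / w by field; rewrite gt_eqF.
by rewrite divr_ge0 ?sqr_ge0 ?ltW.
Qed.

(** An exhaustion of the lattice by nested finite sets, read off its encoding as a countable type;
    [pmap] drops the integers that encode nothing. The order is immaterial, as the estimates are
    uniform over finite sets of frequencies. *)
Definition lattice_enum N : seq 'rV[int]_n := pmap (@pickle_inv _) (iota 0 N).

Lemma lattice_enum_uniq N : uniq (lattice_enum N).
Proof. exact: (pmap_uniq (@pickle_invK _) (iota_uniq _ _)). Qed.

Lemma mem_lattice_enum xi N : (pickle xi < N)%N -> xi \in lattice_enum N.
Proof.
move=> xN; rewrite mem_pmap; apply/mapP; exists (pickle xi).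
  by rewrite mem_iota.
by rewrite pickleK_inv.
Qed.

Lemma lattice_enum_cat N M : (N <= M)%N -> exists t, lattice_enum M = lattice_enum N ++ t.
Proof.
move=> NM; exists (pmap (@pickle_inv _) (iota N (M - N))).
by rewrite /lattice_enum -pmap_cat -[N in iota N _]add0n -iotaD subnKC.
Qed.

Definition fourier_sum N u : Cinf R n := \sum_(xi <- lattice_enum N) hat u xi *: e_ xi.

Lemma fourier_sumZD N (a : R[i]) u v :
  fourier_sum N (a *: u + v) = a *: fourier_sum N u + fourier_sum N v.
Proof.
rewrite /fourier_sum scaler_sumr -big_split; apply: eq_bigr => xi _ /=.
by rewrite hatZD scalerDl scalerA.
Qed.

Lemma eq_fourier_sum N u v : L2class u = L2class v -> fourier_sum N u = fourier_sum N v.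
Proof. by move=> uv; apply: eq_bigr => xi _; rewrite (eq_hat uv). Qed.

Lemma Dc_fourier_sum i N f : Dc i (fourier_sum N (toL2 f)) = fourier_sum N (toL2 (Dc i f)).
Proof.
rewrite /fourier_sum Dc_sum; apply: eq_bigr => xi _.
by rewrite DcZ Dc_character hat_Dc scalerA mulrC.
Qed.

Lemma Dm_fourier_sum b N f : Dm b (fourier_sum N (toL2 f)) = fourier_sum N (toL2 (Dm b f)).
Proof.
rewrite /Dm; elim: (enum _) => //= i s IH.
by elim: (b i) => //= k ->; rewrite Dc_fourier_sum.
Qed.

Lemma hat_fourier_sum N u xi : xi \in lattice_enum N -> hat (toL2 (fourier_sum N u)) xi = hat u xi.
Proof.
move=> xiN; rewrite {1}/hat /fourier_sum toL2_sum.
under eq_bigr do rewrite toL2Z.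
rewrite (@dot_sum_orthogonal R n _ (fun xi : 'rV[int]_n => toL2 (e_ xi)) (vol R n))//.
- by rewrite mulrAC divff ?mul1r// vol_neq0.
- by move=> ? ?; exact: dot_character.
- exact: lattice_enum_uniq.
Qed.

End FourierSeries.

(** * Fourier inversion *)

Section FourierInversion.
Context (R : realType).

(** The intervals $[u_N-e_N,u_N+e_N]$ meet pairwise, both containing the term of index $\max(N,M)$,
    so the supremum of the left ends lies in all of them. The bound $e_N$ is thus kept in the limit
    without loss. *)
Lemma cauchy_limit (T : Type) (u : nat -> T -> R) (e : nat -> T -> R) :
  (forall N M x, (N <= M)%N -> `|u M x - u N x| <= e N x) ->
  exists g : T -> R, forall N x, `|g x - u N x| <= e N x.
Proof.
move=> uc.
have uM N M x : u N x - e N x <= u M x + e M x.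
  have h1 := uc N (maxn N M) x (leq_maxl _ _); have h2 := uc M (maxn N M) x (leq_maxr _ _).
  by move: h1 h2; rewrite !ler_norml => /andP[? ?] /andP[? ?]; lra.
pose B x := range (fun N => u N x - e N x).
have hs x : has_sup (B x).
  split; first by exists (u 0%N x - e 0%N x); exists 0%N.
  by exists (u 0%N x + e 0%N x) => _ [N _ <-].
exists (fun x => sup (B x)) => N x; rewrite ler_norml; apply/andP; split.
  have : u N x - e N x <= sup (B x) by apply: sup_ubound; [exact: (hs x).2|exists N].
  lra.
have : sup (B x) <= u N x + e N x.
  by apply: ge_sup; [exact: (hs x).1|move=> _ [M _ <-]].
lra.
Qed.

Lemma uniform_limit_continuous_row n (u : nat -> 'rV[R]_n -> R) (g : 'rV[R]_n -> R) (e : nat -> R) :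
  (forall eps, 0 < eps -> exists N, e N < eps) ->
  (forall N, continuous (u N)) -> (forall N x, `|g x - u N x| <= e N) -> continuous g.
Proof.
move=> e_0 cu gu x; have FF : Filter (nbhs x) by exact: nbhs_filter.
apply/cvgrPdist_lt => eps eps0.
have [N eN] : exists N, e N < eps / 3 by apply: e_0; rewrite divr_gt0.
have cN : \forall y \near x, `|u N x - u N y| < eps / 3.
  have := cu N x => /cvgrPdist_lt; apply; rewrite divr_gt0//.
apply: filterS cN => y uxy.
have h1 := gu N x; have h2 := gu N y.
have -> : g x - g y = (g x - u N x) + (u N x - u N y) - (g y - u N y) by ring.
rewrite (le_lt_trans (ler_normB _ _))//.
have := ler_normD (g x - u N x) (u N x - u N y); lra.
Qed.

(** The modulus [e N] is the supremum of the partial sums minus the [N]-th one. It is what the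
    Cauchy arguments here and in [extends_exists] run on. *)
Lemma bounded_sum_tail (T : eqType) (c : T -> R) (z : nat -> seq T) (B : R) :
  (forall x, 0 <= c x) -> (forall N M, (N <= M)%N -> exists t, z M = z N ++ t) ->
  (forall N, \sum_(x <- z N) c x <= B) ->
  exists e : nat -> R, (forall eps, 0 < eps -> exists N, forall M, (N <= M)%N -> e M < eps) /\
    (forall N M, (N <= M)%N -> \sum_(x <- z M) c x - \sum_(x <- z N) c x <= e N).
Proof.
move=> c0 zt zB; pose A N := \sum_(x <- z N) c x.
have Amono N M : (N <= M)%N -> A N <= A M.
  by move=> /zt[t zE]; rewrite /A zE big_cat/= lerDl sumr_ge0.
have hs : has_sup (range A).
  by split; [exists (A 0%N); exists 0%N|exists B => _ [N _ <-]; exact: zB].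
exists (fun N => sup (range A) - A N); split.
- move=> eps eps0; have [_ [N _ <-] AN] := sup_adherent eps0 hs.
  exists N => M NM; have := Amono _ _ NM; lra.
- by move=> N M NM; rewrite lerD2r; apply: sup_ubound; [exact: hs.2|exists M].
Qed.

Context (n : nat).
Implicit Types (f : Cinf R n).

(** The partial sums converge uniformly to a continuous periodic [g] because the coefficients are
    summable; [f - g] has vanishing Fourier coefficients, so [g] is [f]. *)
Lemma fourier_inversion f : exists e : nat -> R,
  (forall eps, 0 < eps -> exists N, forall M, (N <= M)%N -> e M < eps) /\
  forall N x, Normc.normc (f x - fourier_sum N (toL2 f) x) <= e N.
Proof.
have [B fB] := hat_summable f.
have [e [e_0 eP]] := @bounded_sum_tail _ (fun xi => Normc.normc (hat (toL2 f) xi)) (lattice_enum n) B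
  (fun xi => normc_ge0 _) (@lattice_enum_cat n) (fun N => fB _ (lattice_enum_uniq n N)).
have SP N M x : (N <= M)%N -> Normc.normc (fourier_sum M (toL2 f) x - fourier_sum N (toL2 f) x) <= e N.
  move=> NM; apply: le_trans (eP N M NM); have [t zE] := lattice_enum_cat n NM.
  rewrite /fourier_sum !Cinf_sumE zE !big_cat/= [X in X - _]addrC addrK [leRHS]addrC addKr.
  apply: (le_trans (normc_sum _ _)); rewrite le_eqVlt; apply/orP; left; apply/eqP.
  apply: eq_bigr => xi _.
  transitivity (Normc.normc (hat (toL2 f) xi * e_ xi x)) => //.
  by rewrite Normc.normcM normc_character mulr1.
have [gr grP] : exists g, forall N x, `|g x - complex.Re (fourier_sum N (toL2 f) x)| <= e N.
  apply: (@cauchy_limit _ _ (fun N _ => e N)) => N M x /(SP _ _ x); apply: le_trans.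
  rewrite (_ : _ - _ = complex.Re (fourier_sum M (toL2 f) x - fourier_sum N (toL2 f) x)) ?Re_le_normc//.
  by case: (Cinf_fun _ _); case: (Cinf_fun _ _).
have [gi giP] : exists g, forall N x, `|g x - complex.Im (fourier_sum N (toL2 f) x)| <= e N.
  apply: (@cauchy_limit _ _ (fun N _ => e N)) => N M x /(SP _ _ x); apply: le_trans.
  rewrite (_ : _ - _ = complex.Im (fourier_sum M (toL2 f) x - fourier_sum N (toL2 f) x)) ?Im_le_normc//.
  by case: (Cinf_fun _ _); case: (Cinf_fun _ _).
have e_1 eps : 0 < eps -> exists N, e N < eps.
  by move=> /e_0[N eN]; exists N; exact: eN.
have Scont N : continuous (@complex.Re R \o fourier_sum N (toL2 f)) /\
    continuous (@complex.Im R \o fourier_sum N (toL2 f)).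
  by have [_ sr si] := CinfP (fourier_sum N (toL2 f)); split; exact: smooth_continuous.
have cgr : continuous gr by apply: (uniform_limit_continuous_row e_1 (fun N => (Scont N).1) grP).
have cgi : continuous gi by apply: (uniform_limit_continuous_row e_1 (fun N => (Scont N).2) giP).
pose g x : R[i] := gr x +i* gi x.
(* The limits of the real and imaginary parts were built separately, hence the factor 2. *)
have gP N x : Normc.normc (g x - fourier_sum N (toL2 f) x) <= 2 * e N.
  apply: (le_trans (normc_le_ReIm _)); rewrite mulr_natl mulr2n; apply: lerD.
    by apply: le_trans (grP N x); rewrite /g; case: (Cinf_fun _ _).
  by apply: le_trans (giP N x); rewrite /g; case: (Cinf_fun _ _).
(* Uniqueness of limits, used to carry periodicity from the partial sums over to [g]. *)
have cvg_eq (a b : R) (s : nat -> R) : (forall N, `|a - s N| <= e N) ->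
    (forall N, `|b - s N| <= e N) -> a = b.
  move=> ha hb; apply/eqP; rewrite -subr_eq0 -normr_le0; apply/ler_addgt0Pr => eps eps0; rewrite add0r.
  have [N eN] := e_1 (eps / 2) (divr_gt0 eps0 (ltr0n _ 2)).
  have -> : a - b = (a - s N) - (b - s N) by ring.
  apply: (le_trans (ler_normB _ _)); have := ha N; have := hb N; lra.
have pg : torus_periodic g.
  move=> i x; rewrite /g; congr (_ +i* _).
    apply: (cvg_eq _ _ (fun N => complex.Re (fourier_sum N (toL2 f) x))) => N; last exact: grP.
    by have := grP N (x + 2 * pi *: delta_mx 0 i); have [-> _ _] := CinfP (fourier_sum N (toL2 f)).
  apply: (cvg_eq _ _ (fun N => complex.Im (fourier_sum N (toL2 f) x))) => N; last exact: giP.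
  by have := giP N (x + 2 * pi *: delta_mx 0 i); have [-> _ _] := CinfP (fourier_sum N (toL2 f)).
suff fg x : f x - g x = 0.
  exists (fun N => 2 * e N); split.
    move=> eps eps0; have [N eN] := e_0 (eps / 2) (divr_gt0 eps0 (ltr0n _ 2)).
    by exists N => M /eN; lra.
  by move=> N x; move/eqP: (fg x); rewrite subr_eq0 => /eqP ->.
have [_ fr fi] := CinfP f.
have [M fM] := Cinf_bounded f.
have [M' SM] := Cinf_bounded (fourier_sum 0 (toL2 f)).
have gM y : Normc.normc (g y) <= 2 * e 0%N + M'.
  have -> : g y = (g y - fourier_sum 0 (toL2 f) y) + fourier_sum 0 (toL2 f) y by rewrite subrK.
  by apply: (le_trans (le_normcD _ _)); apply: lerD; [exact: gP|exact: SM].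
have mg : cmeasurable g by split; exact: continuous_measurable_row.
have Rfg : @complex.Re R \o (fun y => f y - g y) = fun y => (@complex.Re R \o f) y - gr y.
  by apply/funext => y; rewrite /comp /g; case: (f y).
have Ifg : @complex.Im R \o (fun y => f y - g y) = fun y => (@complex.Im R \o f) y - gi y.
  by apply/funext => y; rewrite /comp /g; case: (f y).
apply: (@continuous_zero_coefficients R n (fun y => f y - g y) (M + (2 * e 0%N + M'))).
- by rewrite Rfg => y; exact: (cvgB (smooth_continuous fr (x := y)) (cgr y)).
- by rewrite Ifg => y; exact: (cvgB (smooth_continuous fi (x := y)) (cgi y)).
- by move=> i y; have [pf _ _] := CinfP f; rewrite pf pg.
- by move=> y; apply: (le_trans (le_normcD _ _)); rewrite normcN lerD.
move=> xi; apply: Normc.eq0_normc; apply/eqP; rewrite eq_le normc_ge0 andbT.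
apply/ler_addgt0Pr => eps eps0; rewrite add0r.
have V0 := vol_gt0 R n.
(* Chosen so that $2\cdot(2e_N)\cdot\mathrm{vol}<\varepsilon$, the bound of [normc_cintegral] for an
   integrand of size $2e_N$. *)
have e4 : 0 < eps / (4 * vol R n) by rewrite divr_gt0// mulr_gt0.
have [N0 eN0] := e_0 _ e4.
(* Besides making [e N] small, [N] must be large enough for the partial sum to contain the frequency
   [- xi]: integrating against [e_ xi] picks the coefficient at [- xi], which then cancels in
   $f-S_Nf$. *)
pose N := maxn N0 (pickle (- xi)).+1.
have eN : e N < eps / (4 * vol R n) by apply: eN0; exact: leq_maxl.
have zN : (- xi) \in lattice_enum n N by apply: mem_lattice_enum; exact: leq_maxr.
have iS : cintegral (fun y => (f y - fourier_sum N (toL2 f) y) * e_ xi y) = 0.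
  have -> : (fun y => (f y - fourier_sum N (toL2 f) y) * e_ xi y) =
      (fun y => toL2 (f - fourier_sum N (toL2 f)) y * (toL2 (e_ (- xi)) y)^*).
    apply/funext => y; rewrite !toL2E -characterN opprK.
    by rewrite -[in RHS]/(_ y) CinfBE.
  rewrite -[LHS]/(dot _ _) toL2B dotDl dotNl.
  have := hat_fourier_sum (toL2 f) zN; rewrite /hat => /(congr1 (fun z => z * (vol R n)%:C)).
  by rewrite !mulfVK ?vol_neq0// => ->; rewrite subrr.
have mD : cmeasurable (fun y => (fourier_sum N (toL2 f) y - g y) * e_ xi y).
  apply: cmeasurableM; last exact: Cinf_cmeasurable.
  have := cmeasurableZD (-1) mg (Cinf_cmeasurable (fourier_sum N (toL2 f))).
  by congr cmeasurable; apply/funext => y; rewrite !fctE scaleN1r addrC.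
have Db y : Normc.normc ((fourier_sum N (toL2 f) y - g y) * e_ xi y) <= 2 * e N.
  by rewrite Normc.normcM normc_character mulr1 -normcN opprB.
have i1 : cintegrable (fun y => (f y - fourier_sum N (toL2 f) y) * e_ xi y).
  have := Cinf_cintegrable (mulC (f - fourier_sum N (toL2 f)) (e_ xi)).
  by congr cintegrable; apply/funext => y; rewrite mulCE CinfBE.
have -> : (fun y => (f y - g y) * e_ xi y) = (fun y => 1 * ((f y - fourier_sum N (toL2 f) y) * e_ xi y) +
    (fourier_sum N (toL2 f) y - g y) * e_ xi y).
  by apply/funext => y; rewrite mul1r -mulrDl addrA subrK.
rewrite (cintegralZD 1 i1 (bounded_cintegrable mD Db)) iS mulr0 add0r.
apply: (le_trans (normc_cintegral mD Db)).
have : e N * (4 * vol R n) < eps by rewrite -ltr_pdivlMr// mulr_gt0.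
by rewrite -/(vol R n); lra.
Qed.

End FourierInversion.

(** * Completeness of L^2 *)

Section Completeness.
Context (R : realType) (n : nat).
Let mu := torus_measure R n.
Let r : R := 2^-1.
Implicit Types f g : L2fun R n.

Let Q (z : R[i]) := complex.Re z ^+ 2 + complex.Im z ^+ 2.

Let Q_ge0 z : 0 <= Q z.
Proof. by rewrite addr_ge0// sqr_ge0. Qed.

Let measurable_Q (h : 'rV[R]_n -> R[i]) : cmeasurable h ->
  measurable_fun setT (fun x => (Q (h x))%:E).
Proof. exact: cmeasurable_sqr. Qed.

Let r_gt0 : 0 < r. Proof. by rewrite invr_gt0. Qed.

Lemma geometric_cauchy_cvg (T : Type) (h : nat -> T -> R) (c : T -> R) :
  (forall x, 0 <= c x) ->
  (forall k x, `|h k.+1 x - h k x| <= c x * r ^+ k) ->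
  exists g : T -> R, forall x, h ^~ x @ \oo --> g x.
Proof.
(* The bound is the exact sum of the geometric series of ratio $1/2$, the form for which the
   induction closes. *)
move=> c0 hc; have hM N m x : `|h (m + N)%N x - h N x| <= c x * 2 * (r ^+ N - r ^+ (m + N)).
  elim: m => [|m IH]; first by rewrite !subrr normr0 mulr0.
  have -> : h (m.+1 + N)%N x - h N x = (h (m + N).+1 x - h (m + N)%N x) + (h (m + N)%N x - h N x).
    by rewrite addrA subrK.
  apply: (le_trans (ler_normD _ _)); apply: (le_trans (lerD (hc _ _) IH)).
  rewrite addSn exprS le_eqVlt; apply/orP; left; apply/eqP.
  by rewrite /r; field.
have [|g gP] := @cauchy_limit R T h (fun N x => c x * 2 * r ^+ N).
  move=> N M x NM; rewrite -(subnK NM); apply: (le_trans (hM _ _ _)).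
  by rewrite ler_wpM2l ?mulr_ge0// gerBl exprn_ge0// ltW.
exists g => x; apply/cvgrPdist_lt => eps eps0.
have : (fun N => c x * 2 * r ^+ N) @ \oo --> 0.
  rewrite -[X in _ --> X](mulr0 (c x * 2)); apply: cvgMr; apply: cvg_expr.
  by rewrite ger0_norm ?(ltW r_gt0)// /r invf_lt1// ltr1n.
move=> cv; have [K _ KP] := cvgr_lt _ cv _ eps0.
by exists K => // N /KP; exact: le_lt_trans (gP N x).
Qed.

Let cvg_sqr_dist (a b : nat -> R) (la lb p q : R) : a @ \oo --> la -> b @ \oo --> lb ->
  (fun k => (a k - p) * (a k - p) + (b k - q) * (b k - q)) @ \oo -->
  (la - p) * (la - p) + (lb - q) * (lb - q).
Proof.
move=> ca cb; have ca' : (fun k => a k - p) @ \oo --> la - p by apply: cvgB => //; exact: cvg_cst.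
have cb' : (fun k => b k - q) @ \oo --> lb - q by apply: cvgB => //; exact: cvg_cst.
by apply: cvgD; apply: cvgM.
Qed.

Let sqnormE f : (\int[mu]_x (Q (f x))%:E = (sqnorm f)%:E)%E.
Proof.
by rewrite /sqnorm /Rintegral fineK// (integrable_fin_num _ (integrable_sqr f)).
Qed.

(** Adding up all earlier thresholds makes [phi] monotone and puts [phi k] beyond both [k] and
    [N k]. *)
Lemma fast_subsequence (e : nat -> R) (eps : nat -> R) :
  (forall d, 0 < d -> exists N, forall M, (N <= M)%N -> e M < d) ->
  (forall k, 0 < eps k) ->
  exists phi : nat -> nat, [/\ forall k, (k <= phi k)%N, forall k, (phi k <= phi k.+1)%N &
    forall k, e (phi k) < eps k].
Proof.
move=> e_0 eps0; have /choice[N NP] : forall k, exists N, forall M, (N <= M)%N -> e M < eps k.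
  by move=> k; exact: e_0.
exists (fun k => (k + \sum_(j < k.+1) N j)%N); split => k.
- exact: leq_addr.
- by rewrite [in leqRHS]big_ord_recr/= leq_add// leq_addr.
- by apply: NP; rewrite big_ord_recr/= addnA leq_addl.
Qed.

(* Along a subsequence the increments [d k] satisfy [sqnorm (d k) <= 8^-k], so
   [sum 4^k |d k|^2] is integrable; where it is finite the subsequence converges
   geometrically, and Fatou's lemma bounds the distance to the limit. *)
Lemma L2_complete (u : nat -> L2fun R n) (e : nat -> R) :
  (forall d, 0 < d -> exists N, forall M, (N <= M)%N -> e M < d) ->
  (forall N M, (N <= M)%N -> sqnorm (u M - u N) <= e N) ->
  exists v : L2fun R n, forall N, sqnorm (v - u N) <= e N.
Proof.
move=> e_0 ue.
have rk0 k : 0 < r ^+ k by rewrite exprn_gt0.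
have [phi [phik phiS ephi]] := @fast_subsequence e (fun k => (r ^+ k) ^+ 3) e_0
  (fun k => exprn_gt0 3 (rk0 k)).
pose w k := u (phi k).
pose d k := w k.+1 - w k.
have nd k : sqnorm (d k) <= (r ^+ k) ^+ 3 by apply: (le_trans (ue _ _ (phiS k))); exact: ltW.
pose Fk k x : \bar R := (Q (d k x) / (r ^+ k) ^+ 2)%:E.
have Fk0 k x : (0 <= Fk k x)%E by rewrite lee_fin divr_ge0// exprn_ge0// ltW.
have mFk k : measurable_fun setT (Fk k).
  apply/measurable_EFinP; apply: measurable_funM => //.
  by apply/measurable_EFinP; exact: measurable_Q (L2fun_cmeasurable _).
have iFk k : (\int[mu]_x Fk k x <= (r ^+ k)%:E)%E.
  have -> : (\int[mu]_x Fk k x = (((r ^+ k) ^+ 2)^-1)%:E * \int[mu]_x (Q (d k x))%:E)%E.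
    rewrite -ge0_integralZl_EFin//.
    - by apply: eq_integral => x _; rewrite /Fk mulrC.
    - by move=> x _; rewrite lee_fin.
    - exact: (measurable_Q (L2fun_cmeasurable (d k))).
    - by rewrite invr_ge0 exprn_ge0// ltW.
  rewrite sqnormE -EFinM lee_fin mulrC ler_pdivrMr ?exprn_gt0//.
pose F x := (\sum_(0 <= k <oo) Fk k x)%E.
have F0 x : (0 <= F x)%E by apply: nneseries_ge0 => k _ _.
have mF : measurable_fun setT F by apply: ge0_emeasurable_sum => k.
have iF : (\int[mu]_x F x < +oo)%E.
  rewrite integral_nneseries//; apply: (@le_lt_trans _ _ 2%:E); last exact: ltry.
  apply: lime_le; first by apply: is_cvg_nneseries => k _ _; exact: integral_ge0.
  apply: nearW => K; apply: (@le_trans _ _ (\sum_(0 <= k < K) r ^+ k)%:E).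
    by rewrite -sumEFin; apply: lee_sum => k _.
  rewrite lee_fin; suff -> : \sum_(0 <= k < K) r ^+ k = 2 - 2 * r ^+ K.
    by rewrite gerBl mulr_ge0// ltW.
  elim: K => [|K IH]; first by rewrite big_geq// expr0 mulr1 subrr.
  by rewrite big_nat_recr//= IH exprS /r; field.
pose G := [set x | F x \is a fin_num].
have mG : measurable G by rewrite -[G]setTI; exact: emeasurable_fin_num.
have G0 : mu (~` G) = 0%E.
  have : mu.-integrable setT F.
    apply/integrableP; split=> //.
    by under eq_integral do rewrite gee0_abs//.
  move=> /(integrable_ae measurableT) [N [mN muN GN]].
  apply/eqP; rewrite -measure_le0 -muN; apply: le_measure; rewrite ?inE//.
    exact: measurableC.
  by move=> x Gx; apply: GN => /= /(_ Logic.I).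
pose c x := Num.sqrt (fine (F x)).
have dk k x : G x -> Q (d k x) <= (c x * r ^+ k) ^+ 2.
  move=> Gx; rewrite exprMn sqr_sqrtr ?fine_ge0//.
  rewrite -ler_pdivrMr ?exprn_gt0// -lee_fin fineK//.
  apply: le_trans (nneseries_lim_ge k.+1 _) => [|j _ _]; last exact: Fk0.
  by rewrite big_nat_recr//= leeDr// sume_ge0.
have cr k x : 0 <= c x * r ^+ k by rewrite mulr_ge0 ?sqrtr_ge0// ltW.
(* Multiplying by the indicator of [G] makes the sequence converge everywhere, with limit 0 off [G],
   so that the limit is measurable on the whole space. *)
pose hr k x := complex.Re (w k x) * \1_G x.
pose hi k x := complex.Im (w k x) * \1_G x.
have [gr grP] : exists g : 'rV[R]_n -> R, forall x, hr ^~ x @ \oo --> g x.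
  apply: (@geometric_cauchy_cvg _ _ c) => [x|k x]; first exact: sqrtr_ge0.
  rewrite /hr -mulrBl indicE; case: (boolP (x \in G)) => [/set_mem Gx|_]; last first.
    by rewrite mulr0 normr0.
  rewrite mulr1; have := dk k x Gx; rewrite /d L2funBE /Q => h.
  rewrite -(@ler_pXn2r _ 2)// ?nnegrE ?cr// real_normK ?num_real//.
  apply: le_trans h; move: (w k.+1 x) (w k x) => [a b] [a' b'] /=.
  by rewrite lerDl sqr_ge0.
have [gi giP] : exists g : 'rV[R]_n -> R, forall x, hi ^~ x @ \oo --> g x.
  apply: (@geometric_cauchy_cvg _ _ c) => [x|k x]; first exact: sqrtr_ge0.
  rewrite /hi -mulrBl indicE; case: (boolP (x \in G)) => [/set_mem Gx|_]; last first.
    by rewrite mulr0 normr0.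
  rewrite mulr1; have := dk k x Gx; rewrite /d L2funBE /Q => h.
  rewrite -(@ler_pXn2r _ 2)// ?nnegrE ?cr// real_normK ?num_real//.
  apply: le_trans h; move: (w k.+1 x) (w k x) => [a b] [a' b'] /=.
  by rewrite lerDr sqr_ge0.
pose v x : R[i] := gr x +i* gi x.
have mv : cmeasurable v.
  split.
    apply: (@measurable_fun_cvg _ _ _ setT hr) => [k|x _]; last exact: grP.
    by apply: measurable_funM; [exact: (L2fun_cmeasurable (w k)).1|exact: measurable_indic].
  apply: (@measurable_fun_cvg _ _ _ setT hi) => [k|x _]; last exact: giP.
  by apply: measurable_funM; [exact: (L2fun_cmeasurable (w k)).2|exact: measurable_indic].
have intG (h : 'rV[R]_n -> R[i]) : cmeasurable h ->
    (\int[mu]_x (Q (h x))%:E = \int[mu]_(x in G) (Q (h x))%:E)%E.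
  move=> mh; rewrite (@ge0_negligible_integral _ _ _ mu setT (~` G))//.
  - by rewrite setTD setCK.
  - exact: measurableC.
  - exact: measurable_Q.
  - by move=> x _; rewrite lee_fin.
have mvu N : cmeasurable (v - u N).
  by have := cmeasurableZD (-1) (L2fun_cmeasurable (u N)) mv; rewrite scaleN1r addrC.
(* The subsequence is shifted by [N]: as [phi (k + N)] is at least [N], every integral in the lower
   limit is at most [e N]. *)
have key N : (\int[mu]_x (Q ((v - u N : _ -> _) x))%:E <= (e N)%:E)%E.
  rewrite intG//.
  have -> : (\int[mu]_(x in G) (Q ((v - u N : _ -> _) x))%:E =
      \int[mu]_(x in G) limn_einf (fun k => (Q ((w (k + N)%N - u N) x))%:E))%E.
    apply: eq_integral => x /set_mem Gx; apply/esym.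
    have cv : (fun k => (Q ((w (k + N)%N - u N) x))%:E) @ \oo --> (Q ((v - u N : _ -> _) x))%:E.
      apply: cvg_EFin; first exact: nearW.
      have G1 : \1_G x = 1 :> R by rewrite indicE mem_set.
      have cr1 : (fun k => complex.Re (w (k + N)%N x)) @ \oo --> gr x.
        rewrite (_ : (fun k => _) = fun k => hr (k + N)%N x); last first.
          by apply/funext => k; rewrite /hr G1 mulr1.
        have := grP x; rewrite -(cvg_shiftn N); exact.
      have ci1 : (fun k => complex.Im (w (k + N)%N x)) @ \oo --> gi x.
        rewrite (_ : (fun k => _) = fun k => hi (k + N)%N x); last first.
          by apply/funext => k; rewrite /hi G1 mulr1.
        have := giP x; rewrite -(cvg_shiftn N); exact.
      have QE a b c' d' z z' : z = a +i* b -> z' = c' +i* d' ->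
          Q (z - z') = (a - c') * (a - c') + (b - d') * (b - d') by move=> -> ->.
      have cE (z : R[i]) : z = complex.Re z +i* complex.Im z by case: z.
      rewrite [X in X @ _ --> _](_ : _ = fun k =>
        (complex.Re (w (k + N)%N x) - complex.Re (u N x)) *
        (complex.Re (w (k + N)%N x) - complex.Re (u N x)) +
        (complex.Im (w (k + N)%N x) - complex.Im (u N x)) *
        (complex.Im (w (k + N)%N x) - complex.Im (u N x))); last first.
        by apply/funext => k; rewrite /comp L2funBE (QE _ _ _ _ _ _ (cE _) (cE _)).
      have -> : Q ((v - u N : _ -> _) x) = (gr x - complex.Re (u N x)) * (gr x - complex.Re (u N x)) +
          (gi x - complex.Im (u N x)) * (gi x - complex.Im (u N x)).
        by rewrite (QE _ _ _ _ _ _ (erefl (v x)) (cE _)).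
      exact: cvg_sqr_dist.
    by rewrite is_cvg_limn_einfE; [exact: cvg_lim|apply/cvg_ex; eexists; exact: cv].
  apply: (le_trans (fatou mu mG _ _)) => [k|k x _|].
  - by apply: measurable_funTS; exact: (measurable_Q (L2fun_cmeasurable (w (k + N)%N - u N))).
  - by rewrite lee_fin.
  rewrite limn_einf_lim; apply: lime_le; first exact: is_cvg_einfs.
  apply: nearW => k; apply: (@le_trans _ _ (\int[mu]_(x in G) (Q ((w (k + N)%N - u N) x))%:E)%E).
    by apply: ereal_inf_lbound; exists k => /=.
  rewrite -intG; last exact: L2fun_cmeasurable.
  rewrite sqnormE lee_fin; apply: ue.
  exact: leq_trans (leq_addl k N) (phik _).
have vu_in N : (v - u N : 'rV[R]_n -> R[i]) \in @square_integrable R n.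
  rewrite inE; split; first exact: mvu.
  by apply/Lnorm2_lty; apply: le_lt_trans (key N) _; exact: ltry.
(* [v] is recovered as a sum of the square integrable functions [v - u 0] and [u 0]. *)
have v_in : v \in @square_integrable R n.
  rewrite -[v](subrK (u 0%N : 'rV[R]_n -> R[i])).
  by apply: rpredD; [exact: vu_in|exact: valP].
exists (MkL2fun v_in) => N.
by rewrite -lee_fin -sqnormE; exact: key.
Qed.


End Completeness.

(** * Convergence in the test function topology *)

Section CinfTopology.
Context (R : realType) (n : nat).
Implicit Types (f : Cinf R n) (F : nat -> Cinf R n).

(** Balls of [R[i]^o] have radii in [R[i]]; a positive radius has zero imaginary part, and its real
    part serves as [eps]. *)
Let entourage_normc (E : set (R[i]^o * R[i]^o)) : entourage E ->
  exists2 eps : R, 0 < eps & forall z w : R[i], Normc.normc (z - w) < eps -> E (z, w).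
Proof.
rewrite -entourage_ballE => -[e /= e0 eE].
move: e0; rewrite ltcE => /andP[/eqP /= ei er]; exists (complex.Re e) => // z w zw.
apply: eE; rewrite /= -ball_normE /= /ball_/= ltcE /= -ei eqxx /=.
exact: zw.
Qed.

Let normc_entourage (eps : R) : 0 < eps ->
  entourage [set p : R[i]^o * R[i]^o | Normc.normc (p.1 - p.2) < eps].
Proof.
move=> eps0; rewrite -entourage_ballE; exists eps%:C => /=; first by rewrite ltcR.
by move=> [z w] /=; rewrite -ball_normE /= /ball_/= ltcE /= => /andP[_].
Qed.

Lemma Cinf_cvg F f :
  (forall b (eps : R), 0 < eps -> exists N, forall M, (N <= M)%N ->
    forall x, Normc.normc (cmpartial b f x - cmpartial b (F M) x) < eps) ->
  F @ \oo --> f.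
Proof.
move=> Ff; apply/cvg_sup => b A [_ [[B Bop <-] /= Bf sBA]].
have : nbhs (cmpartial b f : {uniform 'rV[R]_n -> R[i]^o}) B by exact: open_nbhs_nbhs.
move=> /uniform_nbhs[E [/entourage_normc[eps eps0 eE] EB]].
have [N NP] := Ff b eps eps0.
exists N => // M /NP h; apply: sBA; apply: EB => y _.
by apply: eE; exact: h.
Qed.

(** The component of the topology at the multi-index 0 is uniform convergence of the functions
    themselves. *)
Lemma Cinf_cvg_uniform F f : F @ \oo --> f ->
  forall eps : R, 0 < eps -> exists N, forall M, (N <= M)%N ->
    forall x, Normc.normc (f x - F M x) < eps.
Proof.
move=> /cvg_sup/(_ (fun=> 0%N)) Ff eps eps0.
pose B : set {uniform 'rV[R]_n -> R[i]^o} :=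
  [set h | forall y, Normc.normc (cmpartial (fun=> 0%N) f y - h y) < eps].
have nB : nbhs (cmpartial (fun=> 0%N) f : {uniform 'rV[R]_n -> R[i]^o}) B.
  apply/uniform_nbhs; exists [set p | Normc.normc (p.1 - p.2) < eps]; split.
    exact: normc_entourage.
  by move=> h hP y; exact: hP.
have /Ff[N _ NP] := @initial_continuous (Cinf R n) _ (fun f : Cinf R n =>
  cmpartial (fun=> 0%N) f : {uniform 'rV[R]_n -> R[i]^o}) f B nB.
have c0 (g : Cinf R n) x : cmpartial (fun=> 0%N) g x = g x.
  by rewrite -DmE /Dm; congr (Cinf_fun _ x); elim: (enum _).
exists N => M /NP h x; have := h x.
by rewrite /= !c0.
Qed.

(** Partial sums commute with derivatives, so inversion applied to [Dm b f] gives uniform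
    convergence of the derivative of index [b]. *)
Lemma fourier_cvg f : (fun N => fourier_sum N (toL2 f)) @ \oo --> f.
Proof.
apply: Cinf_cvg => b eps eps0.
have [e [e_0 eP]] := fourier_inversion (Dm b f).
have [N NP] := e_0 eps eps0; exists N => M /NP eM x.
by rewrite -!DmE Dm_fourier_sum; exact: le_lt_trans (eP M x) eM.
Qed.

End CinfTopology.

(** * The symbol estimate *)

Section SymbolEstimate.
Context (R : realType) (n : nat).
Implicit Types (f g : Cinf R n) (xi eta : 'rV[int]_n).
Let mu := torus_measure R n.

Lemma sqnorm_normc f : sqnorm (toL2 f) = Rintegral mu setT (fun x => Normc.normc (f x) ^+ 2).
Proof. by apply: eq_Rintegral => x _; rewrite normc_sqr. Qed.

Lemma integrable_normc f : mu.-integrable setT (EFin \o (fun x => Normc.normc (f x) ^+ 2)).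
Proof.
have := integrable_sqr (toL2 f); congr (_.-integrable _ _).
by apply/funext => x; rewrite /comp -normc_sqr.
Qed.

Lemma sqnorm_le_sum (I : Type) (s : seq I) (c : I -> R) (m : I -> Cinf R n) f :
  (forall x, Normc.normc (f x) ^+ 2 <= \sum_(i <- s) c i * Normc.normc (m i x) ^+ 2) ->
  sqnorm (toL2 f) <= \sum_(i <- s) c i * sqnorm (toL2 (m i)).
Proof.
move=> fm; have [is_ ->] :
    mu.-integrable setT (EFin \o (fun x => \sum_(i <- s) c i * Normc.normc (m i x) ^+ 2)) /\
    \sum_(i <- s) c i * sqnorm (toL2 (m i)) =
    Rintegral mu setT (fun x => \sum_(i <- s) c i * Normc.normc (m i x) ^+ 2).
  elim: s {fm} => [|i s [IH1 IH2]].
    rewrite big_nil; under eq_fun do rewrite big_nil.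
    by rewrite /Rintegral integral0; split=> //; exact: integrable0.
  have ic : mu.-integrable setT (EFin \o (fun x => c i * Normc.normc (m i x) ^+ 2)).
    exact: (integrableZl measurableT (c i) (integrable_normc (m i))).
  rewrite big_cons IH2; under eq_fun do rewrite big_cons.
  split; first exact: (integrableD measurableT ic IH1).
  by rewrite RintegralD// RintegralZl ?sqnorm_normc//; exact: integrable_normc.
by rewrite sqnorm_normc; apply: le_Rintegral => //; exact: integrable_normc.
Qed.

(** Sums $2ta_i\le w_ia_i^2+t^2/w_i$ at the optimal $t=X/W$. Here [W] is a bound for $\sum 1/w_i$
    rather than its value, so that one constant serves all truncations. *)
Lemma weighted_cauchy_schwarz (I : Type) (s : seq I) (w a : I -> R) (W : R) :
  0 < W -> (forall i, 0 < w i) -> \sum_(i <- s) (w i)^-1 <= W ->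
  (\sum_(i <- s) a i) ^+ 2 <= W * \sum_(i <- s) w i * a i ^+ 2.
Proof.
move=> W0 w0 sW; set X := \sum_(i <- s) a i; set Y := \sum_(i <- s) _.
pose t := X / W.
have h : 2 * t * X <= Y + t ^+ 2 * W.
  apply: (@le_trans _ _ (Y + t ^+ 2 * \sum_(i <- s) (w i)^-1)); last first.
    by rewrite lerD2l ler_wpM2l// sqr_ge0.
  rewrite !mulr_sumr -big_split; apply: ler_sum => i _ /=.
  rewrite -subr_ge0.
  have -> : w i * a i ^+ 2 + t ^+ 2 / w i - 2 * t * a i = (w i * a i - t) ^+ 2 / w i.
    by field; rewrite gt_eqF.
  by rewrite divr_ge0 ?sqr_ge0 ?ltW.
have tW : t * W = X by rewrite /t divfK// gt_eqF.
have -> : X ^+ 2 = W * (2 * t * X - t ^+ 2 * W) by rewrite -tW; ring.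
by rewrite ler_wpM2l ?(ltW W0)// lerBlDr.
Qed.

Lemma Dm_single k i f : Dm (fun j => if j == i then k else 0%N) f = iter k (Dc i) f.
Proof.
rewrite /Dm; suff H (s : seq 'I_n) : uniq s ->
    foldr (fun j h => iter (if j == i then k else 0%N) (Dc j) h) f s =
    if i \in s then iter k (Dc i) f else f.
  by rewrite H ?enum_uniq// mem_enum.
elim: s => //= j s IH /andP[js us]; rewrite inE IH//.
by case: eqVneq js => [->|ij] js; rewrite 1?eq_sym ?eqxx ?(negbTE js)// eq_sym (negbTE ij).
Qed.

Context (A : {linear Cinf R n -> Cinf R n}) (C : R).

(** The symbol at a fixed frequency, bundled as an element of [Cinf] so that Fourier inversion and
    Bessel's inequality apply to it. *)
Definition symbolC xi : Cinf R n := mulC (e_ (- xi)) (A (e_ xi)).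

Lemma symbolCE xi x : symbolC xi x = symbol A x xi.
Proof. by rewrite mulCE characterN /symbol expiN. Qed.

Lemma A_characterE xi x : A (e_ xi) x = e_ xi x * symbolC xi x.
Proof. by rewrite mulCE mulrA -characterD subrr character0 mul1r. Qed.

Let k := (n./2).+1.

Hypothesis A_symbol_bound :
  forall (x : 'rV[R]_n) (xi : 'rV[int]_n) (beta : 'I_n -> nat),
    (\sum_(i < n) beta i)%N%:R <= n%:R / 2 + 1 :> R ->
    Normc.normc (cmpartial beta (fun y => symbol A y xi) x) <= C.

Let symbolC_bound xi beta x : (\sum_(i < n) beta i)%N%:R <= n%:R / 2 + 1 :> R ->
  Normc.normc (Dm beta (symbolC xi) x) <= C.
Proof.
move=> hb; rewrite DmE (_ : (symbolC xi : _ -> _) = fun y => symbol A y xi).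
  exact: A_symbol_bound.
by apply/funext => y; exact: symbolCE.
Qed.

Let k_le : k%:R <= n%:R / 2 + 1 :> R.
Proof.
rewrite /k -natr1 lerD2r ler_pdivlMr// -natrM ler_nat muln2.
by rewrite -[leqRHS](odd_double_half n) leq_addl.
Qed.

Lemma symbolC_weighted xi (s : seq 'rV[int]_n) : uniq s ->
  \sum_(eta <- s) weight R k eta * Normc.normc (hat (toL2 (symbolC xi)) eta) ^+ 2 <=
  n.+1%:R * C ^+ 2.
Proof.
move=> us; apply: weighted_bessel => // [x|i x].
  rewrite (_ : symbolC xi = Dm (fun=> 0%N) (symbolC xi)); last first.
    by rewrite /Dm; elim: (enum _).
  by apply: symbolC_bound; rewrite big1// addr_ge0// divr_ge0.
rewrite -Dm_single; apply: symbolC_bound.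
by rewrite -big_mkcond big_pred1_eq; exact: k_le.
Qed.

(** The product of the bound for $\sum 1/w$ and the bound $(n+1)C^2$ for the weighted coefficients;
    the leading 2 pays for replacing [A p] by a truncation. *)
Definition symbol_constant : R := 2 * (n.+1%:R ^+ n.+1 * 3 ^+ n * (n.+1%:R * C ^+ 2)).

Lemma symbol_constant_ge0 : 0 <= symbol_constant.
Proof.
have h1 : 0 <= n.+1%:R ^+ n.+1 :> R by exact: exprn_ge0.
have h2 : 0 <= 3 ^+ n :> R by exact: exprn_ge0.
have h3 : 0 <= n.+1%:R * C ^+ 2 by apply: mulr_ge0 => //; exact: sqr_ge0.
by apply: mulr_ge0 => //; apply: mulr_ge0 => //; exact: mulr_ge0.
Qed.

(* The symbol is expanded in a Fourier series in [x]: [A p] becomes a sum over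
   [eta] of [e_ eta] times the Fourier multiplier [m eta] applied to [p], and
   Cauchy-Schwarz with the weight is applied to the sum over [eta]. *)
Lemma sqnorm_A_trig (c : 'rV[int]_n -> R[i]) (s : seq 'rV[int]_n) : uniq s ->
  sqnorm (toL2 (A (\sum_(xi <- s) c xi *: e_ xi))) <=
  symbol_constant * (vol R n * \sum_(xi <- s) Normc.normc (c xi) ^+ 2).
Proof.
move=> us; set W := n.+1%:R ^+ n.+1 * 3 ^+ n : R.
have W0 : 0 < W by rewrite mulr_gt0// exprn_gt0.
have nk : (n.+1 <= k.*2)%N by rewrite /k; lia.
pose a eta xi := hat (toL2 (symbolC xi)) eta.
pose m eta : Cinf R n := \sum_(xi <- s) (c xi * a eta xi) *: e_ xi.
(* [A p] with each symbol replaced by its [N]-th Fourier partial sum: all sums are finite, and the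
   estimate [nP] does not depend on [N]. *)
pose P N : Cinf R n := \sum_(xi <- s) c xi *: mulC (e_ xi) (fourier_sum N (toL2 (symbolC xi))).
have PE N x : P N x = \sum_(eta <- lattice_enum n N) e_ eta x * m eta x.
  rewrite /P Cinf_sumE.
  under eq_bigr do rewrite CinfZE mulCE /fourier_sum Cinf_sumE 2!mulr_sumr.
  rewrite exchange_big; apply: eq_bigr => eta _.
  rewrite /m Cinf_sumE mulr_sumr; apply: eq_bigr => xi _.
  by rewrite !CinfZE -/(a eta xi); ring.
have nP N : sqnorm (toL2 (P N)) <=
    W * (n.+1%:R * C ^+ 2) * (vol R n * \sum_(xi <- s) Normc.normc (c xi) ^+ 2).
  have := @sqnorm_le_sum _ (lattice_enum n N) (fun eta => W * weight R k eta) m (P N).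
  move=> /(_ _)/le_trans; apply.
    move=> x; rewrite PE.
    apply: (@le_trans _ _ ((\sum_(eta <- lattice_enum n N) Normc.normc (m eta x)) ^+ 2)).
      rewrite ler_pXn2r ?nnegrE ?normc_ge0 ?sumr_ge0// => [|eta _]; last exact: normc_ge0.
      apply: (le_trans (normc_sum _ _)); apply: ler_sum => eta _.
      by rewrite Normc.normcM normc_character mul1r.
    rewrite [leRHS](eq_bigr (fun eta => W * (weight R k eta * Normc.normc (m eta x) ^+ 2))); last first.
      by move=> eta _; rewrite [RHS]mulrA.
    rewrite -mulr_sumr; apply: weighted_cauchy_schwarz => // [eta|].
      exact: weight_gt0.
    by apply: sum_weight_le => //; exact: lattice_enum_uniq.
  rewrite (eq_bigr (fun eta => W * (weight R k eta *
      (vol R n * \sum_(xi <- s) Normc.normc (c xi * a eta xi) ^+ 2)))); last first.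
    by move=> eta _; rewrite /m sqnorm_trig// [RHS]mulrA.
  rewrite -mulr_sumr -mulrA ler_wpM2l ?(ltW W0)//.
  under eq_bigr do rewrite mulrCA.
  rewrite -mulr_sumr mulrCA ler_wpM2l ?(ltW (vol_gt0 R n))//.
  under eq_bigr do rewrite mulr_sumr.
  rewrite exchange_big/= mulr_sumr; apply: ler_sum => xi _.
  under eq_bigr do rewrite Normc.normcM exprMn mulrCA.
  rewrite -mulr_sumr mulrC ler_wpM2r ?sqr_ge0//.
  by apply: symbolC_weighted; exact: lattice_enum_uniq.
have AE x : A (\sum_(xi <- s) c xi *: e_ xi) x = \sum_(xi <- s) c xi * (e_ xi x * symbolC xi x).
  rewrite linear_sum Cinf_sumE; apply: eq_bigr => xi _.
  by rewrite linearZ CinfZE A_characterE.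
(* The rates of convergence depend on the frequency, but only those in [s] occur, so a maximum over
   [s] gives a common [N]. The summand 1 in [B] keeps the divisor positive. *)
have close (d : R) : 0 < d -> exists N, forall x,
    Normc.normc (A (\sum_(xi <- s) c xi *: e_ xi) x - P N x) <= d.
  move=> d0.
  have /choice[e eP] : forall xi, exists e : nat -> R,
      (forall eps, 0 < eps -> exists N, forall M, (N <= M)%N -> e M < eps) /\
      forall N x, Normc.normc (symbolC xi x - fourier_sum N (toL2 (symbolC xi)) x) <= e N.
    by move=> xi; exact: fourier_inversion.
  pose B := 1 + \sum_(xi <- s) Normc.normc (c xi).
  have B0 : 0 < B by rewrite ltr_pwDl// sumr_ge0// => xi _; exact: normc_ge0.
  have /choice[N NP] : forall xi, exists N, forall M, (N <= M)%N -> e xi M < d / B.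
    by move=> xi; have [+ _] := eP xi; apply; rewrite divr_gt0.
  exists (\max_(xi <- s) N xi) => x; rewrite AE /P Cinf_sumE -sumrB.
  apply: (le_trans (normc_sum _ _)).
  apply: (@le_trans _ _ (\sum_(xi <- s) Normc.normc (c xi) * (d / B))).
    rewrite big_seq [leRHS]big_seq; apply: ler_sum => xi xis.
    rewrite CinfZE mulCE -!mulrBr !Normc.normcM normc_character mul1r.
    rewrite ler_wpM2l ?normc_ge0//.
    have [_ h] := eP xi; apply: (le_trans (h _ x)); apply/ltW/NP.
    exact: (leq_bigmax_seq xi xis isT).
  rewrite -mulr_suml mulrA ler_pdivrMr// mulrC ler_wpM2l ?(ltW d0)//.
  by rewrite /B lerDr.
apply/ler_addgt0Pr => eps eps0.
have V0 := vol_gt0 R n.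
(* The error then has squared norm at most [eps / 2], which [sqnormD_le] doubles. *)
pose d := Num.sqrt (eps / (2 * vol R n)).
have d0 : 0 < d by rewrite sqrtr_gt0 divr_gt0// mulr_gt0.
have dsq : d ^+ 2 = eps / (2 * vol R n) by rewrite sqr_sqrtr// divr_ge0 ?mulr_ge0 ?ltW.
have [N NP] := close d d0.
have -> : A (\sum_(xi <- s) c xi *: e_ xi) =
    P N + (A (\sum_(xi <- s) c xi *: e_ xi) - P N) by rewrite addrC subrK.
rewrite toL2D; apply: (le_trans (sqnormD_le _ _)); apply: lerD.
  by rewrite /symbol_constant -/W -[leRHS]mulrA ler_wpM2l.
have h : sqnorm (toL2 (A (\sum_(xi <- s) c xi *: e_ xi) - P N)) <= vol R n * d ^+ 2.
  by apply: sqnorm_le => x; rewrite CinfBE.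
apply: (@le_trans _ _ (2 * (vol R n * d ^+ 2))); first by rewrite ler_wpM2l.
by rewrite dsq le_eqVlt; apply/orP; left; apply/eqP; field; rewrite gt_eqF.
Qed.

End SymbolEstimate.

(** * The extension *)

Section Extension.
Context (R : realType) (n : nat) (A : {linear Cinf R n -> Cinf R n}) (K : R).
Implicit Types (u v : L2fun R n).
Hypothesis K0 : 0 <= K.
Hypothesis A_bound : forall (c : 'rV[int]_n -> R[i]) (s : seq 'rV[int]_n), uniq s ->
  sqnorm (toL2 (A (\sum_(xi <- s) c xi *: e_ xi))) <=
  K * (vol R n * \sum_(xi <- s) Normc.normc (c xi) ^+ 2).

(** One-sided, because the sequences concerned are upper bounds for nonnegative quantities. *)
Definition tends_to0 (e : nat -> R) :=
  forall d, 0 < d -> exists N, forall M, (N <= M)%N -> e M < d.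

(** The graph of the extension on representatives: [v] is a limit in $L^2$ of $A S_N u$. An explicit
    rate is carried along, in the form supplied by [L2_complete]. *)
Definition extends_to u v := exists2 e, tends_to0 e &
  forall N, sqnorm (v - toL2 (A (fourier_sum N u))) <= e N.

Let tends_to0D (a b : R) e e' : 0 <= a -> 0 <= b -> tends_to0 e -> tends_to0 e' ->
  tends_to0 (fun N => a * e N + b * e' N).
Proof.
move=> a0 b0 e_0 e'_0 d d0.
have p (c : R) : 0 <= c -> 0 < c + 1 by move=> c0; rewrite ltr_pwDr.
(* The divisor is [c + 1] because the coefficients may be zero. *)
have q (c : R) : 0 <= c -> 0 < d / (2 * (c + 1)) by move=> c0; rewrite divr_gt0// mulr_gt0// p.
have [N NP] := e_0 _ (q _ a0); have [N' NP'] := e'_0 _ (q _ b0).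
have le (c t : R) : 0 <= c -> t < d / (2 * (c + 1)) -> c * t < d / 2.
  move=> c0 ct; apply: (@le_lt_trans _ _ (c * (d / (2 * (c + 1))))).
    by rewrite ler_wpM2l// ltW.
  rewrite -subr_gt0; have -> : d / 2 - c * (d / (2 * (c + 1))) = d / (2 * (c + 1)).
    by field; rewrite gt_eqF// p.
  exact: q.
exists (maxn N N') => M; rewrite geq_max => /andP[/NP h /NP' h'].
by rewrite [ltRHS]splitr; apply: ltrD; exact: le.
Qed.

Lemma extends_exists u : exists v, extends_to u v.
Proof.
pose c xi := Normc.normc (hat u xi) ^+ 2.
have V0 := vol_gt0 R n.
have cB N : \sum_(xi <- lattice_enum n N) c xi <= sqnorm u / vol R n.
  by rewrite ler_pdivlMr// mulrC; exact: bessel_hat (lattice_enum_uniq n N).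
have [e [e_0 eP]] := @bounded_sum_tail R _ c (lattice_enum n) _
  (fun xi => sqr_ge0 _) (@lattice_enum_cat n) cB.
(* The term [0 * e N] only brings the sequence into the shape of [tends_to0D]. *)
pose e' N := K * vol R n * e N + 0 * e N.
have e'_0 : tends_to0 e' by apply: tends_to0D => //; rewrite mulr_ge0// ltW.
have [|v vP] := @L2_complete R n (fun N => toL2 (A (fourier_sum N u))) e' e'_0.
  move=> N M NM; have [t zE] := lattice_enum_cat n NM.
  have ut : uniq t by have := lattice_enum_uniq n M; rewrite zE cat_uniq => /and3P[].
  have -> : toL2 (A (fourier_sum M u)) - toL2 (A (fourier_sum N u)) =
      toL2 (A (\sum_(xi <- t) hat u xi *: e_ xi)).
    rewrite -toL2B -linearB; congr (toL2 (A _)).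
    have -> : fourier_sum M u = fourier_sum N u + \sum_(xi <- t) hat u xi *: e_ xi.
      by rewrite /fourier_sum zE big_cat.
    by rewrite addrAC subrr add0r.
  apply: (le_trans (A_bound _ ut)); rewrite /e' mul0r addr0 -mulrA.
  rewrite ler_wpM2l// ler_wpM2l ?(ltW V0)//.
  by apply: le_trans (eP N M NM); rewrite zE big_cat/= [leRHS]addrC addKr.
by exists v; exists e'.
Qed.

(** Fourier coefficients depend only on the class, so [u] and [u'] have the same approximating
    sequence, and its limit is determined up to a null function. *)
Lemma extends_unique u u' v v' : L2class u = L2class u' ->
  extends_to u v -> extends_to u' v' -> L2class v = L2class v'.
Proof.
move=> uu' [e e_0 eP] [e' e'_0 eP'].
suff h : sqnorm (v - v') = 0.
  apply/eqP; rewrite -subr_eq0 -[L2class v - _](raddfB (\pi_(Quotient.quot (@L2null R n)))%qT).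
  by apply/eqP/sqnorm_eq0.
apply/eqP; rewrite eq_le sqnorm_ge0 andbT; apply/ler_addgt0Pr => d d0; rewrite add0r.
have [N NP] := tends_to0D (ler0n R 2) (ler0n R 2) e_0 e'_0 d0.
apply: le_trans (ltW (NP N (leqnn N))).
have -> : v - v' = (v - toL2 (A (fourier_sum N u))) + - (v' - toL2 (A (fourier_sum N u'))).
  by rewrite (eq_fourier_sum N uu') opprB addrA subrK.
apply: (le_trans (sqnormD_le _ _)); rewrite sqnormN.
by apply: lerD; rewrite ler_wpM2l.
Qed.

Lemma extends_linear (a : R[i]) u u' v v' : extends_to u v -> extends_to u' v' ->
  extends_to (a *: u + u') (a *: v + v').
Proof.
move=> [e e_0 eP] [e' e'_0 eP'].
exists (fun N => 2 * Normc.normc a ^+ 2 * e N + 2 * e' N).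
  by apply: tends_to0D => //; rewrite mulr_ge0// sqr_ge0.
move=> N; have -> : a *: v + v' - toL2 (A (fourier_sum N (a *: u + u'))) =
    a *: (v - toL2 (A (fourier_sum N u))) + (v' - toL2 (A (fourier_sum N u'))).
  by rewrite fourier_sumZD linearP toL2ZD scalerBr opprD addrACA.
apply: (le_trans (sqnormD_le _ _)); rewrite sqnormZ -mulrA; apply: lerD.
  by rewrite ler_wpM2l// ler_wpM2l ?sqr_ge0.
by rewrite ler_wpM2l.
Qed.

(** Bessel's inequality bounds every $A S_N u$ by $K\|u\|^2$; the 2 is lost when passing to the
    limit through [sqnormD_le]. *)
Lemma extends_bounded u v : extends_to u v -> sqnorm v <= 2 * K * sqnorm u.
Proof.
move=> [e e_0 eP]; apply/ler_addgt0Pr => d d0.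
have [N NP] := e_0 (d / 2) (divr_gt0 d0 (ltr0n _ 2)).
have -> : v = toL2 (A (fourier_sum N u)) + (v - toL2 (A (fourier_sum N u))) by rewrite addrC subrK.
apply: (le_trans (sqnormD_le _ _)); apply: lerD.
  rewrite -mulrA ler_wpM2l//; apply: (le_trans (A_bound _ (lattice_enum_uniq n N))).
  by rewrite ler_wpM2l//; exact: bessel_hat (lattice_enum_uniq n N).
have := eP N; have := NP N (leqnn N); lra.
Qed.

(** This is where continuity of [A] enters: $S_Nf\to f$ in the test function topology gives uniform
    convergence of $AS_Nf$ to $Af$, hence convergence in $L^2$ as the measure is finite. *)
Lemma extends_smooth f : continuous A -> extends_to (toL2 f) (toL2 (A f)).
Proof.
move=> cA; have V0 := vol_gt0 R n.
have cv : (fun N => A (fourier_sum N (toL2 f))) @ \oo --> A f.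
  exact: (cvg_comp _ _ (@fourier_cvg R n f) (cA f)).
pose e N := sqnorm (toL2 (A f) - toL2 (A (fourier_sum N (toL2 f)))).
exists e => // d d0; pose t := Num.sqrt (d / (2 * vol R n)).
have t0 : 0 < t by rewrite sqrtr_gt0 divr_gt0// mulr_gt0.
have tsq : t ^+ 2 = d / (2 * vol R n) by rewrite sqr_sqrtr// divr_ge0 ?mulr_ge0 ?ltW.
have [N NP] := Cinf_cvg_uniform cv t0; exists N => M /NP h.
rewrite /e -toL2B; apply: (@le_lt_trans _ _ (vol R n * t ^+ 2)).
  by apply: sqnorm_le => x; rewrite CinfBE; exact/ltW/h.
have -> : vol R n * t ^+ 2 = d / 2 by rewrite tsq; field; rewrite gt_eqF.
by rewrite ltr_pdivrMr// ltr_pMr// ltr1n.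
Qed.

End Extension.

Theorem proposition5p1 (R : realType) (n : nat)
  (A : {linear Cinf R n -> Cinf R n})
  (A_continuous : continuous A)
  (C : R)
  (A_symbol_bound :
    forall (x : 'rV[R]_n) (xi : 'rV[int]_n) (beta : 'I_n -> nat),
      (\sum_(i < n) beta i)%N%:R <= n%:R / 2 + 1 :> R ->
      Normc.normc (cmpartial beta (fun y => symbol A y xi) x) <= C) :
  exists T : {linear L2 R n -> L2 R n},
    (exists M : R, forall u : L2 R n, L2norm (T u) <= M * L2norm u) /\
    (forall f : Cinf R n, T (L2_of_Cinf f) = L2_of_Cinf (A f)).
Proof.
have K0 := symbol_constant_ge0 n C.
have A_bound := sqnorm_A_trig A_symbol_bound.
set K := symbol_constant n C in K0 A_bound.
have ext (u : L2 R n) : {v : L2fun R n | extends_to A (repr u)%qT v}.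
  by apply: cid; exact: extends_exists K0 A_bound _.
pose T (u : L2 R n) : L2 R n := L2class (sval (ext u)).
(* Frees [T] from the choices of representative and of limit made in [ext]: any related pair
   computes it. *)
have TE u v : extends_to A u v -> T (L2class u) = L2class v.
  by move=> uv; apply: extends_unique (svalP (ext _)) uv; exact: L2class_surj.
have T_linear : linear T.
  move=> a u u'; have h := extends_linear a (svalP (ext u)) (svalP (ext u')).
  have -> : a *: u + u' = L2class (a *: (repr u)%qT + (repr u')%qT).
    by rewrite L2classD -L2classZ !L2class_surj.
  by rewrite (TE _ _ h) L2classD -L2classZ.
pose mT := GRing.isLinear.Build R[i] (L2 R n) (L2 R n) *:%R T T_linear.
pose TL : {linear L2 R n -> L2 R n} := HB.pack T mT.
exists TL; split.
  exists (Num.sqrt (2 * K)) => u.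
  rewrite -[X in _ * L2norm X]L2class_surj [TL u]/(T u) /T !L2norm_sqnorm.
  rewrite -sqrtrM; last by apply: mulr_ge0 => //; exact: K0.
  by apply: ler_wsqrtr; have := extends_bounded K0 A_bound (svalP (ext u)).
by move=> f; apply: TE; exact: extends_smooth.
Qed.
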